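(* Assume bounded expectation, flatness, and boundedness of the self-consistent Green function near some $\tau_0\in\mathbb R$ (as defined in the context). If $\tau_0\in\partial\operatorname{supp}\varrho$ is a regular edge, then there are $c\sim1$ and $\delta_*\sim1$ and a sign $s\in\{+1,-1\}$ ($s=+1$ if $\tau_0$ is a right edge, $s=-1$ if it is a left edge) such that $$\varrho(\tau_0+s\,\omega)=\begin{cases}c\,|\omega|^{1/2}+\mathcal O(|\omega|),&\omega\in[-\delta_*,0],\\ 0,&\omega\in[0,\delta_*].\end{cases}$$
   Context: **Setting.** For every $N\in\mathbb N$ let $A=A^*\in\mathbb C^{N\times N}$ be deterministic and $\mathcal S[R]=\mathbb E\,WRW$ for $R\in\mathbb C^{N\times N}$, where $W=W^*\in\mathbb C^{N\times N}$ is a random matrix with $\mathbb EW=0$ and finite second moments (real symmetric or complex Hermitian). $\|R\|$ is the operator norm of a matrix, $\langle R\rangle=N^{-1}\operatorname{Tr}R$, $\mathbb H=\{z\in\mathbb C:\Im z>0\}$. $M=M(z)$, $z\in\mathbb H$, is the unique solution of the Matrix Dyson Equation $1+(z-A+\mathcal S[M])M=0$ with $\Im M=(M-M^* )/(2\mathrm i)>0$. Set $\varrho(z)=\pi^{-1}\Im\langle M(z)\rangle$ for $z\in\mathbb H$ and $\varrho(\tau)=\lim_{\eta\searrow0}\varrho(\tau+\mathrm i\eta)$ for $\tau\in\mathbb R$ (the limit exists and $\varrho$ is continuous under bounded expectation and flatness); $\operatorname{supp}\varrho$ is the support of $\varrho|_{\mathbb R}$. **Assumptions** (constants independent of $N$).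 - *Bounded expectation:* $\|A\|\le C$. - *Flatness:* $c\langle T\rangle\le\mathcal S[T]\le C\langle T\rangle$ for every positive semidefinite $T$, for constants $0<c<C$. - *Bounded self-consistent Green function near $\tau_0$:* there are $\omega_*,M_*>0$ with $\sup\{\|M(z)\|:\ z\in\mathbb H,\ |\Re z-\tau_0|\le\omega_*,\ 0<\Im z\le1\}\le M_*$. **Regular edge.** $\tau_0\in\partial\operatorname{supp}\varrho$ is regular if $\lim_{\operatorname{supp}\varrho\ni\tau\to\tau_0}\varrho(\tau)/\sqrt{|\tau-\tau_0|}=\gamma_{\mathrm{edge}}^{3/2}/\pi$ exists with $0<c_*\le\gamma_{\mathrm{edge}}\le c^*<\infty$ for some constants $c_*,c^*$. **Comparison relations.** $f\lesssim g$, $f=\mathcal O(g)$ and $f\sim g$ (i.e. $f\lesssim g\lesssim f$) hold up to positive constants depending only on the constant $C$ in bounded expectation, the constants $c,C$ in flatness, the constants $\omega_*,M_*$ in the bounded self-consistent Green function assumption, and the constants $c_*,c^*$ in the definition of a regular edge (in particular not on $N$). *)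

(* Defs.v *)
From HB Require Import structures.
From mathcomp Require Import all_boot all_order all_algebra.
From mathcomp Require Import all_classical all_reals all_analysis.
From mathcomp Require Import complex.

Set Implicit Arguments.
Unset Strict Implicit.
Unset Printing Implicit Defensive.

Import Order.TTheory GRing.Theory Num.Theory.
Import numFieldNormedType.Exports.

Local Open Scope classical_set_scope.
Local Open Scope ring_scope.
Local Open Scope complex_scope.
Local Open Scope sesquilinear_scope.

Section Matrices.
Context {R : realType}.

Definition l2norm (n : nat) (x : 'cV[R[i]]_n) : R :=
  Num.sqrt (\sum_(k < n) (complex.Re (x k 0) ^+ 2 + complex.Im (x k 0) ^+ 2)).

Definition opnorm (n : nat) (A : 'M[R[i]]_n) : R :=
  sup [set l2norm (A *m x) | x in [set x : 'cV[R[i]]_n | l2norm x <= 1]].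

Definition selfadjoint (n : nat) (A : 'M[R[i]]_n) : Prop := A ^t* = A.

(* In R[i], [0 <= z] means that z is real and nonnegative. *)
Definition psd (n : nat) (A : 'M[R[i]]_n) : Prop :=
  selfadjoint A /\ forall x : 'cV[R[i]]_n, 0 <= (x ^t* *m A *m x) 0 0.

Definition posdef (n : nat) (A : 'M[R[i]]_n) : Prop :=
  selfadjoint A /\
  forall x : 'cV[R[i]]_n, x != 0 -> 0 < (x ^t* *m A *m x) 0 0.

Definition loewner_le (n : nat) (A B : 'M[R[i]]_n) : Prop := psd (B - A).

Definition ImM (n : nat) (A : 'M[R[i]]_n) : 'M[R[i]]_n :=
  (2 * (0 +i* 1))^-1 *: (A - A ^t*).

Definition ntr (n : nat) (A : 'M[R[i]]_n) : R[i] := \tr A / n%:R.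

End Matrices.

Section RandomMatrix.
Context {R : realType} {d : measure_display} {T : measurableType d}.
Variable P : probability T R.

Definition Ec (X : T -> R[i]) : R[i] :=
  fine 'E_P[fun w => complex.Re (X w)] +i* fine 'E_P[fun w => complex.Im (X w)].

(* A centered Hermitian random matrix with square-integrable entries; the real
   symmetric case is the one where all imaginary parts vanish. *)
Definition centered_hermitian_random_matrix (n : nat)
    (W : T -> 'M[R[i]]_n) : Prop :=
  [/\ forall w, selfadjoint (W w),
      forall k l, (fun w => complex.Re (W w k l)) \in Lfun P 2%:E,
      forall k l, (fun w => complex.Im (W w k l)) \in Lfun P 2%:E
    & forall k l, Ec (fun w => W w k l) = 0].

Definition self_energy (n : nat) (W : T -> 'M[R[i]]_n) (B : 'M[R[i]]_n) :
    'M[R[i]]_n :=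
  \matrix_(k, l) Ec (fun w => (W w *m B *m W w) k l).

End RandomMatrix.

Section DysonEquation.
Context {R : realType} {n : nat}.
Implicit Types (A : 'M[R[i]]_n) (S : 'M[R[i]]_n -> 'M[R[i]]_n).
Implicit Types (M : R[i] -> 'M[R[i]]_n) (z : R[i]).

Definition upper_half z : Prop := 0 < complex.Im z.

Definition solves_MDE A S z (X : 'M[R[i]]_n) : Prop :=
  1%:M + (z%:M - A + S X) *m X = 0 /\ posdef (ImM X).

Definition is_MDE_solution A S M : Prop :=
  forall z, upper_half z -> unique (solves_MDE A S z) (M z).

Definition scdosH M z : R := complex.Im (ntr (M z)) / pi.

Definition scdos M (tau : R) : R :=
  lim (scdosH M (tau +i* eta) @[eta --> 0^'+]).

Definition flat S (c C : R) : Prop :=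
  forall B : 'M[R[i]]_n, psd B ->
    loewner_le (c%:C * ntr B)%:M (S B) /\ loewner_le (S B) (C%:C * ntr B)%:M.

Definition green_bounded_near M (tau0 omega C : R) : Prop :=
  forall z, upper_half z -> `|complex.Re z - tau0| <= omega ->
    complex.Im z <= 1 -> opnorm (M z) <= C.

End DysonEquation.

Section Edges.
Context {R : realType}.
Implicit Types (rho : R -> R) (S : set R) (tau : R).

Definition supp rho : set R := closure [set tau | rho tau != 0].

Definition bdry S : set R := closure S `\` interior S.

(* The limit is taken along the points of the support other than tau0. *)
Definition regular_edge rho (c C tau0 : R) : Prop :=
  bdry (supp rho) tau0 /\
  exists gamma : R, [/\ c <= gamma, gamma <= C &
    rho tau / Num.sqrt `|tau - tau0| @[tau --> within (supp rho) tau0^'] -->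
      gamma `^ (3 / 2) / pi].

(* tau is a right (left) endpoint of an interval constituting S locally. *)
Definition right_edge S tau : Prop :=
  exists2 e : R, 0 < e &
    S `&` `]tau - e, tau + e[%classic = `]tau - e, tau]%classic.

Definition left_edge S tau : Prop :=
  exists2 e : R, 0 < e &
    S `&` `]tau - e, tau + e[%classic = `[tau, tau + e[%classic.

End Edges.

(* Main.v *)
Require Import Defs.
From HB Require Import structures.
From mathcomp Require Import all_boot all_order all_algebra.
From mathcomp Require Import all_classical all_reals all_analysis.
From mathcomp Require Import complex.
From mathcomp Require Import ring lra.

Set Implicit Arguments.
Unset Strict Implicit.
Unset Printing Implicit Defensive.

Import Order.TTheory GRing.Theory Num.Theory.
Import numFieldNormedType.Exports.
Import ComplexField.Normc.

Local Open Scope classical_set_scope.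
Local Open Scope ring_scope.
Local Open Scope complex_scope.
Local Open Scope sesquilinear_scope.
Local Notation "z ^*" := (Num.conj z) : complex_scope.
Local Notation ImM := Defs.ImM.

(** * The square root law at a regular edge

    At a self-adjoint solution [M0] of the Dyson equation at the edge [tau], the
    difference [D = M(z) - M0] satisfies the exact two-point identity
    [D = M0 (omega + S(D)) M(z)] with [omega = z - tau]. Its linearisation
    [X - M0 S(X) M0] annihilates one direction [V], the limit of the normalised
    imaginary parts of [M], and is invertible on a complement, with a bound
    coming from flatness ([doeblin_stability]). Pairing the identity with the
    left eigenvector [L = S(V)] leaves a scalar equation for the coordinate
    [Theta] of [D] along [V]:
      [omega + Theta ^ 2 sigma = O(|omega| ^ (3 / 2))],  [sigma = <L M0 L V>],
    ([coord_bound]); [sigma] is real, and [pi] times the density is the imaginary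
    part of [Theta] up to [O(|omega|)]. Hence the density vanishes to the side
    where [omega / sigma < 0], and is [sqrt(|omega / sigma|) / pi + O(|omega|)]
    on the other side, provided that [sigma] is bounded from below and above.

    This is where the regularity of the edge enters. Along a sequence that
    approaches the edge, with [rho] of order [sqrt |omega|], the scalar equation
    shows that [|sigma| = gamma ^ - 3] unless [sigma = 0] ([sigma_abs]). If
    [sigma] vanished, the next order of the equation would make the cubic
    coefficient vanish as well. That is impossible: in the coordinates of
    a balanced polar decomposition, [S] becomes a symmetric positive map that
    strictly contracts the Hilbert-Schmidt norm away from its fixed vector
    ([symmetric_gap]), and a vanishing cubic coefficient would be a case of
    equality ([cubic_coefficient_neq0]). The same gap shows that a point of
    positive density is an inner point of the support ([bulk_open]), so that the
    approximating sequence exists.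

    The two-point identity serves three times. Between [M(z)] and [M0] it bounds
    [|M(z) - M0|] by [sqrt |omega|]: the bound improves itself, and propagates
    through a half disc by continuity ([near_edge]). Between [M(z)] and its
    adjoint it becomes an equation for the normalised imaginary part, with the
    spectral parameter [eta / rho]; where [Theta] has a large real part, this
    forces [rho = O(eta / sqrt |omega|)], so that the density is zero
    ([outside_bound]). Between [M(z)] and [M(z')] it shows that [M] is Lipschitz
    in [eta] above each point of the other side, where [Theta] has a large
    imaginary part ([inside_lipschitz]); so the limit defining the density
    exists. All constants are explicit functions of the model parameters. *)


(** * Complex scalars, adjoints and the operator norm *)

(** The modulus, the Euclidean norm and the operator norm are sealed, because
    unification would otherwise unfold them. *)
HB.lock Definition cabs (R : realType) (z : R[i]) : R := normc z.

HB.lock Definition vnorm (R : realType) (n : nat) (x : 'cV[R[i]]_n) : R :=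
  l2norm x.

HB.lock Definition mnorm (R : realType) (n : nat) (A : 'M[R[i]]_n) : R :=
  opnorm A.

Section ComplexScalars.
Context {R : realType}.
Implicit Types (z w : R[i]).

Lemma normE_cabs z : `|z| = (cabs z)%:C.
Proof. by rewrite cabs.unlock; case: z => a b; rewrite normc_def. Qed.

Lemma cabs_ge0 z : 0 <= cabs z.
Proof. by rewrite cabs.unlock; case: z => a b; rewrite sqrtr_ge0. Qed.

Lemma cabsD z w : cabs (z + w) <= cabs z + cabs w.
Proof. by rewrite cabs.unlock; exact: le_normcD. Qed.

Lemma cabsM z w : cabs (z * w) = cabs z * cabs w.
Proof. by rewrite cabs.unlock normcM. Qed.

Lemma cabsV z : cabs z^-1 = (cabs z)^-1.
Proof. by rewrite cabs.unlock normcV. Qed.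

Lemma cabs0 : cabs (0 : R[i]) = 0.
Proof. by rewrite cabs.unlock normc0. Qed.

Lemma cabs1 : cabs (1 : R[i]) = 1.
Proof. by rewrite cabs.unlock normc1. Qed.

Lemma cabs_eq0 z : cabs z = 0 -> z = 0.
Proof. by rewrite cabs.unlock; exact: eq0_normc. Qed.

Lemma cabsN z : cabs (- z) = cabs z.
Proof. by rewrite cabs.unlock normcN. Qed.

Lemma cabsJ z : cabs (z^*) = cabs z.
Proof. by rewrite cabs.unlock; case: z => a b; rewrite /= sqrrN. Qed.

Lemma cabs_real (a : R) : cabs a%:C = `|a|.
Proof. by rewrite cabs.unlock /= expr0n /= addr0 sqrtr_sqr. Qed.

Lemma sqr_cabs_ReIm z : cabs z ^+ 2 = complex.Re z ^+ 2 + complex.Im z ^+ 2.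
Proof.
by rewrite cabs.unlock; case: z => a b; rewrite /= sqr_sqrtr ?addr_ge0 ?sqr_ge0.
Qed.

Lemma Re_le_cabs z : `|complex.Re z| <= cabs z.
Proof.
rewrite -(ler_pXn2r (ltn0Sn 1)) ?nnegrE ?cabs_ge0 // sqr_cabs_ReIm.
by rewrite real_normK ?num_real // lerDl sqr_ge0.
Qed.

Lemma Im_le_cabs z : `|complex.Im z| <= cabs z.
Proof.
rewrite -(ler_pXn2r (ltn0Sn 1)) ?nnegrE ?cabs_ge0 // sqr_cabs_ReIm.
by rewrite real_normK ?num_real // lerDr sqr_ge0.
Qed.

Lemma cabs_le_ReIm z : cabs z <= `|complex.Re z| + `|complex.Im z|.
Proof.
rewrite -(ler_pXn2r (ltn0Sn 1)) ?nnegrE ?cabs_ge0 ?addr_ge0 //.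
rewrite sqr_cabs_ReIm sqrrD !real_normK ?num_real //.
by rewrite lerD2r lerDl mulrn_wge0 // mulr_ge0.
Qed.

Lemma cabs_sum (I : finType) (F : I -> R[i]) :
  cabs (\sum_i F i) <= \sum_i cabs (F i).
Proof.
elim/big_ind2 : _ => [|x a y b hx hy|//]; first by rewrite cabs0.
exact: le_trans (cabsD _ _) (lerD hx hy).
Qed.

Lemma conjcE z : z^* = conjc z. Proof. by []. Qed.

Lemma mul_conjcE z : z * z^* = (cabs z ^+ 2)%:C.
Proof.
rewrite sqr_cabs_ReIm; case: z => a b /=; simpc; apply/eqP.
by rewrite eq_complex /= !expr2 eqxx /= addrC mulrC subrr eqxx.
Qed.

Lemma ReD z w : complex.Re (z + w) = complex.Re z + complex.Re w.
Proof. by case: z w => [a b] [c d]. Qed.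
Lemma ImD z w : complex.Im (z + w) = complex.Im z + complex.Im w.
Proof. by case: z w => [a b] [c d]. Qed.
Lemma ReN z : complex.Re (- z) = - complex.Re z.
Proof. by case: z => [a b]. Qed.
Lemma ImN z : complex.Im (- z) = - complex.Im z.
Proof. by case: z => [a b]. Qed.
Lemma ReMr (a : R) z : complex.Re (a%:C * z) = a * complex.Re z.
Proof. by case: z => [b c] /=; rewrite mul0r subr0. Qed.
Lemma ImMr (a : R) z : complex.Im (a%:C * z) = a * complex.Im z.
Proof. by case: z => [b c] /=; rewrite mul0r addr0. Qed.
Lemma ReJ z : complex.Re (z^*) = complex.Re z. Proof. by case: z. Qed.
Lemma ImJ z : complex.Im (z^*) = - complex.Im z. Proof. by case: z. Qed.

Lemma conjC_rc (a : R) : (a%:C)^* = a%:C.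
Proof. by rewrite conjcE conjc_real. Qed.

Lemma conjCM z w : (z * w)^* = z^* * w^*. Proof. exact: rmorphM. Qed.
Lemma conjCD z w : (z + w)^* = z^* + w^*. Proof. exact: rmorphD. Qed.
Lemma conjCN z : (- z)^* = - z^*. Proof. exact: rmorphN. Qed.

Lemma conjC_sum (I : finType) (F : I -> R[i]) :
  (\sum_j F j)^* = \sum_j (F j)^*.
Proof. exact: rmorph_sum. Qed.

Lemma eqC z w :
  complex.Re z = complex.Re w -> complex.Im z = complex.Im w -> z = w.
Proof. by case: z w => [a b] [c d] /= -> ->. Qed.

Lemma real_of_conj z : z^* = z -> z = (complex.Re z)%:C.
Proof.
case: z => a b [] /eqP; rewrite -subr_eq0 => h; congr (_ +i* _)%C => /=.
by move: h; rewrite -opprD oppr_eq0 -mulr2n mulrn_eq0 /= => /eqP.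
Qed.

Lemma ge0_rc z : 0 <= z -> z = (complex.Re z)%:C /\ 0 <= complex.Re z.
Proof. by case: z => a b; rewrite lecE /= => /andP[/eqP -> ->]. Qed.

End ComplexScalars.

Section Adjoint.
Context {R : realType}.
Implicit Types (m n p : nat).

Lemma addmxE m n (A B : 'M[R[i]]_(m, n)) i j : (A + B) i j = A i j + B i j.
Proof. by rewrite mxE. Qed.
Lemma oppmxE m n (A : 'M[R[i]]_(m, n)) i j : (- A) i j = - A i j.
Proof. by rewrite mxE. Qed.
Lemma scalemxE m n a (A : 'M[R[i]]_(m, n)) i j : (a *: A) i j = a * A i j.
Proof. by rewrite mxE. Qed.

Lemma scalarmxE n (a : R[i]) (j k : 'I_n) :
  (a%:M : 'M[R[i]]_n) j k = a * (j == k)%:R.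
Proof. by rewrite !mxE mulr_natr. Qed.

Lemma adjD m n (A B : 'M[R[i]]_(m, n)) : (A + B)^t* = A^t* + B^t*.
Proof. by rewrite !linearD /= map_mxD. Qed.
Lemma adjN m n (A : 'M[R[i]]_(m, n)) : (- A)^t* = - A^t*.
Proof. by rewrite !linearN /= map_mxN. Qed.
Lemma adjB m n (A B : 'M[R[i]]_(m, n)) : (A - B)^t* = A^t* - B^t*.
Proof. by rewrite adjD adjN. Qed.
Lemma adjZ m n a (A : 'M[R[i]]_(m, n)) : (a *: A)^t* = a^* *: A^t*.
Proof. by rewrite linearZ /= map_mxZ. Qed.
Lemma adjM m n p (A : 'M[R[i]]_(m, n)) (B : 'M[R[i]]_(n, p)) :
  (A *m B)^t* = B^t* *m A^t*.
Proof. by rewrite trmx_mul map_mxM. Qed.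
Lemma adjK m n (A : 'M[R[i]]_(m, n)) : A^t*^t* = A.
Proof. exact: trmxCK. Qed.
Lemma adj0 m n : (0 : 'M[R[i]]_(m, n))^t* = 0.
Proof. by rewrite trmx0 map_mx0. Qed.
Lemma adj1 n : (1%:M : 'M[R[i]]_n)^t* = 1%:M.
Proof. by rewrite trmx1 map_mx1. Qed.
Lemma adj_scalar n a : (a%:M : 'M[R[i]]_n)^t* = (a^*)%:M.
Proof. by rewrite tr_scalar_mx map_scalar_mx. Qed.
Lemma adjE m n (A : 'M[R[i]]_(m, n)) i j : A^t* i j = (A j i)^*.
Proof. by rewrite !mxE. Qed.
Lemma mxtrace_adj n (A : 'M[R[i]]_n) : \tr (A^t*) = (\tr A)^*.
Proof. by rewrite /mxtrace rmorph_sum; apply: eq_bigr => i _; rewrite adjE. Qed.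

End Adjoint.

Ltac mxlin := apply/matrixP => ? ?;
  rewrite ?(addmxE, oppmxE, scalemxE, scalarmxE); ring.

Section L2norm.
Context {R : realType}.
Variable n : nat.
Implicit Types (x y : 'cV[R[i]]_n).

Lemma vnorm_ge0 x : 0 <= vnorm x.
Proof. by rewrite vnorm.unlock; exact: sqrtr_ge0. Qed.

Lemma sqr_vnorm x : vnorm x ^+ 2 = \sum_k cabs (x k 0) ^+ 2.
Proof.
rewrite vnorm.unlock sqr_sqrtr; last by apply: sumr_ge0 => k _; rewrite addr_ge0 ?sqr_ge0.
by apply: eq_bigr => k _; rewrite sqr_cabs_ReIm.
Qed.

Lemma dotcE x : (x^t* *m x) 0 0 = (vnorm x ^+ 2)%:C.
Proof.
rewrite mxE sqr_vnorm rmorph_sum; apply: eq_bigr => k _.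
by rewrite adjE mulrC mul_conjcE.
Qed.

Lemma cauchy_schwarz x y : cabs ((x^t* *m y) 0 0) <= vnorm x * vnorm y.
Proof.
have [h _] := CauchySchwarz (@dotmx R[i] n) (x^t*) (y^t*).
have {h} : `|(x^t* *m y^t*^t*) 0 0| ^+ 2 <=
    (x^t* *m x^t*^t*) 0 0 * (y^t* *m y^t*^t*) 0 0 by rewrite -!dotmxE; exact: h.
rewrite !adjK !dotcE normE_cabs -rmorphXn -rmorphM lecR -exprMn.
by rewrite ler_pXn2r ?nnegrE ?cabs_ge0 ?mulr_ge0 ?vnorm_ge0.
Qed.

Lemma vnormD x y : vnorm (x + y) <= vnorm x + vnorm y.
Proof.
rewrite -(ler_pXn2r (ltn0Sn 1)) ?nnegrE ?addr_ge0 ?vnorm_ge0 //.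
have -> : vnorm (x + y) ^+ 2 = vnorm x ^+ 2 + vnorm y ^+ 2
          + 2 * complex.Re ((x^t* *m y) 0 0).
  apply: complexI; rewrite -dotcE adjD mulmxDl !mulmxDr.
  have e : (y^t* *m x) 0 0 = ((x^t* *m y) 0 0)^* by rewrite -adjE adjM adjK.
  rewrite !addmxE e !dotcE; set a := _ ^+ 2; set b := _ ^+ 2.
  by case: (_ 0 0) => u v; apply: eqC => /=; ring.
have := le_trans (ler_norm _) (le_trans (Re_le_cabs _) (cauchy_schwarz x y)).
rewrite sqrrD; lra.
Qed.

Lemma vnormZ a x : vnorm (a *: x) = cabs a * vnorm x.
Proof.
apply: (@pexpIrn _ 2) => //; rewrite ?nnegrE ?mulr_ge0 ?cabs_ge0 ?vnorm_ge0 //.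
rewrite exprMn !sqr_vnorm mulr_sumr; apply: eq_bigr => k _.
by rewrite mxE cabsM exprMn.
Qed.

Lemma vnorm0 : vnorm (0 : 'cV[R[i]]_n) = 0.
Proof. by rewrite -(scale0r 0) vnormZ cabs0 mul0r. Qed.

Lemma vnorm_eq0 x : vnorm x = 0 -> x = 0.
Proof.
move=> x0; apply/colP => k; rewrite mxE; apply: cabs_eq0; apply/eqP.
rewrite -sqrf_eq0; have /eqP := sqr_vnorm x.
rewrite x0 expr0n /= eq_sym psumr_eq0; last by move=> j _; rewrite sqr_ge0.
by move=> /allP /(_ k); rewrite mem_index_enum => /(_ isT).
Qed.

Lemma vnorm_gt0 x : x != 0 -> 0 < vnorm x.
Proof.
move=> x0; rewrite lt_neqAle vnorm_ge0 andbT eq_sym.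
by apply: contra_neq x0 => /vnorm_eq0.
Qed.

Lemma entry_le_vnorm x k : cabs (x k 0) <= vnorm x.
Proof.
rewrite -(ler_pXn2r (ltn0Sn 1)) ?nnegrE ?cabs_ge0 ?vnorm_ge0 //.
rewrite sqr_vnorm (bigD1 k) //= lerDl; apply: sumr_ge0 => j _.
exact: sqr_ge0.
Qed.

Lemma vnorm_le_sum x : vnorm x <= \sum_k cabs (x k 0).
Proof.
rewrite -(ler_pXn2r (ltn0Sn 1)) ?nnegrE ?vnorm_ge0 //; last first.
  by apply: sumr_ge0 => k _; exact: cabs_ge0.
rewrite sqr_vnorm expr2 mulr_suml; apply: ler_sum => k _.
rewrite expr2 ler_wpM2l ?cabs_ge0 // (bigD1 k) //= lerDl.
by apply: sumr_ge0 => j _; exact: cabs_ge0.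
Qed.

Lemma vnorm_delta k : vnorm (delta_mx k 0 : 'cV[R[i]]_n) = 1.
Proof.
apply: (@pexpIrn _ 2) => //; rewrite ?nnegrE ?vnorm_ge0 //.
rewrite sqr_vnorm (bigD1 k) //= big1 ?addr0.
  by rewrite mxE !eqxx cabs1 expr1n.
by move=> j jk; rewrite mxE (negbTE jk) cabs0 expr0n.
Qed.

End L2norm.

Section OperatorNorm.
Context {R : realType}.
Variable n : nat.
Implicit Types (A B : 'M[R[i]]_n) (x y : 'cV[R[i]]_n).

Let vnorm_mulmx_sum A x :
  vnorm (A *m x) <= (\sum_i \sum_j cabs (A i j)) * vnorm x.
Proof.
apply: le_trans (vnorm_le_sum _) _; rewrite mulr_suml; apply: ler_sum => i _.
rewrite mxE; apply: le_trans (cabs_sum _) _; rewrite mulr_suml.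
apply: ler_sum => j _; rewrite cabsM ler_wpM2l ?cabs_ge0 //.
exact: entry_le_vnorm.
Qed.

Let sum_normc_ge0 A : 0 <= \sum_i \sum_j cabs (A i j).
Proof. by do 2!apply: sumr_ge0 => ? _; exact: cabs_ge0. Qed.

Let mnorm_has_sup A :
  has_sup [set vnorm (A *m x) | x in [set x : 'cV[R[i]]_n | vnorm x <= 1]].
Proof.
split; first by exists (vnorm (A *m 0)), 0 => //=; rewrite vnorm0.
exists (\sum_i \sum_j cabs (A i j)) => _ /= [x x1 <-].
apply: le_trans (vnorm_mulmx_sum _ _) _.
by rewrite -[leRHS]mulr1 ler_wpM2l.
Qed.

Let mnormE A :
  mnorm A = sup [set vnorm (A *m x) | x in [set x : 'cV[R[i]]_n | vnorm x <= 1]].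
Proof. by rewrite mnorm.unlock vnorm.unlock. Qed.

Let mnorm_ub A x : vnorm x <= 1 -> vnorm (A *m x) <= mnorm A.
Proof. by move=> x1; rewrite mnormE; apply: (sup_upper_bound (mnorm_has_sup A)); exists x. Qed.

Lemma mnorm_ge0 A : 0 <= mnorm A.
Proof.
apply: le_trans (vnorm_ge0 (A *m 0)) (mnorm_ub _ _).
by rewrite vnorm0.
Qed.

Lemma vnorm_mulmx A x : vnorm (A *m x) <= mnorm A * vnorm x.
Proof.
have [->|x0] := eqVneq x 0; first by rewrite mulmx0 !vnorm0 mulr0.
have lx := vnorm_gt0 x0.
have := @mnorm_ub A (((vnorm x)^-1)%:C *: x).
rewrite -scalemxAr !vnormZ cabs_real ger0_norm ?invr_ge0 ?vnorm_ge0 //.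
by rewrite mulVf ?gt_eqF // mulrC ler_pdivrMr //; apply.
Qed.

Lemma mnorm_le A t :
  0 <= t -> (forall x, vnorm (A *m x) <= t * vnorm x) -> mnorm A <= t.
Proof.
move=> t0 h; rewrite mnormE; apply: ge_sup; first exact: (mnorm_has_sup A).1.
move=> _ /= [x x1 <-]; apply: le_trans (h x) _.
by rewrite -[leRHS]mulr1 ler_wpM2l.
Qed.

Lemma mnormD A B : mnorm (A + B) <= mnorm A + mnorm B.
Proof.
apply: mnorm_le => [|x]; first by rewrite addr_ge0 ?mnorm_ge0.
rewrite mulmxDl mulrDl; apply: le_trans (vnormD _ _) _.
by rewrite lerD ?vnorm_mulmx.
Qed.

Lemma mnormM A B : mnorm (A *m B) <= mnorm A * mnorm B.
Proof.
apply: mnorm_le => [|x]; first by rewrite mulr_ge0 ?mnorm_ge0.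
rewrite -mulmxA -mulrA; apply: le_trans (vnorm_mulmx _ _) _.
by rewrite ler_wpM2l ?mnorm_ge0 ?vnorm_mulmx.
Qed.

Lemma mnorm0 : mnorm (0 : 'M[R[i]]_n) = 0.
Proof.
apply/eqP; rewrite eq_le mnorm_ge0 andbT; apply: mnorm_le => // x.
by rewrite mul0mx vnorm0 mul0r.
Qed.

Let mnormZ_le a A : mnorm (a *: A) <= cabs a * mnorm A.
Proof.
apply: mnorm_le => [|x]; first by rewrite mulr_ge0 ?mnorm_ge0 ?cabs_ge0.
rewrite -scalemxAl vnormZ -mulrA.
by rewrite ler_wpM2l ?cabs_ge0 ?vnorm_mulmx.
Qed.

Lemma mnormZ a A : mnorm (a *: A) = cabs a * mnorm A.
Proof.
apply/eqP; rewrite eq_le mnormZ_le /=.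
have [->|a0] := eqVneq a 0; first by rewrite cabs0 mul0r mnorm_ge0.
have na0 : 0 < cabs a.
  rewrite lt_neqAle cabs_ge0 andbT eq_sym.
  by apply: contra_neq a0 => /cabs_eq0.
rewrite mulrC -ler_pdivlMr // mulrC -cabsV.
have := mnormZ_le a^-1 (a *: A).
by rewrite scalerA mulVf // scale1r.
Qed.

Lemma mnormN A : mnorm (- A) = mnorm A.
Proof. by rewrite -scaleN1r mnormZ cabsN cabs1 mul1r. Qed.

Lemma mnormB A B : mnorm (A - B) <= mnorm A + mnorm B.
Proof. by have := mnormD A (- B); rewrite mnormN. Qed.

Lemma mnorm1_le : mnorm (1%:M : 'M[R[i]]_n) <= 1.
Proof. by apply: mnorm_le => // x; rewrite mul1mx mul1r. Qed.

Lemma mnorm_scalar_le a : mnorm (a%:M : 'M[R[i]]_n) <= cabs a.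
Proof.
rewrite -scalemx1 mnormZ -[leRHS]mulr1 ler_wpM2l ?cabs_ge0 //.
exact: mnorm1_le.
Qed.

Lemma mnorm_eq0 A : mnorm A = 0 -> A = 0.
Proof.
move=> A0; apply/matrixP => i j; rewrite mxE.
have /vnorm_eq0 /colP /(_ i) : vnorm (A *m delta_mx j 0) = 0.
  apply/eqP; rewrite eq_le vnorm_ge0 andbT.
  by apply: le_trans (vnorm_mulmx _ _) _; rewrite A0 mul0r.
by rewrite -colE !mxE.
Qed.

Lemma entry_le_mnorm A i j : cabs (A i j) <= mnorm A.
Proof.
apply: le_trans (_ : vnorm (A *m delta_mx j 0) <= _); last first.
  by apply: le_trans (vnorm_mulmx _ _) _; rewrite vnorm_delta mulr1.
by rewrite -colE; apply: le_trans (entry_le_vnorm _ i); rewrite mxE.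
Qed.

Lemma mnorm_le_sum A : mnorm A <= \sum_i \sum_j cabs (A i j).
Proof. by apply: mnorm_le => // x; exact: vnorm_mulmx_sum. Qed.

Lemma mnorm_adj A : mnorm (A^t*) = mnorm A.
Proof.
suff h B : mnorm (B^t*) <= mnorm B.
  by apply: le_anti; rewrite h; have := h (A^t*); rewrite adjK => ->.
apply: mnorm_le => [|x]; first exact: mnorm_ge0.
have [->|y0] := eqVneq (B^t* *m x) 0.
  by rewrite vnorm0 mulr_ge0 ?mnorm_ge0 ?vnorm_ge0.
have ly := vnorm_gt0 y0; rewrite -(ler_pM2r ly) -expr2.
have -> : vnorm (B^t* *m x) ^+ 2 = cabs ((x^t* *m (B *m (B^t* *m x))) 0 0).
  by rewrite mulmxA -[x^t* *m B]adjK adjM adjK dotcE cabs_real ger0_norm ?sqr_ge0.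
apply: le_trans (cauchy_schwarz _ _) _.
rewrite [leRHS]mulrAC mulrC ler_wpM2r ?vnorm_ge0 //.
exact: vnorm_mulmx.
Qed.

Hypothesis n0 : (0 < n)%N.

Lemma cabs_ntr A : cabs (ntr A) <= mnorm A.
Proof.
rewrite /ntr cabsM cabsV; have -> : n%:R = (n%:R : R)%:C :> R[i].
  by rewrite rmorph_nat.
rewrite cabs_real ger0_norm // ler_pdivrMr ?ltr0n //.
apply: le_trans (cabs_sum _) _.
apply: le_trans (ler_sum _ (fun i _ => entry_le_mnorm A i i)) _.
by rewrite sumr_const card_ord mulr_natr.
Qed.

End OperatorNorm.

(** * Positive semidefinite matrices *)

(** Sealed for the same reason as the norms. *)
HB.lock Definition qform (R : realType) (n : nat) (A : 'M[R[i]]_n)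
  (x : 'cV[R[i]]_n) : R[i] := (x^t* *m A *m x) 0 0.

HB.lock Definition psdm (R : realType) (n : nat) (A : 'M[R[i]]_n) : Prop :=
  psd A.

Local Notation "A <<= B" := (psdm (B - A)) (at level 70, no associativity).

Section Psd.
Context {R : realType}.
Variable n : nat.
Implicit Types (A B T X Y U V : 'M[R[i]]_n) (x y : 'cV[R[i]]_n) (t : R).

Lemma psdmE A : psdm A = psd A. Proof. by rewrite psdm.unlock. Qed.

Lemma psdmI T : T^t* = T -> (forall x, 0 <= qform T x) -> psdm T.
Proof. by rewrite psdm.unlock qform.unlock => h p; split. Qed.

Lemma psd_herm T : psdm T -> T^t* = T.
Proof. by rewrite psdm.unlock; case. Qed.

Lemma psd_ge0 T x : psdm T -> 0 <= qform T x.
Proof. by rewrite psdm.unlock qform.unlock; case=> _; apply. Qed.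

Lemma qformD A B x : qform (A + B) x = qform A x + qform B x.
Proof. by rewrite qform.unlock mulmxDr mulmxDl addmxE. Qed.

Lemma qformN A x : qform (- A) x = - qform A x.
Proof. by rewrite qform.unlock mulmxN mulNmx oppmxE. Qed.

Lemma qformZ a A x : qform (a *: A) x = a * qform A x.
Proof. by rewrite qform.unlock -scalemxAr -scalemxAl scalemxE. Qed.

Lemma qform_congr X A x : qform (X^t* *m A *m X) x = qform A (X *m x).
Proof. by rewrite qform.unlock adjM !mulmxA. Qed.

Lemma qform_scalar (a : R[i]) x :
  qform (a%:M : 'M[R[i]]_n) x = a * (vnorm x ^+ 2)%:C.
Proof.
by rewrite qform.unlock mul_mx_scalar -scalemxAl scalemxE dotcE.
Qed.

Lemma qform_gram X x : qform (X^t* *m X) x = (vnorm (X *m x) ^+ 2)%:C.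
Proof. by rewrite -dotcE adjM qform.unlock !mulmxA. Qed.

Lemma qform_conj A x : A^t* = A -> (qform A x)^* = qform A x.
Proof. by move=> hA; rewrite qform.unlock -adjE !adjM adjK hA mulmxA. Qed.

Lemma psdD A B : psdm A -> psdm B -> psdm (A + B).
Proof.
move=> pA pB; apply: psdmI => [|x]; first by rewrite adjD (psd_herm pA) (psd_herm pB).
by rewrite qformD addr_ge0 // psd_ge0.
Qed.

Lemma psdZ (a : R) A : 0 <= a -> psdm A -> psdm (a%:C *: A).
Proof.
move=> a0 pA; apply: psdmI => [|x]; first by rewrite adjZ (psd_herm pA) conjC_rc.
by rewrite qformZ mulr_ge0 ?psd_ge0 // ler0c.
Qed.

Lemma psd_congr X A : psdm A -> psdm (X^t* *m A *m X).
Proof.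
move=> pA; apply: psdmI => [|x]; last by rewrite qform_congr psd_ge0.
by rewrite !adjM adjK (psd_herm pA) mulmxA.
Qed.

Lemma psd_congrV X A : psdm A -> psdm (X *m A *m X^t*).
Proof. by move=> pA; have := psd_congr (X^t*) pA; rewrite adjK. Qed.

Lemma psd_gram X : psdm (X^t* *m X).
Proof.
apply: psdmI => [|x]; first by rewrite adjM adjK.
by rewrite qform_gram ler0c sqr_ge0.
Qed.

Lemma psd_scalar (a : R) : 0 <= a -> psdm (a%:C%:M : 'M[R[i]]_n).
Proof.
move=> a0; apply: psdmI => [|x]; first by rewrite adj_scalar conjC_rc.
by rewrite qform_scalar mulr_ge0 // ler0c // sqr_ge0.
Qed.

Lemma loewner_trans B A T : A <<= B -> B <<= T -> A <<= T.
Proof.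
by move=> h1 h2; have := psdD h1 h2; rewrite addrC addrA subrK.
Qed.

Lemma loewner_psd A B : psdm A -> A <<= B -> psdm B.
Proof. by move=> h1 h2; have := psdD h1 h2; rewrite addrC subrK. Qed.

Lemma herm_spectral A : A^t* = A ->
  exists U (d : 'I_n -> R), [/\ U *m U^t* = 1%:M, U^t* *m U = 1%:M &
    A = U^t* *m diag_mx (\row_i (d i)%:C) *m U].
Proof.
move=> hA; have herA : A \is hermsymmx.
  by apply/is_hermitianmxP; rewrite expr0 scale1r -[in LHS]hA.
have /orthomx_spectralP eA := hermitian_normalmx herA.
have dreal := hermitian_spectral_diag_real herA.
have uU := spectral_unitarymx A.
have iU := invmx_unitary uU.
exists (spectralmx A), (fun i => complex.Re (spectral_diag A 0 i)); split.
- exact/unitarymxP.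
- by rewrite -iU mulVmx // unitarymx_unit.
- rewrite -iU; apply: (etrans eA).
  apply: (congr1 (fun e => _ *m diag_mx e *m _)); apply/rowP => i.
  by rewrite !mxE; apply: real_of_conj; apply/CrealP; exact: (mxOverP dreal).
Qed.

Lemma qform_unitary_diag U (d : 'I_n -> R) k : U *m U^t* = 1%:M ->
  qform (U^t* *m diag_mx (\row_i (d i)%:C) *m U)
    (U^t* *m (delta_mx k 0 : 'cV[R[i]]_n)) = (d k)%:C.
Proof.
move=> UU; rewrite qform_congr mulmxA UU mul1mx qform.unlock -mulmxA -colE.
rewrite mxE (bigD1 k) //= big1.
  by rewrite addr0 !mxE !eqxx /= rmorph1 mul1r mulr1n.
by move=> j jk; rewrite !mxE (negbTE jk) /= rmorph0 mul0r.
Qed.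

Lemma psd_sqrt T : psdm T -> exists Y, T = Y^t* *m Y.
Proof.
move=> pT; have [U [d [UU U'U eT]]] := herm_spectral (psd_herm pT).
have d0 k : 0 <= d k.
  have := psd_ge0 (U^t* *m delta_mx k 0) pT.
  by rewrite {1}eT qform_unitary_diag // ler0c.
exists (diag_mx (\row_i (Num.sqrt (d i))%:C) *m U).
rewrite adjM tr_diag_mx map_diag_mx mulmxA -(mulmxA (U^t*)) mulmx_diag {1}eT.
apply: (congr1 (fun e => U^t* *m diag_mx e *m U)).
apply/rowP => i.
rewrite !mxE.
by rewrite [X in X * _]conjC_rc -rmorphM -expr2 sqr_sqrtr.
Qed.

Lemma psd_trace T : psdm T -> 0 <= \tr T.
Proof.
move=> pT; rewrite /mxtrace; apply: sumr_ge0 => i _.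
have := psd_ge0 (delta_mx i 0) pT.
rewrite qform.unlock -mulmxA -colE mxE (bigD1 i) //= big1 ?addr0.
  by rewrite !mxE !eqxx /= rmorph1 mul1r.
by move=> j jk; rewrite !mxE (negbTE jk) /= rmorph0 mul0r.
Qed.

Lemma psd_tr_mul A B : psdm A -> psdm B -> 0 <= \tr (A *m B).
Proof.
move=> pA /psd_sqrt[Y ->]; rewrite mulmxA mxtrace_mulC mulmxA.
exact: psd_trace (psd_congrV _ pA).
Qed.

Lemma herm_le_mnorm X t : X^t* = X -> mnorm X <= t -> X <<= t%:C%:M.
Proof.
move=> hX Xt; apply: psdmI => [|x].
  by rewrite adjB adj_scalar conjC_rc hX.
have : cabs (qform X x) <= t * vnorm x ^+ 2.
  have := cauchy_schwarz x (X *m x); rewrite qform.unlock mulmxA.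
  move/le_trans; apply; rewrite expr2 mulrA mulrC ler_wpM2r ?vnorm_ge0 //.
  by apply: le_trans (vnorm_mulmx _ _) _; rewrite ler_wpM2r ?vnorm_ge0.
rewrite qformD qformN qform_scalar (real_of_conj (qform_conj x hX)) cabs_real.
rewrite -rmorphM -rmorphB ler0c subr_ge0.
exact: le_trans (ler_norm _).
Qed.

Lemma mnorm_gram_le X t : 0 <= t -> X^t* *m X <<= (t ^+ 2)%:C%:M ->
  mnorm X <= t.
Proof.
move=> t0 h; apply: mnorm_le => // x.
rewrite -(ler_pXn2r (ltn0Sn 1)) ?nnegrE ?mulr_ge0 ?vnorm_ge0 //.
have := psd_ge0 x h; rewrite qformD qformN qform_scalar qform_gram exprMn.
by rewrite -rmorphM -rmorphB ler0c subr_ge0.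
Qed.

(** Conjugating [Y Y^* <= t] by a square root [Y] of [T] gives
    [T ^ 2 <= t T]. *)
Lemma psd_norm_le T t : 0 <= t -> psdm T -> T <<= t%:C%:M -> mnorm T <= t.
Proof.
move=> t0 pT Tt; have [Y eY] := psd_sqrt pT; apply: (mnorm_gram_le t0).
have yy : mnorm Y <= Num.sqrt t.
  apply: mnorm_gram_le; first exact: sqrtr_ge0.
  by rewrite -eY sqr_sqrtr.
have : Y *m Y^t* <<= t%:C%:M.
  apply: herm_le_mnorm; first by rewrite adjM adjK.
  apply: le_trans (mnormM _ _) _.
  by rewrite mnorm_adj -(sqr_sqrtr t0) expr2 ler_pM ?mnorm_ge0.
move=> /(psd_congr Y); rewrite mulmxBr mulmxBl mul_mx_scalar -scalemxAl -eY.
have -> : Y^t* *m (Y *m Y^t*) *m Y = T *m T by rewrite eY !mulmxA.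
move=> h; rewrite (psd_herm pT).
apply: loewner_trans h _.
have -> : (t ^+ 2)%:C%:M = t%:C *: t%:C%:M :> 'M[R[i]]_n.
  by rewrite scale_scalar_mx -rmorphM.
by rewrite -scalerBr; apply: psdZ.
Qed.

(** [X] is half the difference of [t + X] and [t - X], which are positive
    semidefinite and at most [2 t]. *)
Lemma sandwich_norm X t : 0 <= t -> X <<= t%:C%:M -> - X <<= t%:C%:M ->
  mnorm X <= 2 * t.
Proof.
move=> t0 h1 h2.
have eX : X = (2^-1)%:C *: ((t%:C%:M - - X) - (t%:C%:M - X)).
  have -> : (t%:C%:M - - X) - (t%:C%:M - X) = 2%:R *: X.
    by rewrite !opprK opprB addrC addrA subrK scaler_nat.
  rewrite scalerA -(rmorph_nat (real_complex R)) -rmorphM mulVf.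
    by rewrite rmorph1 scale1r.
  by rewrite pnatr_eq0.
have k Y : Y <<= t%:C%:M -> - Y <<= t%:C%:M -> mnorm (t%:C%:M - Y) <= 2 * t.
  move=> k1 k2; apply: (psd_norm_le _ k1); first by rewrite mulr_ge0.
  have e : (2 * t)%:C%:M - (t%:C%:M - Y) = t%:C%:M - - Y by mxlin.
  by rewrite e.
rewrite [X in mnorm X <= _]eX mnormZ cabs_real ger0_norm ?invr_ge0 //.
have := mnormB (t%:C%:M - - X) (t%:C%:M - X).
have := k _ h1 h2; have := k (- X) h2; rewrite opprK => /(_ h1).
lra.
Qed.

Lemma posdef_of_ge T (a : R) : 0 < a -> a%:C%:M <<= T -> posdef T.
Proof.
move=> a0 p; split=> [|x x0].
  have := psd_herm p; rewrite /selfadjoint adjB adj_scalar conjC_rc.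
  exact: addIr.
have := psd_ge0 x p; rewrite qformD qformN qform_scalar subr_ge0 qform.unlock.
apply: lt_le_trans; rewrite -rmorphM ltcR mulr_gt0 // exprn_gt0 //.
exact: vnorm_gt0.
Qed.

Lemma posdef_psd T : posdef T -> psdm T.
Proof.
move=> [h p]; apply: psdmI => [//|x]; rewrite qform.unlock.
have [->|x0] := eqVneq x 0; first by rewrite mulmx0 mxE.
exact/ltW/p.
Qed.

Lemma unit_of_inj A : (forall x, A *m x = 0 -> x = 0) -> A \in unitmx.
Proof.
move=> h; rewrite -unitmx_tr -row_free_unit -kermx_eq0; apply/eqP/row_matrixP => i.
rewrite row0; apply: trmx_inj; rewrite trmx0; apply: h.
by apply: trmx_inj; rewrite trmx_mul trmxK -row_mul mulmx_ker row0 trmx0.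
Qed.

Lemma posdef_unit T : posdef T -> T \in unitmx.
Proof.
move=> [h p]; apply: unit_of_inj => x Tx; apply/eqP; apply: contraT => x0.
by have := p x x0; rewrite -mulmxA Tx mulmx0 mxE ltxx.
Qed.

End Psd.

Section RealImaginaryParts.
Context {R : realType}.
Variable n : nat.
Implicit Types (A B T X Y : 'M[R[i]]_n).

Definition ReMx X : 'M[R[i]]_n := (2^-1)%:C *: (X + X^t*).

(** The value of the normalised trace where the trace is real, as for
    self-adjoint matrices. *)
Definition rtr X : R := complex.Re (ntr X).

Lemma two_iE : 2 * (0 +i* 1) = 0 +i* 2 :> R[i].
Proof.
by rewrite -(rmorph_nat (real_complex R)); apply: eqC => /=; ring.
Qed.

Lemma two_i_neq0 : 2 * (0 +i* 1) != 0 :> R[i].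
Proof. by rewrite two_iE eq_complex /= pnatr_eq0 andbF. Qed.

Lemma ImME X : ImM X = (- (0 +i* 1) * (2^-1)%:C) *: (X - X^t*).
Proof.
congr (_ *: _); apply: (mulIf two_i_neq0); rewrite mulVf ?two_i_neq0 //.
by rewrite two_iE; apply: eqC => /=; field.
Qed.

Lemma selfadj_ImM X : (ImM X)^t* = ImM X.
Proof.
rewrite !ImME adjZ adjB adjK -opprB scalerN -scaleNr; congr (_ *: _).
by apply: eqC => /=; ring.
Qed.

Lemma selfadj_ReMx X : (ReMx X)^t* = ReMx X.
Proof. by rewrite adjZ conjC_rc adjD adjK addrC. Qed.

Lemma ReIm_mx X : X = ReMx X + (0 +i* 1) *: ImM X.
Proof.
rewrite ImME scalerA.
have -> : (0 +i* 1) * (- (0 +i* 1) * (2^-1)%:C) = (2^-1)%:C :> R[i].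
  by apply: eqC => /=; ring.
have h : (2^-1)%:C * 2 = 1 :> R[i].
  by rewrite -(rmorph_nat (real_complex R)) -rmorphM mulVf ?rmorph1 ?pnatr_eq0.
rewrite -[LHS]scale1r -h /ReMx; mxlin.
Qed.

Lemma mnorm_ImM X : mnorm (ImM X) <= mnorm X.
Proof.
rewrite ImME mnormZ cabsM cabsN cabs_real ger0_norm ?invr_ge0 //.
have -> : cabs (0 +i* 1) = 1 :> R.
  by rewrite cabs.unlock /= expr0n expr1n add0r sqrtr1.
by have := mnormB X (X^t*); rewrite mnorm_adj mul1r; lra.
Qed.

Lemma mnorm_ReMx X : mnorm (ReMx X) <= mnorm X.
Proof.
rewrite mnormZ cabs_real ger0_norm ?invr_ge0 //.
by have := mnormD X (X^t*); rewrite mnorm_adj; lra.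
Qed.

Lemma mnorm_le_ReIm X : mnorm X <= mnorm (ReMx X) + mnorm (ImM X).
Proof.
rewrite [X in mnorm X <= _]ReIm_mx; apply: le_trans (mnormD _ _) _.
rewrite lerD2l mnormZ cabs.unlock /= expr0n expr1n add0r sqrtr1 mul1r.
exact: lexx.
Qed.

Lemma ntrD X Y : ntr (X + Y) = ntr X + ntr Y.
Proof. by rewrite /ntr mxtraceD mulrDl. Qed.
Lemma ntrN X : ntr (- X) = - ntr X.
Proof. by rewrite /ntr raddfN mulNr. Qed.
Lemma ntrB X Y : ntr (X - Y) = ntr X - ntr Y.
Proof. by rewrite ntrD ntrN. Qed.
Lemma ntrZ a X : ntr (a *: X) = a * ntr X.
Proof. by rewrite /ntr mxtraceZ mulrA. Qed.
Lemma ntr_adj X : ntr (X^t*) = (ntr X)^*.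
Proof.
by rewrite /ntr mxtrace_adj rmorphM fmorphV rmorph_nat.
Qed.
Lemma ntr_mulC X Y : ntr (X *m Y) = ntr (Y *m X).
Proof. by rewrite /ntr mxtrace_mulC. Qed.

Lemma ntr_herm X : X^t* = X -> ntr X = (rtr X)%:C.
Proof. by move=> hX; apply: real_of_conj; rewrite -ntr_adj hX. Qed.

Lemma rtrD X Y : rtr (X + Y) = rtr X + rtr Y.
Proof. by rewrite /rtr ntrD ReD. Qed.
Lemma rtrN X : rtr (- X) = - rtr X.
Proof. by rewrite /rtr ntrN ReN. Qed.
Lemma rtrZ (a : R) X : rtr (a%:C *: X) = a * rtr X.
Proof. by rewrite /rtr ntrZ ReMr. Qed.

Lemma psd_rtr T : psdm T -> 0 <= rtr T.
Proof.
move=> pT; have := psd_trace pT.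
have : 0 <= (n%:R : R[i])^-1 by rewrite invr_ge0 ler0n.
move=> h1 h2; have := mulr_ge0 h2 h1; rewrite -/(ntr T).
by move=> /ge0_rc [].
Qed.

Lemma psd_ntr_mul A B : psdm A -> psdm B -> 0 <= ntr (A *m B).
Proof.
by move=> pA pB; rewrite mulr_ge0 ?psd_tr_mul // invr_ge0 ler0n.
Qed.

Lemma rtr_mono A B : A <<= B -> rtr A <= rtr B.
Proof. by move/psd_rtr; rewrite rtrD rtrN subr_ge0. Qed.

Lemma rtr_ImM X : rtr (ImM X) = complex.Im (ntr X).
Proof.
rewrite /rtr ImME ntrZ ntrB ntr_adj; by case: (ntr X) => a b /=; field.
Qed.

Hypothesis n0 : (0 < n)%N.

Lemma ntr_scalar (a : R[i]) : ntr (a%:M : 'M[R[i]]_n) = a.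
Proof.
by rewrite /ntr mxtrace_scalar -[a *+ n]mulr_natr mulfK // pnatr_eq0 -lt0n.
Qed.

Lemma rtr_scalar (a : R) : rtr (a%:C%:M : 'M[R[i]]_n) = a.
Proof. by rewrite /rtr ntr_scalar. Qed.

Lemma rtr_le_mnorm X : `|rtr X| <= mnorm X.
Proof. exact: le_trans (Re_le_cabs _) (cabs_ntr n0 _). Qed.

End RealImaginaryParts.

(** * Flat positive maps and the Dyson equation *)

(** The properties of the self-energy on which the whole argument rests. *)
Record energy_map (R : realType) (n : nat) (S : 'M[R[i]]_n -> 'M[R[i]]_n)
    (c C : R) : Prop := EnergyMap {
  emD : forall X Y, S (X + Y) = S X + S Y;
  emZ : forall a X, S (a *: X) = a *: S X;
  em_adj : forall X, S (X^t*) = (S X)^t*;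
  em_sym : forall X Y, \tr (S X *m Y) = \tr (X *m S Y);
  em_gt0 : 0 < c;
  em_lt : c <= C;
  em_lb : forall T, psdm T -> (c * rtr T)%:C%:M <<= S T;
  em_ub : forall T, psdm T -> S T <<= (C * rtr T)%:C%:M
}.

Section EnergyMap.
Context {R : realType}.
Variables (n : nat) (S : 'M[R[i]]_n -> 'M[R[i]]_n) (c C : R).
Hypothesis hS : energy_map S c C.
Implicit Types (A B T X Y : 'M[R[i]]_n).

Lemma emN X : S (- X) = - S X.
Proof. by rewrite -scaleN1r (emZ hS) scaleN1r. Qed.

Lemma emB X Y : S (X - Y) = S X - S Y.
Proof. by rewrite (emD hS) emN. Qed.

Lemma em_Cgt0 : 0 < C.
Proof. exact: lt_le_trans (em_gt0 hS) (em_lt hS). Qed.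

Lemma em_psd T : psdm T -> psdm (S T).
Proof.
move=> pT; apply: loewner_psd (em_lb hS pT).
by apply: psd_scalar; rewrite mulr_ge0 ?psd_rtr // ltW // (em_gt0 hS).
Qed.

Lemma em_mono A B : A <<= B -> S A <<= S B.
Proof. by move=> h; rewrite -emB; apply: em_psd. Qed.

Lemma em_psd_norm T : psdm T -> mnorm (S T) <= C * rtr T.
Proof.
move=> pT; apply: psd_norm_le (em_ub hS pT); last exact: em_psd.
by rewrite mulr_ge0 ?psd_rtr // ltW // em_Cgt0.
Qed.

Hypothesis n0 : (0 < n)%N.

Let em_herm_norm X : X^t* = X -> mnorm (S X) <= 2 * (C * mnorm X).
Proof.
move=> hX.
have k Y : Y^t* = Y -> mnorm Y <= mnorm X -> S Y <<= (C * mnorm X)%:C%:M.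
  move=> hY YX; have p : psdm ((mnorm X)%:C%:M : 'M[R[i]]_n).
    exact/psd_scalar/mnorm_ge0.
  have := em_ub hS p; rewrite rtr_scalar //.
  exact/loewner_trans/em_mono/herm_le_mnorm.
apply: sandwich_norm; first by rewrite mulr_ge0 ?mnorm_ge0 // ltW // em_Cgt0.
  exact: k.
by rewrite -emN; apply: k; rewrite ?adjN ?hX ?mnormN.
Qed.

(** A factor 2 comes from the splitting into real and imaginary parts, another
    one from bounding a self-adjoint matrix from both sides. *)
Lemma em_norm X : mnorm (S X) <= 4 * C * mnorm X.
Proof.
rewrite {1}(ReIm_mx X) (emD hS) (emZ hS).
apply: le_trans (mnormD _ _) _; rewrite mnormZ.
have -> : cabs (0 +i* 1) = 1 :> R.
  by rewrite cabs.unlock /= expr0n expr1n add0r sqrtr1.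
have h1 := em_herm_norm (selfadj_ReMx X).
have h2 := em_herm_norm (selfadj_ImM X).
have k1 := ler_wpM2l (ltW em_Cgt0) (mnorm_ReMx X).
have k2 := ler_wpM2l (ltW em_Cgt0) (mnorm_ImM X).
lra.
Qed.

End EnergyMap.

Section DysonAlgebra.
Context {R : realType}.
Variables (n : nat) (S : 'M[R[i]]_n -> 'M[R[i]]_n) (c C : R).
Variable A : 'M[R[i]]_n.
Hypothesis hS : energy_map S c C.
Hypothesis hA : A^t* = A.
Implicit Types (z : R[i]) (X Y M : 'M[R[i]]_n).

(** The equation without the condition on the imaginary part, since it is also
    used on the real axis, where this part can vanish. *)
Definition mde_eq z M : Prop := (A - z%:M - S M) *m M = 1%:M.

Lemma solves_mde_eq z M : solves_MDE A S z M <-> mde_eq z M /\ posdef (ImM M).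
Proof.
have -> : solves_MDE A S z M =
  (1%:M + (z%:M - A + S M) *m M = 0 /\ posdef (ImM M)) by [].
have -> : z%:M - A + S M = - (A - z%:M - S M) by mxlin.
rewrite mulNmx /mde_eq.
split=> -[e p]; split=> //.
  by apply/esym/eqP; rewrite -subr_eq0 e.
by rewrite e subrr.
Qed.

Lemma mde_invr z M : mde_eq z M -> M *m (A - z%:M - S M) = 1%:M.
Proof. by move/mulmx1C. Qed.

Lemma mde_unit z M : mde_eq z M -> M \in unitmx.
Proof. by move=> e; have [] := mulmx1_unit e. Qed.

(** The difference of the inverses of two solutions is affine in the
    difference of the solutions. *)
Lemma two_point z1 z2 M1 M2 : mde_eq z1 M1 -> mde_eq z2 M2 ->
  M1 - M2 = M1 *m ((z1 - z2)%:M + S (M1 - M2)) *m M2.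
Proof.
move=> /mde_invr e1 e2.
have -> : (z1 - z2)%:M + S (M1 - M2) =
    (A - z2%:M - S M2) - (A - z1%:M - S M1) by rewrite (emB hS); mxlin.
by rewrite mulmxBr mulmxBl e1 -mulmxA e2 mulmx1 mul1mx.
Qed.

(** Stability is studied in the form where the solution to expand around stands
    on the left. *)
Lemma two_point_sym z1 z2 M1 M2 : mde_eq z1 M1 -> mde_eq z2 M2 ->
  M1 - M2 = M2 *m ((z1 - z2)%:M + S (M1 - M2)) *m M1.
Proof.
move=> e1 e2; rewrite -[LHS]opprB (two_point e2 e1) -mulNmx -mulmxN.
congr (_ *m _ *m _); rewrite -(opprB M1 M2) (emN hS).
by mxlin.
Qed.

Lemma mde_adj z M : mde_eq z M -> mde_eq z^* (M^t*).
Proof.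
move/mde_invr/(congr1 (fun X => X^t*)).
by rewrite adjM !adjB adj_scalar adj1 hA -(em_adj hS).
Qed.

Let im_scale (z : R[i]) : z - z^* = (2 * (0 +i* 1)) * (complex.Im z)%:C.
Proof. by rewrite two_iE; case: z => a b; apply: eqC => /=; ring. Qed.

Let two_i_unit := @two_i_neq0 R.

(** The two-point identity between [M] and its adjoint, which solves the
    equation at the conjugate spectral parameter. *)
Lemma mde_ImMr z M : mde_eq z M ->
  ImM M = M *m ((complex.Im z)%:C%:M + S (ImM M)) *m M^t*.
Proof.
move=> e; have := two_point e (mde_adj e).
have eD : M - M^t* = (2 * (0 +i* 1)) *: ImM M.
  by rewrite scalerA mulfV // scale1r.
rewrite eD (emZ hS) im_scale -scale_scalar_mx -scalerDr -scalemxAr -scalemxAl.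
by move/(scalerI two_i_unit).
Qed.

Lemma mde_ImMl z M : mde_eq z M ->
  ImM M = M^t* *m ((complex.Im z)%:C%:M + S (ImM M)) *m M.
Proof.
move=> e; have := two_point (mde_adj e) e.
have eD : M^t* - M = - (2 * (0 +i* 1)) *: ImM M.
  by rewrite scalerA mulNr mulfV // scaleN1r opprB.
have -> : z^* - z = - (2 * (0 +i* 1)) * (complex.Im z)%:C.
  by rewrite mulNr -im_scale opprB.
rewrite eD (emZ hS) -scale_scalar_mx -scalerDr -scalemxAr -scalemxAl.
by apply: scalerI; rewrite oppr_eq0.
Qed.

End DysonAlgebra.

(** * The self-energy is a flat positive map *)

Section SelfEnergy.
Context {R : realType} {d : measure_display} {T : measurableType d}.
Variable P : probability T R.
Implicit Types (X Y : T -> R[i]) (f g : T -> R).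

Let rE f := fine 'E_P[f].

Let integrD f g : f \in Lfun P 1 -> g \in Lfun P 1 ->
  (fun w => f w + g w) \in Lfun P 1.
Proof.
move=> /Lfun1_integrable hf /Lfun1_integrable hg; apply/Lfun1_integrable.
by have := integrableD measurableT hf hg; apply: eq_integrable => // x _.
Qed.

Let integrZ (a : R) f : f \in Lfun P 1 -> (fun w => a * f w) \in Lfun P 1.
Proof.
move=> /Lfun1_integrable hf; apply/Lfun1_integrable.
by have := integrableZl measurableT a hf; apply: eq_integrable => // x _.
Qed.

Let rED f g : f \in Lfun P 1 -> g \in Lfun P 1 ->
  rE (fun w => f w + g w) = rE f + rE g.
Proof.
move=> hf hg; rewrite /rE -fineD ?expectation_fin_num //.
by rewrite -expectationD.
Qed.

Let rEZ (a : R) f : f \in Lfun P 1 -> rE (fun w => a * f w) = a * rE f.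
Proof.
move=> hf; rewrite /rE.
have -> : (fun w => a * f w) = a \o* f by apply/funext => x /=; rewrite mulrC.
by rewrite expectationZl // fineM ?expectation_fin_num.
Qed.

Let cintegr X := (fun w => complex.Re (X w)) \in Lfun P 1 /\
                 (fun w => complex.Im (X w)) \in Lfun P 1.

Let cintegrD X Y : cintegr X -> cintegr Y -> cintegr (fun w => X w + Y w).
Proof.
move=> [h1 h2] [k1 k2]; split.
  by under eq_fun do rewrite ReD; exact: integrD.
by under eq_fun do rewrite ImD; exact: integrD.
Qed.

Let EcD X Y : cintegr X -> cintegr Y ->
  Ec P (fun w => X w + Y w) = Ec P X + Ec P Y.
Proof.
move=> [h1 h2] [k1 k2]; apply: eqC; rewrite ?(ReD, ImD) /=.
  by under eq_fun do rewrite ReD; exact: rED.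
by under eq_fun do rewrite ImD; exact: rED.
Qed.

Let ReMe (a z : R[i]) : complex.Re (a * z) =
  complex.Re a * complex.Re z + (- complex.Im a) * complex.Im z.
Proof. by case: a z => [a b] [u v] /=; rewrite mulNr. Qed.

Let ImMe (a z : R[i]) : complex.Im (a * z) =
  complex.Re a * complex.Im z + complex.Im a * complex.Re z.
Proof. by case: a z => [a b] [u v] /=. Qed.

Let cintegrZ a X : cintegr X -> cintegr (fun w => a * X w).
Proof.
move=> [h1 h2]; split.
  by under eq_fun do rewrite ReMe; apply: integrD; exact: integrZ.
by under eq_fun do rewrite ImMe; apply: integrD; exact: integrZ.
Qed.

Let EcZ a X : cintegr X -> Ec P (fun w => a * X w) = a * Ec P X.
Proof.
move=> [h1 h2]; apply: eqC; rewrite ?(ReMe, ImMe) /=.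
  under eq_fun do rewrite ReMe.
  by rewrite -/(rE _) rED ?rEZ //; exact: integrZ.
under eq_fun do rewrite ImMe.
by rewrite -/(rE _) rED ?rEZ //; exact: integrZ.
Qed.

Let Ec_conj X : cintegr X -> Ec P (fun w => (X w)^*) = (Ec P X)^*.
Proof.
move=> [h1 h2]; apply: eqC; rewrite ?(ReJ, ImJ) /=.
  by under eq_fun do rewrite ReJ.
under eq_fun do rewrite ImJ -mulN1r.
by rewrite -/(rE _) rEZ // mulN1r.
Qed.

Let cintegr0 : cintegr (fun=> 0).
Proof.
have h : (fun=> 0 : R) \in Lfun P 1.
  by apply/Lfun1_integrable; exact: integrable0.
by split.
Qed.

Let Ec0 : Ec P (fun=> 0) = 0.
Proof.
have := EcZ 0 cintegr0.
by under eq_fun do rewrite mul0r; rewrite mul0r.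
Qed.

Let Ec_sum (I : finType) (F : I -> T -> R[i]) : (forall j, cintegr (F j)) ->
  cintegr (fun w => \sum_j F j w) /\
  Ec P (fun w => \sum_j F j w) = \sum_j Ec P (F j).
Proof.
move=> h; elim: (index_enum I) => [|j s [IH1 IH2]].
  under eq_fun do rewrite big_nil; rewrite big_nil; split; first exact: cintegr0.
  exact: Ec0.
under eq_fun do rewrite big_cons; rewrite big_cons; split; first exact: cintegrD.
by rewrite EcD // IH2.
Qed.

Variables (n : nat) (W : T -> 'M[R[i]]_n).
Hypothesis hW : centered_hermitian_random_matrix P W.

Let cov k l p q := Ec P (fun w => W w k l * W w p q).

Let L2_mul f g : f \in Lfun P 2%:E -> g \in Lfun P 2%:E ->
  (fun w => f w * g w) \in Lfun P 1.
Proof. exact: Lfun2_mul_Lfun1. Qed.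

Let cintegr_prod k l p q : cintegr (fun w => W w k l * W w p q).
Proof.
have [_ hR hI _] := hW; split.
  under eq_fun do rewrite ReMe mulNr -mulN1r.
  by apply: integrD; [|apply: integrZ]; exact: L2_mul.
under eq_fun do rewrite ImMe.
by apply: integrD; exact: L2_mul.
Qed.

Let self_energyE B k l :
  self_energy P W B k l = \sum_p \sum_q B p q * cov k p q l.
Proof.
rewrite mxE.
have -> : (fun w => (W w *m B *m W w) k l) =
   (fun w => \sum_q \sum_p B p q * (W w k p * W w q l)).
  apply/funext => w; rewrite mxE; apply: eq_bigr => q _.
  by rewrite mxE mulr_suml; apply: eq_bigr => p _; ring.
have h q p : cintegr (fun w => B p q * (W w k p * W w q l)).
  exact: cintegrZ.
have h1 q := Ec_sum (h q).
rewrite (Ec_sum (fun q => (h1 q).1)).2 exchange_big /=.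
by apply: eq_bigr => q _; rewrite (h1 q).2; apply: eq_bigr => p _; rewrite EcZ.
Qed.

Let conjW w k l : (W w k l)^* = W w l k.
Proof. by have [h _ _ _] := hW; rewrite -adjE h. Qed.

Let cov_conj k l p q : (cov k l p q)^* = cov q p l k.
Proof.
rewrite -Ec_conj //; congr Ec; apply/funext => w.
by rewrite conjCM !conjW mulrC.
Qed.

Let cov_sym k l p q : cov k l p q = cov p q k l.
Proof. by congr Ec; apply/funext => w; rewrite mulrC. Qed.

(** The self-energy is linear with the covariances [E(W k l * W p q)] as
    coefficients; commutativity of the product makes it symmetric for the trace
    pairing, and the Hermitian symmetry of [W] makes it commute with the
    adjoint. *)
Lemma self_energy_energy_map (c C : R) : 0 < c -> c <= C ->
  flat (self_energy P W) c C -> energy_map (self_energy P W) c C.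
Proof.
move=> c0 cC hflat; split=> //.
- move=> X Y; apply/matrixP => k l; rewrite addmxE !self_energyE -big_split.
  apply: eq_bigr => p _; rewrite -big_split; apply: eq_bigr => q _ /=.
  by rewrite addmxE mulrDl.
- move=> a X; apply/matrixP => k l; rewrite scalemxE !self_energyE mulr_sumr.
  apply: eq_bigr => p _; rewrite mulr_sumr; apply: eq_bigr => q _.
  by rewrite scalemxE mulrA.
- move=> X; apply/matrixP => k l; rewrite adjE !self_energyE conjC_sum.
  rewrite exchange_big; apply: eq_bigr => p _; rewrite conjC_sum.
  by apply: eq_bigr => q _; rewrite adjE conjCM cov_conj.
- move=> X Y; rewrite /mxtrace.
  transitivity (\sum_k \sum_l \sum_p \sum_q X p q * cov k p q l * Y l k).
    apply: eq_bigr => k _; rewrite mxE; apply: eq_bigr => l _.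
    rewrite self_energyE mulr_suml; apply: eq_bigr => p _.
    by rewrite mulr_suml.
  transitivity (\sum_p \sum_q \sum_l \sum_k X p q * cov k p q l * Y l k).
    etransitivity; first by apply: eq_bigr => k _; exact: exchange_big.
    rewrite exchange_big; apply: eq_bigr => p _ /=.
    etransitivity.
      by apply: eq_bigr => k _; exact: exchange_big.
    rewrite exchange_big; apply: eq_bigr => q _ /=.
    exact: exchange_big.
  apply: eq_bigr => p _; rewrite mxE; apply: eq_bigr => q _.
  rewrite self_energyE mulr_sumr; apply: eq_bigr => l _.
  rewrite mulr_sumr; apply: eq_bigr => k _; rewrite (cov_sym k p).
  by rewrite -!mulrA [_ * Y _ _]mulrC.
- move=> B pB; have pB' : psd B by rewrite -psdmE.
  have [h _] := hflat B pB'; rewrite psdmE.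
  by move: h; rewrite (ntr_herm (psd_herm pB)) -rmorphM.
- move=> B pB; have pB' : psd B by rewrite -psdmE.
  have [_ h] := hflat B pB'; rewrite psdmE.
  by move: h; rewrite (ntr_herm (psd_herm pB)) -rmorphM.
Qed.

End SelfEnergy.

(** * Limits along ultrafilters *)

Section UltrafilterLimits.
Context {R : realType} {I : Type} (F : set_system I).
Context {FF : ProperFilter F}.
Implicit Types (u v : I -> R) (f g : I -> R[i]).

Lemma squeeze0 u v : (\forall i \near F, 0 <= u i <= v i) ->
  v i @[i --> F] --> 0 -> u i @[i --> F] --> 0.
Proof. by move=> h hv; apply: (squeeze_cvgr h) hv; exact: cvg_cst. Qed.

Lemma cvg0D u v : u i @[i --> F] --> 0 -> v i @[i --> F] --> 0 ->
  u i + v i @[i --> F] --> 0.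
Proof. by move=> hu hv; rewrite -[X in _ --> X](addr0 (0 : R)); exact: cvgD. Qed.

Lemma cvg_distP u (l : R) :
  u i @[i --> F] --> l <-> `|u i - l| @[i --> F] --> (0 : R).
Proof.
split=> [/subr_cvg0 h|h]; first exact/(norm_cvg0P (fun i => u i - l)).
apply/subr_cvg0; exact/(norm_cvg0P (fun i => u i - l)).
Qed.

Lemma cvg0M_bound u v b : u i @[i --> F] --> 0 ->
  (\forall i \near F, `|v i| <= b) -> u i * v i @[i --> F] --> 0.
Proof.
move=> hu hv; apply/norm_cvg0P.
apply: (@squeeze0 _ (fun i => `|u i| * b)).
  apply: filterS hv => i vi; rewrite normr_ge0 normrM ler_wpM2l //.
rewrite -[X in _ --> X](mul0r b); apply: cvgMl; exact/norm_cvg0P.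
Qed.

Lemma cvgr_unique u (a l : R) : u i @[i --> F] --> a -> u i @[i --> F] --> l ->
  a = l.
Proof. by move=> ha hl; rewrite (cvg_unique _ ha hl). Qed.

Lemma cvg_ge u (a l : R) : u i @[i --> F] --> l ->
  (\forall i \near F, a <= u i) -> a <= l.
Proof.
move=> hu h; have := limr_ge (cvgP _ hu) h.
by rewrite (cvg_lim _ hu) => [/(_ FF)//|]; exact: norm_hausdorff.
Qed.

Lemma cvg_le u (a l : R) : u i @[i --> F] --> l ->
  (\forall i \near F, u i <= a) -> l <= a.
Proof.
move=> hu h; rewrite -lerN2; apply: (@cvg_ge (fun i => - u i)); first exact: cvgN.
by apply: filterS h => i; rewrite lerN2.
Qed.

Lemma cvg0_sum (J : finType) (G : J -> I -> R) :
  (forall p, G p i @[i --> F] --> 0) -> \sum_p G p i @[i --> F] --> 0.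
Proof.
move=> hG; elim: (index_enum J) => [|p s IH].
  by under eq_fun do rewrite big_nil; exact: cvg_cst.
by under eq_fun do rewrite big_cons; exact: cvg0D.
Qed.

Lemma cvg_le0_eq (a : R) u : 0 <= a -> (\forall i \near F, a <= u i) ->
  u i @[i --> F] --> 0 -> a = 0.
Proof.
move=> a0 h hu; apply: le_anti; rewrite a0 andbT.
exact: cvg_ge hu h.
Qed.

(** Stated with the real-valued distance to the limit, so that all limits are
    handled by squeezing real functions. *)
Definition ccvg f (a : R[i]) : Prop := cabs (f i - a) @[i --> F] --> 0.

Variable n : nat.
Implicit Types (h k : I -> 'M[R[i]]_n) (X Y : 'M[R[i]]_n).

Definition mcvg h X : Prop := mnorm (h i - X) @[i --> F] --> 0.

Lemma ccvg_ext f g a : (\forall i \near F, f i = g i) -> ccvg f a -> ccvg g a.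
Proof.
move=> e; apply: squeeze0; apply: filterS e => i ->.
by rewrite cabs_ge0 lexx.
Qed.

Lemma mcvg_ext h k X : (\forall i \near F, h i = k i) -> mcvg h X -> mcvg k X.
Proof.
move=> e; apply: squeeze0; apply: filterS e => i ->.
by rewrite mnorm_ge0 lexx.
Qed.

Lemma ccvg_bounded f a : ccvg f a -> \forall i \near F, cabs (f i) <= cabs a + 1.
Proof.
move=> /cvgr_lt/(_ 1 ltr01); apply: filterS => i h.
by have := cabsD (f i - a) a; rewrite subrK; lra.
Qed.

Lemma mcvg_bounded h X : mcvg h X ->
  \forall i \near F, mnorm (h i) <= mnorm X + 1.
Proof.
move=> /cvgr_lt/(_ 1 ltr01); apply: filterS => i hi.
by have := mnormD (h i - X) X; rewrite subrK; lra.
Qed.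

Lemma ccvg_cst a : ccvg (fun=> a) a.
Proof. by rewrite /ccvg subrr cabs0; exact: cvg_cst. Qed.

Lemma mcvg_cst X : mcvg (fun=> X) X.
Proof. by rewrite /mcvg subrr mnorm0; exact: cvg_cst. Qed.

Lemma ccvgD f g a b : ccvg f a -> ccvg g b -> ccvg (fun i => f i + g i) (a + b).
Proof.
move=> hf hg; apply: squeeze0 (cvg0D hf hg); near=> i.
rewrite cabs_ge0 /=; have := cabsD (f i - a) (g i - b).
by rewrite addrACA -opprD.
Unshelve. all: by end_near. Qed.

Lemma mcvgD h k X Y : mcvg h X -> mcvg k Y -> mcvg (fun i => h i + k i) (X + Y).
Proof.
move=> hf hg; apply: squeeze0 (cvg0D hf hg); near=> i.
rewrite mnorm_ge0 /=; have := mnormD (h i - X) (k i - Y).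
by rewrite addrACA -opprD.
Unshelve. all: by end_near. Qed.

Lemma ccvgM f g a b : ccvg f a -> ccvg g b -> ccvg (fun i => f i * g i) (a * b).
Proof.
move=> hf hg.
have h1 : cabs (f i - a) * cabs (g i) @[i --> F] --> 0.
  apply: (cvg0M_bound hf (b := cabs b + 1)); apply: filterS (ccvg_bounded hg) => i.
  by rewrite ger0_norm ?cabs_ge0.
have h2 : cabs (g i - b) * cabs a @[i --> F] --> 0.
  apply: (cvg0M_bound hg (b := cabs a)); near=> i.
  by rewrite ger0_norm ?cabs_ge0.
apply: squeeze0 (cvg0D h1 h2); near=> i.
rewrite cabs_ge0 /= -!cabsM; apply: le_trans (cabsD _ _).
by rewrite le_eqVlt; apply/orP; left; apply/eqP; congr cabs; ring.
Unshelve. all: by end_near. Qed.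

Lemma mcvgM h k X Y : mcvg h X -> mcvg k Y ->
  mcvg (fun i => h i *m k i) (X *m Y).
Proof.
move=> hf hg.
have h1 : mnorm (h i - X) * mnorm (k i) @[i --> F] --> 0.
  apply: (cvg0M_bound hf (b := mnorm Y + 1)).
  by apply: filterS (mcvg_bounded hg) => i; rewrite ger0_norm ?mnorm_ge0.
have h2 : mnorm (k i - Y) * mnorm X @[i --> F] --> 0.
  apply: (cvg0M_bound hg (b := mnorm X)); near=> i.
  by rewrite ger0_norm ?mnorm_ge0.
apply: squeeze0 (cvg0D h1 h2); near=> i.
rewrite mnorm_ge0 /=.
have -> : h i *m k i - X *m Y = (h i - X) *m k i + X *m (k i - Y).
  by rewrite mulmxBl mulmxBr addrA subrK.
apply: le_trans (mnormD _ _) _.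
by rewrite lerD ?mnormM // mulrC mnormM.
Unshelve. all: by end_near. Qed.

Lemma mcvgZ f h a X : ccvg f a -> mcvg h X ->
  mcvg (fun i => f i *: h i) (a *: X).
Proof.
move=> hf hg.
have h1 : cabs (f i - a) * mnorm (h i) @[i --> F] --> 0.
  apply: (cvg0M_bound hf (b := mnorm X + 1)).
  by apply: filterS (mcvg_bounded hg) => i; rewrite ger0_norm ?mnorm_ge0.
have h2 : mnorm (h i - X) * cabs a @[i --> F] --> 0.
  apply: (cvg0M_bound hg (b := cabs a)); near=> i.
  by rewrite ger0_norm ?cabs_ge0.
apply: squeeze0 (cvg0D h1 h2); near=> i.
rewrite mnorm_ge0 /= -mnormZ mulrC -mnormZ.
have -> : f i *: h i - a *: X = (f i - a) *: h i + a *: (h i - X) by mxlin.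
exact: mnormD.
Unshelve. all: by end_near. Qed.

Lemma mcvgN h X : mcvg h X -> mcvg (fun i => - h i) (- X).
Proof.
apply: squeeze0; near=> i.
by rewrite mnorm_ge0 -opprD mnormN lexx.
Unshelve. all: by end_near. Qed.

Lemma mcvgB h k X Y : mcvg h X -> mcvg k Y -> mcvg (fun i => h i - k i) (X - Y).
Proof. by move=> hf hg; apply: mcvgD hf (mcvgN hg). Qed.

Lemma mcvg_adj h X : mcvg h X -> mcvg (fun i => (h i)^t*) (X^t*).
Proof.
apply: squeeze0; near=> i.
by rewrite mnorm_ge0 -adjB mnorm_adj lexx.
Unshelve. all: by end_near. Qed.

Lemma ccvg_conj f a : ccvg f a -> ccvg (fun i => (f i)^*) (a^*).
Proof.
apply: squeeze0; near=> i.
by rewrite cabs_ge0 -conjCN -conjCD cabsJ lexx.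
Unshelve. all: by end_near. Qed.

Lemma mcvg_scalar f a : ccvg f a -> mcvg (fun i => (f i)%:M) a%:M.
Proof.
apply: squeeze0; near=> i.
by rewrite mnorm_ge0 -raddfB mnorm_scalar_le.
Unshelve. all: by end_near. Qed.

Lemma mcvg_linear (S : 'M[R[i]]_n -> 'M[R[i]]_n) (C : R) h X :
  (forall Y Z, S (Y - Z) = S Y - S Z) -> (forall Y, mnorm (S Y) <= C * mnorm Y) ->
  mcvg h X -> mcvg (fun i => S (h i)) (S X).
Proof.
move=> SB Sn hX; apply: (@squeeze0 _ (fun i => mnorm (h i - X) * C)).
  by near=> i; rewrite mnorm_ge0 -SB mulrC Sn.
rewrite -[X in _ --> X](mul0r C); exact: cvgMl.
Unshelve. all: by end_near. Qed.

Lemma ccvg_unique f a b : ccvg f a -> ccvg f b -> a = b.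
Proof.
move=> ha hb; apply/eqP; rewrite -subr_eq0; apply/eqP/cabs_eq0.
apply: cvg_le0_eq (cabs_ge0 _) _ (cvg0D ha hb); near=> i.
rewrite -(cabsN (f i - a)); have := cabsD (- (f i - a)) (f i - b).
by rewrite opprB addrA subrK.
Unshelve. all: by end_near. Qed.

Lemma mcvg_unique h X Y : mcvg h X -> mcvg h Y -> X = Y.
Proof.
move=> ha hb; apply/eqP; rewrite -subr_eq0; apply/eqP/mnorm_eq0.
apply: cvg_le0_eq (mnorm_ge0 _) _ (cvg0D ha hb); near=> i.
rewrite -(mnormN (h i - X)); have := mnormD (- (h i - X)) (h i - Y).
by rewrite opprB addrA subrK.
Unshelve. all: by end_near. Qed.

Lemma mcvg_norm h X : mcvg h X -> mnorm (h i) @[i --> F] --> mnorm X.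
Proof.
move=> hX; apply/cvg_distP; apply: squeeze0 hX; near=> i.
rewrite normr_ge0 /= ler_norml; apply/andP; split.
  by have := mnormB (h i) (h i - X); rewrite subKr; lra.
by have := mnormD (h i - X) X; rewrite subrK; lra.
Unshelve. all: by end_near. Qed.

Lemma mcvg_norm_le h X b : mcvg h X -> (\forall i \near F, mnorm (h i) <= b) ->
  mnorm X <= b.
Proof. by move=> /mcvg_norm hX hb; apply: (cvg_le hX hb). Qed.

Lemma ccvg_Re f a : ccvg f a ->
  complex.Re (f i) @[i --> F] --> complex.Re a.
Proof.
move=> hf; apply/cvg_distP; apply: squeeze0 hf; near=> i.
by rewrite normr_ge0 -ReN -ReD Re_le_cabs.
Unshelve. all: by end_near. Qed.

Lemma ccvg_Im f a : ccvg f a ->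
  complex.Im (f i) @[i --> F] --> complex.Im a.
Proof.
move=> hf; apply/cvg_distP; apply: squeeze0 hf; near=> i.
by rewrite normr_ge0 -ImN -ImD Im_le_cabs.
Unshelve. all: by end_near. Qed.

Lemma ccvg_ReIm f a : complex.Re (f i) @[i --> F] --> complex.Re a ->
  complex.Im (f i) @[i --> F] --> complex.Im a -> ccvg f a.
Proof.
move=> /cvg_distP hR /cvg_distP hI.
apply: squeeze0 (cvg0D hR hI); near=> i.
by rewrite cabs_ge0 -!ReN -!ImN -!ReD -!ImD cabs_le_ReIm.
Unshelve. all: by end_near. Qed.

Lemma ccvg_real u (l : R) : u i @[i --> F] --> l -> ccvg (fun i => (u i)%:C) l%:C.
Proof. by move=> h; apply: ccvg_ReIm => //=; exact: cvg_cst. Qed.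

Lemma ccvg_abs f a : ccvg f a -> cabs (f i) @[i --> F] --> cabs a.
Proof.
move=> hX; apply/cvg_distP; apply: squeeze0 hX; near=> i.
rewrite normr_ge0 /= ler_norml; apply/andP; split.
  by have := cabsD (f i) (a - f i); rewrite addrC subrK -(cabsN (a - _)) opprB; lra.
by have := cabsD (f i - a) a; rewrite subrK; lra.
Unshelve. all: by end_near. Qed.

Lemma ccvg0_abs f : cabs (f i) @[i --> F] --> 0 -> ccvg f 0.
Proof. by apply: squeeze0; near=> i; rewrite subr0 cabs_ge0 lexx.
Unshelve. all: by end_near. Qed.

Lemma ccvg_ntr h X : (0 < n)%N -> mcvg h X -> ccvg (fun i => ntr (h i)) (ntr X).
Proof.
move=> n0; apply: squeeze0; near=> i.
by rewrite cabs_ge0 -ntrB cabs_ntr.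
Unshelve. all: by end_near. Qed.

Lemma mcvg_psd h X : mcvg h X -> (\forall i \near F, psdm (h i)) -> psdm X.
Proof.
move=> hX hp.
have hq x : ccvg (fun i => qform (h i) x) (qform X x).
  apply: (@squeeze0 _ (fun i => mnorm (h i - X) * vnorm x ^+ 2)); last first.
    by rewrite -[X in _ --> X](mul0r (vnorm x ^+ 2)); exact: cvgMl.
  near=> i; rewrite cabs_ge0 /= -qformN -qformD qform.unlock -mulmxA.
  apply: le_trans (cauchy_schwarz _ _) _.
  by rewrite mulrC expr2 mulrA ler_wpM2r ?vnorm_ge0 // vnorm_mulmx.
apply: psdmI => [|x].
  apply: mcvg_unique (mcvg_adj hX) _; apply: mcvg_ext hX.
  by apply: filterS hp => i /psd_herm.
have hp' : \forall i \near F, 0 <= qform (h i) x.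
  by apply: filterS hp => i; exact: psd_ge0.
rewrite lecE /=; apply/andP; split.
  have : complex.Im (qform (h i) x) @[i --> F] --> (0 : R).
    apply: (@squeeze0 _ (fun=> 0)); last exact: cvg_cst.
    by apply: filterS hp' => i; rewrite lecE /= => /andP[/eqP -> _]; rewrite lexx.
  by move=> h0; rewrite (cvg_unique _ (ccvg_Im (hq x)) h0).
apply: cvg_ge (ccvg_Re (hq x)) _.
by apply: filterS hp' => i; rewrite lecE /= => /andP[_].
Unshelve. all: by end_near. Qed.

Hypothesis FU : UltraFilter F.

(** Bounded functions converge along an ultrafilter; this replaces the
    extraction of subsequences. *)
Lemma ultra_cvg u (b : R) : (\forall i \near F, `|u i| <= b) ->
  exists l : R, u i @[i --> F] --> l.
Proof.
move=> hb.
have [|l [_ hl]] := @segment_compact R (- b) b (u @ F)%classic _.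
  by apply: filterS hb => i; rewrite /= in_itv /= ler_norml.
exists l => B hB.
have [//|hn] := in_ultra_setVsetC (u @^-1` B) FU.
by have [y [yn yB]] := hl (~` B) B hn hB.
Qed.

Lemma ultra_ccvg f b : (\forall i \near F, cabs (f i) <= b) ->
  exists a, ccvg f a.
Proof.
move=> hb.
have [x hx] : exists x : R, complex.Re (f i) @[i --> F] --> x.
  apply: (@ultra_cvg _ b); apply: filterS hb => i.
  exact: le_trans (Re_le_cabs _).
have [y hy] : exists y : R, complex.Im (f i) @[i --> F] --> y.
  apply: (@ultra_cvg _ b); apply: filterS hb => i.
  exact: le_trans (Im_le_cabs _).
by exists (x +i* y); exact: ccvg_ReIm.
Qed.

Lemma ultra_mcvg h b : (\forall i \near F, mnorm (h i) <= b) ->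
  exists X, mcvg h X.
Proof.
move=> hb.
have /choice[X hX] : forall p : 'I_n * 'I_n, exists a,
    ccvg (fun i => h i p.1 p.2) a.
  move=> p; apply: (@ultra_ccvg _ b); apply: filterS hb => i.
  exact: le_trans (entry_le_mnorm _ _ _).
exists (\matrix_(p, q) X (p, q)).
apply: (@squeeze0 _ (fun i => \sum_(p : 'I_n) \sum_(q : 'I_n)
   cabs (h i p q - X (p, q)))).
  near=> i; rewrite mnorm_ge0 /=; apply: le_trans (mnorm_le_sum _) _.
  do 2 (apply: ler_sum => ? _); by rewrite addmxE oppmxE mxE.
by apply: cvg0_sum => p; apply: cvg0_sum => q; exact: (hX (p, q)).
Unshelve. all: by end_near. Qed.

End UltrafilterLimits.

(** * Spectral gap of positive maps *)

(** A positive map [K] with [K V = V] that dominates [e * th T * V] on positive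
    semidefinite [T] contracts the order-unit norm of [V] by [1 - e] on the
    kernel of the functional [th]. The bounds [v1 <= V <= v2] compare this norm
    with the operator norm. *)
Section Doeblin.
Context {R : realType}.
Variable n : nat.
Hypothesis n0 : (0 < n)%N.
Variables (K : 'M[R[i]]_n -> 'M[R[i]]_n) (V : 'M[R[i]]_n) (th : 'M[R[i]]_n -> R[i]).
Variables (v1 v2 e : R).
Hypothesis KD : forall X Y, K (X + Y) = K X + K Y.
Hypothesis KZ : forall a X, K (a *: X) = a *: K X.
Hypothesis Kadj : forall X, K (X^t*) = (K X)^t*.
Hypothesis KV : K V = V.
Hypothesis thD : forall X Y, th (X + Y) = th X + th Y.
Hypothesis thZ : forall a X, th (a *: X) = a * th X.
Hypothesis th_adj : forall X, th (X^t*) = (th X)^*.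
Hypothesis thV : th V = 1.
Hypothesis v10 : 0 < v1.
Hypothesis Vlb : v1%:C%:M <<= V.
Hypothesis Vub : V <<= v2%:C%:M.
Hypothesis e0 : 0 < e.
Hypothesis doeblin : forall T, psdm T -> (e * complex.Re (th T))%:C *: V <<= K T.
Implicit Types (X Y T : 'M[R[i]]_n) (s t : R).

Let KN X : K (- X) = - K X.
Proof. by rewrite -scaleN1r KZ scaleN1r. Qed.

Let thN X : th (- X) = - th X.
Proof. by rewrite -scaleN1r thZ mulN1r. Qed.

Let psdV : psdm V.
Proof. by apply: loewner_psd Vlb; apply: psd_scalar; exact: ltW. Qed.

Let rtrV : 0 < rtr V.
Proof. by apply: lt_le_trans (rtr_mono Vlb); rewrite rtr_scalar. Qed.

Let v2_gt0 : 0 < v2.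
Proof.
by apply: lt_le_trans rtrV _; have := rtr_mono Vub; rewrite rtr_scalar.
Qed.

Let e_le1 : e <= 1.
Proof.
have := rtr_mono (doeblin psdV); rewrite KV thV rtrZ mulr1.
by rewrite -[leRHS]mul1r ler_pM2r.
Qed.

Let within X t := X <<= t%:C *: V /\ - X <<= t%:C *: V.

Let contract X t : th X = 0 -> X <<= t%:C *: V -> K X <<= ((1 - e) * t)%:C *: V.
Proof.
move=> X0 /doeblin; rewrite thD thN X0 subr0 thZ thV mulr1 KD KN KZ KV /=.
by congr psdm; mxlin.
Qed.

Let within_contract X t : th X = 0 -> within X t -> within (K X) ((1 - e) * t).
Proof.
move=> X0 [h1 h2]; split; first exact: contract.
by rewrite -KN; apply: contract; rewrite ?thN ?X0 ?oppr0.
Qed.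

Let within_ge0 X t : within X t -> 0 <= t.
Proof.
move=> [/rtr_mono h1 /rtr_mono h2]; move: h1 h2; rewrite rtrN rtrZ => h1 h2.
by rewrite -(pmulr_lge0 _ rtrV); lra.
Qed.

Let scalar_le_V s : 0 <= s -> s%:C%:M <<= (s / v1)%:C *: V.
Proof.
move=> s0; have := psdZ (divr_ge0 s0 (ltW v10)) Vlb.
by rewrite scalerBr scale_scalar_mx -rmorphM divfK ?gt_eqF.
Qed.

Let within_mnorm X : X^t* = X -> within X (mnorm X / v1).
Proof.
move=> hX; split.
  apply: loewner_trans (scalar_le_V (mnorm_ge0 X)).
  exact: herm_le_mnorm.
apply: loewner_trans (scalar_le_V (mnorm_ge0 X)).
by apply: herm_le_mnorm; rewrite ?adjN ?hX ?mnormN.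
Qed.

Let V_le_scalar s : 0 <= s -> s%:C *: V <<= (s * v2)%:C%:M.
Proof.
by move=> s0; have := psdZ s0 Vub; rewrite scalerBr scale_scalar_mx -rmorphM.
Qed.

Let mnorm_within X t : within X t -> mnorm X <= 2 * (t * v2).
Proof.
move=> h; have t0 := within_ge0 h; have [h1 h2] := h.
apply: sandwich_norm; first by rewrite mulr_ge0 // ltW.
  exact: loewner_trans h1 (V_le_scalar t0).
exact: loewner_trans h2 (V_le_scalar t0).
Qed.

Let withinD X Y s t : within X s -> within Y t -> within (X + Y) (s + t).
Proof.
move=> [a1 a2] [b1 b2]; split.
  have := psdD a1 b1; congr psdm; rewrite rmorphD scalerDl; mxlin.
have := psdD a2 b2; congr psdm; rewrite rmorphD scalerDl; mxlin.
Qed.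

(** The least [t] with [within X t] satisfies [t <= (1 - e) t + y], where [y]
    bounds the order-unit norm of [X - K X]. *)
Let herm_stability X : X^t* = X -> th X = 0 ->
  mnorm X <= 2 * v2 / (v1 * e) * mnorm (X - K X).
Proof.
move=> hX X0; set Y := X - K X.
have hY : Y^t* = Y by rewrite adjB -Kadj hX.
have wY := within_mnorm hY; set y := mnorm Y / v1 in wY.
have step t : within X t -> within X ((1 - e) * t + y).
  by move=> /(within_contract X0) h; have := withinD h wY; rewrite addrC subrK.
pose E := [set t | within X t].
have E0 : has_inf E.
  split; first by exists (mnorm X / v1); exact: within_mnorm.
  by exists 0 => t; exact: within_ge0.
have e1 : 0 <= 1 - e by rewrite subr_ge0.
have main : e * inf E <= y.
  apply/ler_addgt0Pr => d d0.
  have [t Et td] := inf_adherent d0 E0.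
  have := ge_inf E0.2 (step _ Et) => h.
  have h2 := ler_wpM2l e1 (ltW td); have ed := mulr_ge0 (ltW e0) (ltW d0).
  move: h2; rewrite mulrDr !mulrBl !mul1r => h2; lra.
apply/ler_addgt0Pr => d d0.
have d'0 : 0 < d / (2 * v2) by rewrite divr_gt0 // mulr_gt0.
have [t Et td] := inf_adherent d'0 E0.
have := mnorm_within Et => h; apply: le_trans h _.
have -> : 2 * v2 / (v1 * e) * mnorm Y + d = 2 * (y / e + d / (2 * v2)) * v2.
  by rewrite /y; field; rewrite !gt_eqF.
rewrite mulrA ler_pM2r // ler_pM2l // (le_trans (ltW td)) // lerD2r.
by rewrite ler_pdivlMr // mulrC.
Qed.

Lemma doeblin_stability X : th X = 0 ->
  mnorm X <= 4 * v2 / (v1 * e) * mnorm (X - K X).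
Proof.
move=> X0; set a := 4 * v2 / (v1 * e).
have a0 : 0 <= 2 * v2 / (v1 * e).
  by rewrite divr_ge0 ?mulr_ge0 // ltW.
have eRe : ReMx X - K (ReMx X) = ReMx (X - K X).
  by rewrite /ReMx KZ KD Kadj adjB; mxlin.
have eIm : ImM X - K (ImM X) = ImM (X - K X).
  by rewrite !ImME KZ KD KN Kadj adjB; mxlin.
have hR := herm_stability (selfadj_ReMx X).
have hI := herm_stability (selfadj_ImM X).
have tR : th (ReMx X) = 0 by rewrite thZ thD th_adj X0 rmorph0 addr0 mulr0.
have tI : th (ImM X) = 0.
  by rewrite ImME thZ thD thN th_adj X0 rmorph0 oppr0 addr0 mulr0.
have {hR} := hR tR; have {hI} := hI tI; rewrite eRe eIm => hI hR.
have -> : a = 2 * v2 / (v1 * e) + 2 * v2 / (v1 * e).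
  by rewrite /a; field; rewrite !gt_eqF.
rewrite mulrDl; apply: le_trans (mnorm_le_ReIm X) (lerD _ _).
  exact: le_trans hR (ler_wpM2l a0 (mnorm_ReMx _)).
exact: le_trans hI (ler_wpM2l a0 (mnorm_ImM _)).
Qed.

Hypothesis thK : forall X, th (K X) = th X.

Let iter_within X t k : th X = 0 -> within X t ->
  within (iter k K X) ((1 - e) ^+ k * t).
Proof.
move=> X0 h; have X0k j : th (iter j K X) = 0 by elim: j => //= j <-.
elim: k => [|k IH] /=; first by rewrite expr0 mul1r.
by rewrite exprS -mulrA; apply: within_contract.
Qed.

Lemma herm_iter_cvg0 X : X^t* = X -> th X = 0 ->
  mnorm (iter k K X) @[k --> \oo] --> 0.
Proof.
move=> hX X0; have w := within_mnorm hX.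
apply: (@squeeze0 _ _ _ _ _ (fun k => (1 - e) ^+ k * (2 * (mnorm X / v1 * v2)))).
  near=> k; rewrite mnorm_ge0 /=.
  apply: le_trans (mnorm_within (iter_within k X0 w)) _; rewrite le_eqVlt.
  by apply/orP; left; apply/eqP; ring.
rewrite -[X in _ --> X](mul0r (2 * (mnorm X / v1 * v2))); apply: cvgMl.
by apply: cvg_expr; rewrite ger0_norm ?subr_ge0 // ltrBlDr ltrDl.
Unshelve. all: by end_near. Qed.

Lemma iter_cvg0 X : th X = 0 -> mnorm (iter k K X) @[k --> \oo] --> 0.
Proof.
move=> X0.
have tR : th (ReMx X) = 0 by rewrite thZ thD th_adj X0 rmorph0 addr0 mulr0.
have tI : th (ImM X) = 0.
  by rewrite ImME thZ thD thN th_adj X0 rmorph0 oppr0 addr0 mulr0.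
have h1 := herm_iter_cvg0 (selfadj_ReMx X) tR.
have h2 := herm_iter_cvg0 (selfadj_ImM X) tI.
have e1 k : iter k K X = iter k K (ReMx X) + (0 +i* 1) *: iter k K (ImM X).
  by elim: k => [|k IH] /=; [exact: ReIm_mx | rewrite IH KD KZ].
apply: squeeze0 (cvg0D h1 h2); near=> k.
rewrite mnorm_ge0 /= e1; apply: le_trans (mnormD _ _) _.
by rewrite lerD2l mnormZ cabs.unlock /= expr0n expr1n add0r sqrtr1 mul1r.
Unshelve. all: by end_near. Qed.

End Doeblin.

(** The square of the normalised Hilbert-Schmidt norm. *)
HB.lock Definition hs (R : realType) (n : nat) (X : 'M[R[i]]_n) : R :=
  rtr (X^t* *m X).

Section HilbertSchmidt.
Context {R : realType}.
Variable n : nat.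
Hypothesis n0 : (0 < n)%N.
Implicit Types (X Y : 'M[R[i]]_n).

Definition hsip X Y : R[i] := ntr (X^t* *m Y).

Lemma hs_ge0 X : 0 <= hs X.
Proof. by rewrite hs.unlock; exact/psd_rtr/psd_gram. Qed.

Lemma hs_le_mnorm X : hs X <= mnorm X ^+ 2.
Proof.
rewrite hs.unlock; apply: le_trans (ler_norm _) _; apply: le_trans (rtr_le_mnorm n0 _) _.
by apply: le_trans (mnormM _ _) _; rewrite mnorm_adj.
Qed.

Lemma hs_eq0 X : hs X = 0 -> X = 0.
Proof.
rewrite hs.unlock /rtr /ntr => h.
have e : \tr (X^t* *m X) = (\sum_j \sum_k cabs (X k j) ^+ 2)%:C.
  rewrite /mxtrace rmorph_sum; apply: eq_bigr => j _.
  rewrite mxE rmorph_sum; apply: eq_bigr => k _.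
  by rewrite adjE mulrC mul_conjcE.
move: h; rewrite e -(rmorph_nat (real_complex R)) -fmorphV -rmorphM /= => /eqP.
rewrite mulf_eq0 invr_eq0 pnatr_eq0 -[(n == 0)%N]negbK -lt0n n0 orbF => h.
have ge0 j : 0 <= \sum_k cabs (X k j) ^+ 2.
  by apply: sumr_ge0 => k _; exact: sqr_ge0.
apply/matrixP => k j; rewrite mxE; apply: cabs_eq0; apply/eqP.
rewrite -sqrf_eq0; move: h; rewrite psumr_eq0 // => /allP /(_ j).
rewrite mem_index_enum => /(_ isT) /=.
rewrite psumr_eq0; last by move=> l _; exact: sqr_ge0.
by move=> /allP /(_ k); rewrite mem_index_enum => /(_ isT).
Qed.

Lemma hsD X Y : hs (X + Y) = hs X + hs Y + 2 * complex.Re (hsip X Y).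
Proof.
rewrite hs.unlock adjD mulmxDl !mulmxDr !rtrD.
have -> : rtr (Y^t* *m X) = rtr (X^t* *m Y).
  by rewrite /rtr -(adjK (Y^t* *m X)) ntr_adj adjM adjK ReJ.
by rewrite -[complex.Re _]/(rtr _); move: (rtr _) (rtr _) (rtr _) => p q r; ring.
Qed.

Lemma hsN X : hs (- X) = hs X.
Proof. by rewrite hs.unlock adjN mulmxN mulNmx opprK. Qed.

End HilbertSchmidt.

Section SymmetricGap.
Context {R : realType}.
Variable n : nat.
Hypothesis n0 : (0 < n)%N.
Variables (F : 'M[R[i]]_n -> 'M[R[i]]_n) (f : 'M[R[i]]_n) (cF v1 v2 : R).
Hypothesis FD : forall X Y, F (X + Y) = F X + F Y.
Hypothesis FZ : forall a X, F (a *: X) = a *: F X.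
Hypothesis Fadj : forall X, F (X^t*) = (F X)^t*.
Hypothesis Fsym : forall X Y, \tr (F X *m Y) = \tr (X *m F Y).
Hypothesis Ff : F f = f.
Hypothesis cF0 : 0 < cF.
Hypothesis Flb : forall T, psdm T -> (cF * rtr T)%:C%:M <<= F T.
Hypothesis v10 : 0 < v1.
Hypothesis flb : v1%:C%:M <<= f.
Hypothesis fub : f <<= v2%:C%:M.
Implicit Types (X Y T Z : 'M[R[i]]_n).

Let psdf : psdm f.
Proof. by apply: loewner_psd flb; apply: psd_scalar; exact: ltW. Qed.

Let fadj : f^t* = f. Proof. exact: psd_herm. Qed.

Let v2_gt0 : 0 < v2.
Proof.
have := rtr_mono (loewner_trans flb fub); rewrite !rtr_scalar //.
exact: lt_le_trans.
Qed.

Let f_neq0 : f != 0.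
Proof.
apply: contraTneq (rtr_mono flb) => ->.
by rewrite rtr_scalar // /rtr /ntr mxtrace0 mul0r /= -ltNge.
Qed.

Let hf : 0 < hs f.
Proof.
rewrite lt_neqAle hs_ge0 andbT eq_sym; apply: contra_neq f_neq0.
exact: hs_eq0.
Qed.

(* The functional of the Hilbert-Schmidt projection onto [f], which [F]
   preserves because it is symmetric. *)
Let th X := ((hs f)^-1)%:C * ntr (f *m X).

Let thD X Y : th (X + Y) = th X + th Y.
Proof. by rewrite /th mulmxDr ntrD mulrDr. Qed.

Let thZ a X : th (a *: X) = a * th X.
Proof. by rewrite /th -scalemxAr ntrZ mulrCA. Qed.

Let th_adj X : th (X^t*) = (th X)^*.
Proof.
by rewrite /th conjCM conjC_rc -ntr_adj adjM fadj ntr_mulC.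
Qed.

Let thf : th f = 1.
Proof.
rewrite /th ntr_herm; last by rewrite adjM fadj.
have -> : rtr (f *m f) = hs f by rewrite hs.unlock fadj.
by rewrite -rmorphM mulVf ?gt_eqF.
Qed.

Let thF X : th (F X) = th X.
Proof. by rewrite /th /ntr -Fsym Ff. Qed.

Let e := cF * hs f / v2 ^+ 2.

Let doeblinF T : psdm T -> (e * complex.Re (th T))%:C *: f <<= F T.
Proof.
move=> pT; apply: loewner_trans _ (Flb pT).
have h1 : rtr (f *m T) <= v2 * rtr T.
  have := psd_ntr_mul fub pT; rewrite mulmxBl mul_scalar_mx ntrB ntrZ.
  by move=> /ge0_rc [_]; rewrite ReD ReN ReMr subr_ge0.
have hre : complex.Re (th T) = rtr (f *m T) / hs f.
  by rewrite /th ReMr mulrC.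
have h0 : 0 <= rtr (f *m T) by have [_] := ge0_rc (psd_ntr_mul psdf pT).
rewrite hre.
have -> : e * (rtr (f *m T) / hs f) = cF * rtr (f *m T) / v2 ^+ 2.
  by rewrite /e; field; rewrite !gt_eqF.
set s := cF * _ / _; have s0 : 0 <= s.
  by rewrite divr_ge0 ?sqr_ge0 // mulr_ge0 // ltW.
apply: (loewner_trans (B := (s * v2)%:C%:M)).
  by have := psdZ s0 fub; rewrite scalerBr scale_scalar_mx -rmorphM.
rewrite -raddfB -rmorphB; apply: psd_scalar; rewrite subr_ge0.
have -> : s * v2 = cF * (rtr (f *m T) / v2).
  by rewrite /s; field; rewrite gt_eqF.
by rewrite ler_pM2l // ler_pdivrMr // mulrC.
Qed.

Let e_gt0 : 0 < e.
Proof. by rewrite divr_gt0 ?mulr_gt0 // exprn_gt0. Qed.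

(* The second difference of [k |-> hs (F^k X)] is [hs (F (F X) - X)]. *)
Let hs_convex X : 2 * hs (F X) <= hs (F (F X)) + hs X.
Proof.
have := hs_ge0 (F (F X) - X); rewrite hsD hsN.
have -> : complex.Re (hsip (F (F X)) (- X)) = - hs (F X).
  rewrite /hsip mulmxN ntrN ReN hs.unlock /rtr; congr (- complex.Re _).
  by rewrite /ntr -Fadj Fsym.
by move: (hs _) (hs _) (hs _) => p q r; lra.
Qed.

Let hs_F_lt X : th X = 0 -> hs X <= hs (F X) -> X = 0.
Proof.
move=> X0 h; apply: (hs_eq0 n0).
have mono k : hs (iter k F X) <= hs (iter k.+1 F X).
  elim: k => [//|k IH]; rewrite [iter k.+2 _ _]/=.
  have := hs_convex (iter k F X); rewrite -[F (iter k F X)]/(iter k.+1 F X).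
  by move: IH; move: (hs _) (hs _) (hs _) => p q r; lra.
have lb k : hs X <= hs (iter k F X).
  by elim: k => [//|k IH]; apply: le_trans IH (mono k).
have c0 := iter_cvg0 n0 FD FZ Ff thD thZ th_adj thf v10 flb fub e_gt0
   doeblinF thF X0.
apply: (@cvg_le0_eq R nat \oo _ _ (fun k => mnorm (iter k F X) * mnorm (iter k F X))).
- exact: hs_ge0.
- by near=> k; apply: le_trans (lb k) _; rewrite -expr2 hs_le_mnorm.
- by rewrite -[X in _ --> X](mul0r (0 : R)); exact: cvgM.
Unshelve. all: by end_near. Qed.

(** A symmetric positive map with a positive fixed vector is a strict
    Hilbert-Schmidt contraction away from this vector: the sequence
    [hs (F^k X)] is convex, and it tends to zero when [X] is orthogonal to
    [f], so that it must decrease strictly. *)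
Lemma symmetric_gap X : hs X <= hs (F X) -> exists a, X = a *: f.
Proof.
move=> h; exists (th X); apply/eqP; rewrite -subr_eq0; apply/eqP.
set a := th X; set Z := X - a *: f.
have Z0 : th Z = 0 by rewrite thD -scaleNr thZ thf mulr1 subrr.
have eX : X = a *: f + Z by rewrite addrC subrK.
have orth Y : th Y = 0 -> hs (a *: f + Y) = hs (a *: f) + hs Y.
  move=> Y0; rewrite hsD /hsip adjZ -scalemxAl ntrZ fadj.
  have -> : ntr (f *m Y) = 0.
    move: Y0; rewrite /th => /eqP; rewrite mulf_eq0 => /orP[|/eqP//].
    by rewrite (inj_eq (@complexI R) _ 0) invr_eq0 gt_eqF.
  by rewrite mulr0 mulr0 addr0.
apply: (hs_F_lt Z0).
have : hs (a *: f + Z) <= hs (F (a *: f + Z)) by rewrite -eX.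
by rewrite FD FZ Ff (orth _ Z0) orth ?thF // lerD2l.
Qed.

End SymmetricGap.

(** * Balanced polar decomposition and stability in the bulk *)

Section GramBound.
Context {R : realType}.
Variable n : nat.
Implicit Types (X Y Z T V : 'M[R[i]]_n).

Lemma gram_lb Y Z (b : R) : Z *m Y = 1%:M -> 0 < b -> mnorm Z <= b ->
  (b ^- 2)%:C%:M <<= Y^t* *m Y.
Proof.
move=> ZY b0 Zb; apply: psdmI => [|x].
  by rewrite adjB adjM adjK adj_scalar conjC_rc.
rewrite qformD qformN qform_gram qform_scalar -rmorphM -rmorphB ler0c subr_ge0.
have : vnorm x <= b * vnorm (Y *m x).
  rewrite -{1}(mul1mx x) -ZY -mulmxA; apply: le_trans (vnorm_mulmx _ _) _.
  by rewrite ler_wpM2r ?vnorm_ge0.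
rewrite -ler_pdivrMl // => h.
rewrite -exprVn -exprMn ler_pXn2r ?nnegrE ?vnorm_ge0 //.
by rewrite mulr_ge0 ?vnorm_ge0 // invr_ge0 ltW.
Qed.

Lemma unit_gram_lb Y : Y \in unitmx -> exists2 a : R, 0 < a &
  a%:C%:M <<= Y^t* *m Y.
Proof.
move=> uY; pose b := mnorm (invmx Y) + 1.
have b0 : 0 < b by rewrite ltr_wpDl ?mnorm_ge0.
exists (b ^- 2); first by rewrite invr_gt0 exprn_gt0.
by apply: (gram_lb (mulVmx uY)) => //; rewrite lerDl.
Qed.

Lemma psd_unit_lb T : psdm T -> T \in unitmx -> exists2 a : R, 0 < a &
  a%:C%:M <<= T.
Proof.
move=> /psd_sqrt[Y ->]; rewrite unitmx_mul => /andP[_ uY].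
exact: unit_gram_lb.
Qed.

Lemma psd_ub T : psdm T -> T <<= (mnorm T)%:C%:M.
Proof. by move=> pT; apply: herm_le_mnorm; rewrite ?psd_herm. Qed.

Lemma unitmx_adj Y : (Y^t* \in unitmx) = (Y \in unitmx).
Proof. by rewrite map_unitmx unitmx_tr. Qed.

End GramBound.

Section Polar.
Context {R : realType}.
Variable n : nat.
Implicit Types (X Y Z T V H M D U f : 'M[R[i]]_n) (v w : 'I_n -> R[i]).

Let dg v : 'M[R[i]]_n := diag_mx (\row_i v i).

Let dgM v w : dg v *m dg w = dg (fun i => v i * w i).
Proof.
by rewrite /dg mulmx_diag; congr diag_mx; apply/rowP => i; rewrite !mxE.
Qed.

Let dg_adj v : (dg v)^t* = dg (fun i => (v i)^*).
Proof.
rewrite /dg tr_diag_mx map_diag_mx; congr diag_mx.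
by apply/rowP => i; rewrite !mxE.
Qed.

Let dg1 : dg (fun=> 1) = 1%:M.
Proof.
by apply/matrixP => i j; rewrite !mxE.
Qed.

Let eq_dg v w : v =1 w -> dg v = dg w.
Proof. by move=> e; congr (dg _); apply/funext. Qed.

(** [D] carries the size, the unitary [U] the phase of [M]; conjugating the map
    [M S(.) M] by [D] turns it into a symmetric positive map preceded and
    followed by [U]. *)
Definition balanced_polar M V D U f : Prop :=
  [/\ D \in unitmx, U *m U^t* = 1%:M, U^t* *m U = 1%:M, U *m f = f *m U &
  [/\ f^t* = f, V = D *m f *m D^t* & M = D *m U *m D^t*]].

(** Simultaneous diagonalisation by congruence of [V > 0] and of the
    self-adjoint [H], after which the polar decomposition of the diagonal
    matrix of [H + i y V] is split evenly between the two sides. *)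
Lemma balanced_polar_exists V H (y : R) M : posdef V -> H^t* = H ->
  M = H + (0 +i* y) *: V -> M \in unitmx ->
  exists D U f, balanced_polar M V D U f.
Proof.
move=> pV hH eM uM.
have [Y eV] := psd_sqrt (posdef_psd pV).
have uY : Y \in unitmx.
  by move: (posdef_unit pV); rewrite eV unitmx_mul => /andP[].
pose Yi := invmx Y.
have YiY : Yi *m Y = 1%:M by rewrite mulVmx.
have YYi : Y *m Yi = 1%:M by rewrite mulmxV.
have hH' : (Yi^t* *m H *m Yi)^t* = Yi^t* *m H *m Yi.
  by rewrite !adjM adjK hH mulmxA.
have [U1 [h [UU' U'U eH]]] := herm_spectral hH'.
pose D0 := (U1 *m Y)^t*.
have eV0 : V = D0 *m D0^t*.
  by rewrite /D0 adjK adjM !mulmxA -(mulmxA _ _ U1) U'U mulmx1.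
have eH0 : H = D0 *m dg (fun i => (h i)%:C) *m D0^t*.
  have -> : D0 *m dg (fun i => (h i)%:C) *m D0^t* =
    Y^t* *m (U1^t* *m dg (fun i => (h i)%:C) *m U1) *m Y.
    by rewrite /D0 adjK adjM !mulmxA.
  rewrite -eH !mulmxA -adjM YiY adj1 mul1mx -mulmxA YiY mulmx1 //.
pose m i := h i +i* y.
have eM0 : M = D0 *m dg m *m D0^t*.
  rewrite eM {1}eH0 eV0 -[X in _ *: (X *m _)]mulmx1 -dg1 scalemxAl scalemxAr.
  rewrite -mulmxDl -mulmxDr; apply: (congr1 (fun e => D0 *m e *m D0^t*)).
  apply/matrixP => i j.
  rewrite !mxE; case: (i == j); rewrite ?mulr1n ?mulr0n ?mulr0 ?addr0 // mulr1.
  by apply: eqC => /=; ring.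
have [uD0 udg] : D0 \in unitmx /\ dg m \in unitmx.
  by move: uM; rewrite eM0 !unitmx_mul => /andP[/andP[-> ->]].
have m0 i : m i != 0.
  have := udg; rewrite unitmxE det_diag unitfE => /prodf_neq0 /(_ i isT).
  by rewrite mxE.
have cm0 i : 0 < cabs (m i).
  rewrite lt_neqAle cabs_ge0 andbT eq_sym.
  by apply: contra_neq (m0 i) => /cabs_eq0.
have cn0 i : (cabs (m i))%:C != 0 :> R[i].
  by rewrite (inj_eq (@complexI R) _ 0) gt_eqF.
pose r i : R[i] := (Num.sqrt (cabs (m i)))%:C.
pose u i : R[i] := m i / (cabs (m i))%:C.
have rr i : r i * r i = (cabs (m i))%:C.
  by rewrite -rmorphM -expr2 sqr_sqrtr // ltW.
have rJ i : (r i)^* = r i by exact: conjC_rc.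
have uuJ i : u i * (u i)^* = 1.
  by rewrite mul_conjcE cabsM cabsV cabs_real ger0_norm ?cabs_ge0 // divff ?gt_eqF // expr1n.
exists (D0 *m dg r), (dg u), (dg (fun i => ((cabs (m i))^-1)%:C)); split.
- rewrite unitmx_mul uD0 unitmxE det_diag unitfE; apply/prodf_neq0 => i _.
  by rewrite mxE (inj_eq (@complexI R) _ 0) gt_eqF // sqrtr_gt0.
- by rewrite dg_adj dgM -dg1; apply: eq_dg.
- by rewrite dg_adj dgM -dg1; apply: eq_dg => i; rewrite mulrC.
- by rewrite !dgM; apply: eq_dg => i; rewrite mulrC.
split.
- by rewrite dg_adj; apply: eq_dg => i; rewrite conjC_rc.
- rewrite adjM dg_adj eV0 !mulmxA -(mulmxA _ (dg r)) dgM -(mulmxA _ (dg _) (dg _)) dgM.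
  congr (_ *m _); rewrite -[LHS]mulmx1; congr (_ *m _); rewrite -dg1.
  apply: eq_dg => i; rewrite rJ mulrAC rr -rmorphM divff ?gt_eqF //.
- rewrite adjM dg_adj eM0 !mulmxA -(mulmxA _ (dg r)) dgM -(mulmxA _ (dg _) (dg _)) dgM.
  apply: (congr1 (fun e => D0 *m e *m D0^t*)); apply: eq_dg => i.
  by rewrite rJ mulrAC rr mulrC divfK.
Qed.

End Polar.


Section PolarGap.
Context {R : realType}.
Variables (n : nat) (S : 'M[R[i]]_n -> 'M[R[i]]_n) (c C : R).
Hypothesis n0 : (0 < n)%N.
Hypothesis hS : energy_map S c C.
Variables (M V D U f : 'M[R[i]]_n).
Hypothesis hpol : balanced_polar M V D U f.
Hypothesis pV : posdef V.
Implicit Types (X Y T : 'M[R[i]]_n).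

(* The linearised operator in balanced coordinates, up to the factors [U]. *)
Let F X := D^t* *m S (D *m X *m D^t*) *m D.

Let uD : D \in unitmx. Proof. by case: hpol. Qed.
Let UU' : U *m U^t* = 1%:M. Proof. by case: hpol. Qed.
Let U'U : U^t* *m U = 1%:M. Proof. by case: hpol. Qed.
Let Uf : U *m f = f *m U. Proof. by case: hpol. Qed.
Let fadj : f^t* = f. Proof. by case: hpol => _ _ _ _ []. Qed.
Let eV : V = D *m f *m D^t*. Proof. by case: hpol => _ _ _ _ []. Qed.
Let eM : M = D *m U *m D^t*. Proof. by case: hpol => _ _ _ _ []. Qed.

Let Di := invmx D.
Let DiD : Di *m D = 1%:M. Proof. by rewrite mulVmx. Qed.
Let DDi : D *m Di = 1%:M. Proof. by rewrite mulmxV. Qed.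
Let DaDia : D^t* *m Di^t* = 1%:M. Proof. by rewrite -adjM DiD adj1. Qed.
Let DiaDa : Di^t* *m D^t* = 1%:M. Proof. by rewrite -adjM DDi adj1. Qed.

Let cancelD X Y : D *m X *m D^t* = D *m Y *m D^t* -> X = Y.
Proof.
move=> /(congr1 (fun Z => Di *m Z *m Di^t*)).
by rewrite !mulmxA DiD !mul1mx -!mulmxA DaDia !mulmx1.
Qed.

Let conjD X : D *m (Di *m X *m Di^t*) *m D^t* = X.
Proof. by rewrite !mulmxA DDi mul1mx -mulmxA DiaDa mulmx1. Qed.

Let FD X Y : F (X + Y) = F X + F Y.
Proof. by rewrite /F mulmxDr mulmxDl (emD hS) mulmxDr mulmxDl. Qed.

Let FZ a X : F (a *: X) = a *: F X.
Proof. by rewrite /F -scalemxAr -scalemxAl (emZ hS) -scalemxAr -scalemxAl. Qed.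

Let Fadj X : F (X^t*) = (F X)^t*.
Proof. by rewrite /F !adjM adjK -(em_adj hS) !adjM adjK !mulmxA. Qed.

Let Fsym X Y : \tr (F X *m Y) = \tr (X *m F Y).
Proof.
rewrite /F; set A := S _; set B := S _.
transitivity (\tr (A *m (D *m Y *m D^t*))).
  by rewrite -!mulmxA mxtrace_mulC !mulmxA.
by rewrite (em_sym hS) -/B -!mulmxA mxtrace_mulC !mulmxA.
Qed.

Let psdf : psdm f.
Proof.
have -> : f = Di *m V *m Di^t*.
  by apply: cancelD; rewrite conjD -eV.
exact: psd_congrV (posdef_psd pV).
Qed.

Let uf : f \in unitmx.
Proof.
by move: (posdef_unit pV); rewrite eV !unitmx_mul => /andP[/andP[]].
Qed.

Let zero_nonunit : (0 : 'M[R[i]]_n) \in unitmx -> False.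
Proof.
move=> /mulmxV; rewrite mul0mx => /(congr1 (@rtr R n)).
rewrite (rtr_scalar n0 1) /rtr /ntr mxtrace0 mul0r => /eqP.
by rewrite eq_sym oner_eq0.
Qed.

Let F_lb : exists2 cF : R, 0 < cF &
  forall T, psdm T -> (cF * rtr T)%:C%:M <<= F T.
Proof.
have [d d0 hd] := unit_gram_lb uD.
exists (c * d * d) => [|T pT]; first by rewrite !mulr_gt0 // (em_gt0 hS).
have pD := psd_congrV D pT.
apply: (loewner_trans (B := D^t* *m (c * rtr (D *m T *m D^t*))%:C%:M *m D)).
  rewrite mul_mx_scalar -scalemxAl.
  have r0 : 0 <= c * rtr (D *m T *m D^t*).
    by rewrite mulr_ge0 ?psd_rtr // ltW // (em_gt0 hS).
  apply: (loewner_trans (B := (c * rtr (D *m T *m D^t*) * d)%:C%:M)); last first.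
    by have := psdZ r0 hd; rewrite scalerBr scale_scalar_mx -rmorphM.
  rewrite -raddfB -rmorphB; apply: psd_scalar; rewrite subr_ge0.
  have h : d * rtr T <= rtr (D *m T *m D^t*).
    have := psd_ntr_mul hd pT; rewrite mulmxBl mul_scalar_mx ntrB ntrZ.
    move=> /ge0_rc [_]; rewrite ReD ReN ReMr subr_ge0 => h.
    apply: le_trans h _; rewrite /rtr -(mulmxA (D^t*)) ntr_mulC; exact: lexx.
  have := ler_wpM2l (ltW (mulr_gt0 (em_gt0 hS) d0)) h.
  by rewrite -!mulrA [rtr _ * d]mulrC.
have := psd_congr D (em_lb hS pD); rewrite mulmxBr mulmxBl.
exact.
Qed.

Let gap X : F f = f -> hs X <= hs (F X) -> exists a, X = a *: f.
Proof.
move=> Ff; have [cF cF0 Flb] := F_lb.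
have [v1 v10 flb] := psd_unit_lb psdf uf.
exact: (symmetric_gap n0 FD FZ Fadj Fsym Ff cF0 Flb v10 flb (psd_ub psdf)).
Qed.

Let hs_conjU X : hs (U *m X *m U) = hs X.
Proof.
rewrite hs.unlock !adjM !mulmxA -[_ *m U^t* *m U]mulmxA U'U mulmx1.
by rewrite /rtr ntr_mulC !mulmxA UU' mul1mx.
Qed.

(** In the bulk the linearised equation is injective: in balanced
    coordinates [X = M S(X) M] reads [Y = U F(Y) U], so that [F] preserves the
    Hilbert-Schmidt norm of [Y] and [Y] is a multiple of [f]; then
    [U ^ 2 = 1] unless [Y = 0]. *)
Lemma bulk_injective X : V = M *m S V *m M^t* -> V = ImM M ->
  X = M *m S X *m M -> X = 0.
Proof.
move=> fixV imV eX.
have Ff : F f = f.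
  have e : f = U *m F f *m U^t*.
    by apply: cancelD; rewrite -eV [LHS]fixV eM !adjM adjK /F -eV !mulmxA.
  have <- : U^t* *m f *m U = F f.
    by rewrite {1}e !mulmxA U'U mul1mx -mulmxA U'U mulmx1.
  by rewrite -mulmxA -Uf mulmxA U'U mul1mx.
pose Y := Di *m X *m Di^t*.
have XY : X = D *m Y *m D^t* by rewrite conjD.
have eY : Y = U *m F Y *m U.
  by apply: cancelD; rewrite -XY [LHS]eX eM /F -XY !mulmxA.
have [y ey] : exists y, Y = y *: f.
  by apply: gap Ff _; rewrite {1}eY hs_conjU.
have [y0|y0] := eqVneq y 0.
  by rewrite XY ey y0 scale0r mulmx0 mul0mx.
have U2 : U *m U = 1%:M.
  move: eY; rewrite ey FZ Ff -scalemxAr -scalemxAl => /(scalerI y0).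
  rewrite -mulmxA -Uf mulmxA => ff.
  by rewrite -[LHS]mulmx1 -(mulmxV uf) mulmxA -ff.
have hU : U^t* = U by rewrite -[LHS]mulmx1 -U2 mulmxA U'U mul1mx.
have hM : M^t* = M by rewrite eM !adjM adjK hU mulmxA.
have : V = 0 by rewrite imV ImME hM subrr scaler0.
by move=> V0; case: zero_nonunit; rewrite -V0; exact: posdef_unit.
Qed.

(** In balanced coordinates [Y - U F(Y) U = q] with [q = U f f], and the two
    summands are the pairings of [q] with [Y] and with [F Y]. If they add up to
    zero then [hs (F Y) = hs Y], so that [Y] is a multiple of [f], which forces
    [q = 0]. *)
Lemma cubic_coefficient_neq0 E : M^t* = M -> V = M *m S V *m M ->
  E - M *m S E *m M = M *m S V *m V ->
  ntr (S V *m M *m S V *m E) + ntr (S V *m M *m S E *m V) != 0.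
Proof.
move=> hM fixV eE; apply/eqP => ab0.
have hU : U^t* = U.
  apply: cancelD; rewrite -eM -[RHS]hM [in RHS]eM !adjM adjK.
  by rewrite mulmxA.
have U2 : U *m U = 1%:M by rewrite -{2}hU.
have UUX X : U *m (U *m X *m U) *m U = X.
  by rewrite !mulmxA U2 mul1mx -mulmxA U2 mulmx1.
pose G := S V.
have fG : D^t* *m G *m D = f.
  have e : f = U *m (D^t* *m G *m D) *m U.
    by apply: cancelD; rewrite -eV [LHS]fixV eM -/G !mulmxA.
  have : U *m f *m U = D^t* *m G *m D.
    by rewrite {1}e !mulmxA U2 mul1mx -mulmxA U2 mulmx1.
  by move=> <-; rewrite Uf -mulmxA U2 mulmx1.
have Ff : F f = f by rewrite /F -eV.
pose Y := Di *m E *m Di^t*.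
have EY : E = D *m Y *m D^t* by rewrite conjD.
have FYE : F Y = D^t* *m S E *m D by rewrite /F -EY.
pose q := U *m f *m f.
have qadj : q^t* = q by rewrite /q !adjM hU fadj -Uf mulmxA -Uf.
have Uq : U *m q = q *m U.
  by rewrite /q -[RHS]mulmxA -Uf [RHS]mulmxA -(mulmxA U f U) -Uf !mulmxA.
have eq1 : Y - U *m F Y *m U = q.
  apply: cancelD; rewrite mulmxBr mulmxBl -EY FYE.
  have -> : D *m (U *m (D^t* *m S E *m D) *m U) *m D^t* = M *m S E *m M.
    by rewrite eM !mulmxA.
  rewrite eE -/G.
  transitivity (D *m U *m (D^t* *m G *m D) *m f *m D^t*).
    by rewrite [X in X *m _ *m _]eM [X in _ *m X = _]eV !mulmxA.
  by rewrite fG /q !mulmxA.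
have ea : ntr (S V *m M *m S V *m E) = ntr (q *m Y).
  rewrite -/G [X in _ *m X]EY [X in _ *m X *m G]eM.
  have -> : G *m (D *m U *m D^t*) *m G *m (D *m Y *m D^t*) =
     G *m D *m U *m (D^t* *m G *m D) *m Y *m D^t* by rewrite !mulmxA.
  by rewrite fG ntr_mulC !mulmxA fG -Uf.
have eb : ntr (S V *m M *m S E *m V) = ntr (q *m F Y).
  rewrite -/G FYE [X in _ *m X]eV [X in _ *m X *m S E]eM.
  have -> : G *m (D *m U *m D^t*) *m S E *m (D *m f *m D^t*) =
     G *m D *m U *m (D^t* *m S E *m D) *m f *m D^t* by rewrite !mulmxA.
  rewrite -FYE ntr_mulC !mulmxA fG ntr_mulC !mulmxA.
  by rewrite -[f *m f *m U]mulmxA -Uf mulmxA -Uf.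
have uq : q \in unitmx by rewrite /q !unitmx_mul uf (mulmx1_unit U2).1.
clearbody q.
have eFY : F Y = U *m Y *m U - q.
  have : U *m Y *m U - F Y = q.
    have <- : U *m q *m U = q by rewrite Uq -mulmxA U2 mulmx1.
    rewrite -eq1 mulmxBr mulmxBl; congr (_ - _).
    by rewrite UUX.
  by move=> <-; rewrite subKr.
have ntrU Q X : U *m Q = Q *m U -> ntr (Q *m (U *m X *m U)) = ntr (Q *m X).
  by move=> UQ; rewrite !mulmxA ntr_mulC !mulmxA UQ -[Q *m U *m U]mulmxA U2 mulmx1.
have ntrqU : ntr (q *m (U *m Y *m U)) = ntr (q *m Y) by exact: ntrU.
have key : 2 * ntr (q *m Y) = (hs q)%:C.
  have hsq : (hs q)%:C = ntr (q *m q).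
    by rewrite hs.unlock qadj -ntr_herm // adjM qadj.
  move: ab0; rewrite ea eb eFY mulmxBr ntrB ntrqU hsq => /eqP.
  rewrite addrA subr_eq0 => /eqP <-.
  by rewrite mulr_natl mulr2n.
have hsFY : hs (F Y) = hs Y.
  rewrite eFY hsD hsN hs_conjU /hsip mulmxN ntrN ReN.
  have -> : ntr ((U *m Y *m U)^t* *m q) = (ntr (q *m Y))^*.
    by rewrite -ntrqU -ntr_adj [in RHS]adjM qadj.
  rewrite ReJ; move: key => /(congr1 (@complex.Re R)).
  rewrite -(rmorph_nat (real_complex R)) ReMr /=.
  by move: (hs Y) (hs q) (complex.Re _) => p r s <-; ring.
have [y ey] : exists y, Y = y *: f by apply: gap Ff _; rewrite hsFY.
have q0 : q = 0.
  rewrite -eq1 ey FZ Ff -scalemxAr -scalemxAl Uf -mulmxA U2 mulmx1.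
  exact: subrr.
by apply: zero_nonunit; rewrite -q0.
Qed.

End PolarGap.

(** * Expansion around a self-adjoint solution *)

Section EdgeFrame.
Context {R : realType}.
Variables (n : nat) (S : 'M[R[i]]_n -> 'M[R[i]]_n).
Implicit Types (X Y T : 'M[R[i]]_n).

(** The coordinate along [V] of the projection whose kernel is the orthogonal
    complement of the left eigenvector [S V]. *)
Definition vcoord V X : R[i] := ((rtr (S V *m V))^-1)%:C * ntr (S V *m X).

Definition vrest V X := X - vcoord V X *: V.

(** The linearisation [X - M0 S(X) M0] of the Dyson equation at a self-adjoint
    solution [M0] annihilates [V]; the constant [b] bounds all the data of this
    linearisation, and its inverse on the kernel of the coordinate along
    [V]. *)
Record edge_frame (M0 V : 'M[R[i]]_n) (b : R) : Prop := EdgeFrame {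
  ef_b1 : 1 <= b;
  ef_M0adj : M0^t* = M0;
  ef_fix : V = M0 *m S V *m M0;
  ef_psd : psdm V;
  ef_ntr : ntr V = 1;
  ef_M0 : mnorm M0 <= b;
  ef_S : forall X, mnorm (S X) <= b * mnorm X;
  ef_V : mnorm V <= b;
  ef_L : mnorm (S V) <= b;
  ef_l : b^-1 <= rtr (S V *m V);
  ef_coord_psd : forall T, psdm T -> rtr T = 1 -> b^-1 <= complex.Re (vcoord V T);
  ef_stab : forall X, vcoord V X = 0 -> mnorm X <= b * mnorm (X - M0 *m S X *m M0)
}.

(** The stability constant [4 v2 / (v1 e)] of the Doeblin estimate, with
    [v1 = c / k ^ 2], [v2 = C k ^ 2] and [e = c ^ 2 / v2 ^ 2]. *)
Definition edge_gap (c C k : R) : R :=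
  4 * (k ^+ 2 * C) / ((k ^- 2 * c) * (c ^+ 2 / (k ^+ 2 * C * (k ^+ 2 * C)))).

Definition edge_const (c C k : R) : R :=
  1 + k + 4 * C + k ^+ 2 * C + C + c^-1 + C / c + edge_gap c C k.

(** Flatness gives the Doeblin condition for [T |-> M0 S(T) M0] as soon as [M0]
    and its inverse are bounded. *)
Lemma edge_frame_of (c C k : R) (M0 V Mi : 'M[R[i]]_n) : (0 < n)%N ->
  energy_map S c C -> 0 < k -> M0^t* = M0 -> V = M0 *m S V *m M0 -> psdm V ->
  ntr V = 1 -> mnorm M0 <= k -> Mi *m M0 = 1%:M -> mnorm Mi <= k ->
  edge_frame M0 V (edge_const c C k) /\ posdef V.
Proof.
move=> n0 hS k0 hM fixV pV nV Mk MiM Mik.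
have c0 := em_gt0 hS; have C0 := em_Cgt0 hS.
set b := edge_const c C k; pose v2 := k ^+ 2 * C; pose v1 := k ^- 2 * c.
pose e := c ^+ 2 / (v2 * v2).
have k20 : 0 < k ^+ 2 by rewrite exprn_gt0.
have v20 : 0 < v2 by rewrite mulr_gt0.
have v10 : 0 < v1 by rewrite mulr_gt0 // invr_gt0.
have e0 : 0 < e by rewrite divr_gt0 ?exprn_gt0 // mulr_gt0.
have gap0 : 0 <= edge_gap c C k.
  by rewrite /edge_gap -/v1 -/v2 -/e divr_ge0 // mulr_ge0 // ltW.
have c'0 : 0 < c^-1 by rewrite invr_gt0.
have Cc0 : 0 < C / c by rewrite divr_gt0.
have [b1 [bk [bS [bV [bC [bc [bCc bg]]]]]]] : 1 <= b /\ k <= b /\ 4 * C <= b /\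
    v2 <= b /\ C <= b /\ c^-1 <= b /\ C / c <= b /\ edge_gap c C k <= b.
  rewrite /b /edge_const -/v2.
  by move: (edge_gap c C k) gap0 (c^-1) (C / c) c'0 Cc0 => g *; do !split; lra.
have b0 : 0 < b by apply: lt_le_trans b1.
have rV : rtr V = 1 by rewrite /rtr nV.
have M2lb : (k ^- 2)%:C%:M <<= M0 *m M0.
  by have := gram_lb MiM k0 Mik; rewrite hM.
have Klb T : psdm T -> (k ^- 2 * (c * rtr T))%:C%:M <<= M0 *m S T *m M0.
  move=> pT; have r0 : 0 <= c * rtr T by rewrite mulr_ge0 ?psd_rtr // ltW.
  apply: (loewner_trans (B := M0^t* *m (c * rtr T)%:C%:M *m M0)).
    rewrite hM mul_mx_scalar -scalemxAl.
    by have := psdZ r0 M2lb; rewrite scalerBr scale_scalar_mx -rmorphM [_ * k ^- 2]mulrC.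
  rewrite -[X in X *m S T]hM.
  by have := psd_congr M0 (em_lb hS pT); rewrite mulmxBr mulmxBl.
have Vlb : v1%:C%:M <<= V.
  by have := Klb _ pV; rewrite -fixV rV mulr1.
have LC : mnorm (S V) <= C.
  by apply: le_trans (em_psd_norm hS pV) _; rewrite rV mulr1.
have Vn : mnorm V <= v2.
  rewrite [X in mnorm X]fixV; apply: le_trans (mnormM _ _) _.
  rewrite /v2 expr2 -mulrA [k * C]mulrC mulrA.
  apply: ler_pM; rewrite ?mnorm_ge0 //; apply: le_trans (mnormM _ _) _.
  by apply: ler_pM; rewrite ?mnorm_ge0.
have Vub : V <<= v2%:C%:M by apply: herm_le_mnorm; rewrite ?psd_herm.
have Llb : c%:C%:M <<= S V by have := em_lb hS pV; rewrite rV mulr1.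
have Lub : S V <<= C%:C%:M by have := em_ub hS pV; rewrite rV mulr1.
have pL : psdm (S V) by exact: (em_psd hS pV).
have tr_lb T : psdm T -> c * rtr T <= rtr (S V *m T).
  move=> pT; have := psd_ntr_mul Llb pT; rewrite mulmxBl mul_scalar_mx ntrB ntrZ.
  by move=> /ge0_rc [_]; rewrite ReD ReN ReMr subr_ge0.
have tr_ub T : psdm T -> rtr (S V *m T) <= C * rtr T.
  move=> pT; have := psd_ntr_mul Lub pT; rewrite mulmxBl mul_scalar_mx ntrB ntrZ.
  by move=> /ge0_rc [_]; rewrite ReD ReN ReMr subr_ge0.
set l := rtr (S V *m V).
have lc : c <= l by have := tr_lb _ pV; rewrite rV mulr1.
have lC : l <= C by have := tr_ub _ pV; rewrite rV mulr1.
have l0 : 0 < l by apply: lt_le_trans lc.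
have thE T : complex.Re (vcoord V T) = l^-1 * rtr (S V *m T).
  by rewrite /vcoord ReMr.
split; last exact: posdef_of_ge v10 Vlb.
split=> //.
- exact: le_trans Mk bk.
- move=> X; apply: le_trans (em_norm hS n0 X) _.
  by rewrite ler_wpM2r ?mnorm_ge0.
- exact: le_trans Vn bV.
- exact: le_trans LC bC.
- apply: le_trans lc; rewrite -[leRHS]invrK lef_pV2 ?posrE //.
- move=> T pT rT; rewrite thE.
  apply: (@le_trans _ _ (C^-1 * c)).
    rewrite -[leRHS]invrK lef_pV2 ?posrE // ?invr_gt0 ?mulr_gt0 ?invr_gt0 //.
    by rewrite invfM invrK.
  apply: ler_pM; [by rewrite invr_ge0 ltW | exact: ltW | by rewrite lef_pV2 ?posrE |].
  by have := tr_lb _ pT; rewrite rT mulr1.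
- move=> X X0; apply: le_trans (_ : edge_gap c C k * mnorm (X - M0 *m S X *m M0) <= _); last first.
    by rewrite ler_wpM2r ?mnorm_ge0.
  have doeb T : psdm T ->
      (e * complex.Re (vcoord V T))%:C *: V <<= M0 *m S T *m M0.
    move=> pT; apply: loewner_trans _ (Klb _ pT).
    have r0 : 0 <= rtr (S V *m T).
      by have [_] := ge0_rc (psd_ntr_mul pL pT).
    have s0 : 0 <= e * complex.Re (vcoord V T).
      by rewrite thE (mulr_ge0 (ltW e0)) // mulr_ge0 // invr_ge0 ltW.
    apply: (loewner_trans (B := (e * complex.Re (vcoord V T) * v2)%:C%:M)).
      by have := psdZ s0 Vub; rewrite scalerBr scale_scalar_mx -rmorphM.
    rewrite -raddfB -rmorphB; apply: psd_scalar; rewrite subr_ge0 thE.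
    have h1 : l^-1 * rtr (S V *m T) <= c^-1 * (C * rtr T).
      apply: ler_pM; [by rewrite invr_ge0 ltW | exact: r0 | by rewrite lef_pV2 ?posrE |].
      exact: tr_ub.
    have ev0 : 0 <= e * v2 by rewrite ltW // mulr_gt0.
    have := ler_wpM2l ev0 h1.
    have -> : e * v2 * (c^-1 * (C * rtr T)) = k ^- 2 * (c * rtr T).
      rewrite /e /v2; field.
      by rewrite (gt_eqF C0) (gt_eqF c0) (gt_eqF k0).
    by rewrite mulrAC.
  have thD Y Z : vcoord V (Y + Z) = vcoord V Y + vcoord V Z.
    by rewrite /vcoord mulmxDr ntrD mulrDr.
  have thZ a Y : vcoord V (a *: Y) = a * vcoord V Y.
    by rewrite /vcoord -scalemxAr ntrZ mulrCA.
  have th_adj Y : vcoord V (Y^t*) = (vcoord V Y)^*.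
    rewrite /vcoord conjCM conjC_rc -ntr_adj adjM (psd_herm pL).
    by rewrite ntr_mulC.
  have thV : vcoord V V = 1.
    have -> : vcoord V V = (complex.Re (vcoord V V))%:C.
      by apply: real_of_conj; rewrite -th_adj (psd_herm pV).
    by rewrite thE mulVf ?gt_eqF.
  apply: (doeblin_stability n0 (K := fun X => M0 *m S X *m M0) _ _ _ (esym fixV)
    thD thZ th_adj thV v10 Vlb Vub e0 doeb X0).
  + by move=> Y Z; rewrite (emD hS) mulmxDr mulmxDl.
  + by move=> a Y; rewrite (emZ hS) -scalemxAr -scalemxAl.
  + by move=> Y; rewrite (em_adj hS) !adjM hM mulmxA.
Qed.

End EdgeFrame.

HB.lock Definition edge_c0 (R : realType) (b : R) : R := 11 * b ^+ 6.

Section LocalExpansion.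
Context {R : realType}.
Variables (n : nat) (S : 'M[R[i]]_n -> 'M[R[i]]_n) (c C b : R).
Hypothesis n0 : (0 < n)%N.
Hypothesis hS : energy_map S c C.
Variables (M0 V : 'M[R[i]]_n).
Hypothesis hF : edge_frame S M0 V b.
Implicit Types (X Y T D P Q : 'M[R[i]]_n) (zeta : R[i]) (r : R).

Local Notation th := (vcoord S V).
Local Notation rest := (vrest S V).
Local Notation L := (S V).
Local Notation K X := (M0 *m S X *m M0).

Let b1 := ef_b1 hF.
Let hM := ef_M0adj hF.
Let fixV := ef_fix hF.
Let pV := ef_psd hF.

Lemma edge_b_gt0 : 0 < b. Proof. exact: lt_le_trans b1. Qed.
Let b0 := edge_b_gt0.

Lemma edge_psdL : psdm L. Proof. exact: (em_psd hS pV). Qed.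

Let l0 : 0 < rtr (L *m V).
Proof. by apply: lt_le_trans (ef_l hF); rewrite invr_gt0. Qed.

Lemma vcoordD X Y : th (X + Y) = th X + th Y.
Proof. by rewrite /vcoord mulmxDr ntrD mulrDr. Qed.
Lemma vcoordZ a X : th (a *: X) = a * th X.
Proof. by rewrite /vcoord -scalemxAr ntrZ mulrCA. Qed.
Lemma vcoordN X : th (- X) = - th X.
Proof. by rewrite -scaleN1r vcoordZ mulN1r. Qed.

Lemma vcoord_adj X : th (X^t*) = (th X)^*.
Proof.
rewrite /vcoord conjCM conjC_rc -ntr_adj adjM (psd_herm edge_psdL).
by rewrite ntr_mulC.
Qed.

Lemma vcoordV : th V = 1.
Proof.
have -> : th V = (complex.Re (th V))%:C.
  by apply: real_of_conj; rewrite -vcoord_adj (psd_herm pV).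
by rewrite /vcoord ReMr mulVf ?gt_eqF.
Qed.

Lemma vcoord_le X : cabs (th X) <= b ^+ 2 * mnorm X.
Proof.
rewrite /vcoord cabsM cabs_real ger0_norm ?invr_ge0 ?(ltW l0) // expr2 -mulrA.
apply: ler_pM; rewrite ?invr_ge0 ?(ltW l0) ?cabs_ge0 //.
  rewrite -[leRHS]invrK lef_pV2 ?posrE ?invr_gt0 //; exact: ef_l hF.
apply: le_trans (cabs_ntr n0 _) _; apply: le_trans (mnormM _ _) _.
by rewrite ler_wpM2r ?mnorm_ge0 // (ef_L hF).
Qed.

Lemma vrest_decomp X : X = th X *: V + rest X.
Proof. by rewrite addrC subrK. Qed.

Lemma vcoord_rest X : th (rest X) = 0.
Proof. by rewrite vcoordD vcoordN vcoordZ vcoordV mulr1 subrr. Qed.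

Lemma vrest_adj X : (rest X)^t* = rest (X^t*).
Proof. by rewrite /vrest adjB adjZ vcoord_adj (psd_herm pV). Qed.

(** [L] is a left eigenvector: pairing with it removes the linear part of the
    two-point identity. *)
Lemma ntr_LK X : ntr (L *m K X) = ntr (L *m X).
Proof.
rewrite !mulmxA ntr_mulC !mulmxA -fixV /ntr; congr (_ / _).
exact: esym (em_sym hS V X).
Qed.

Let SD := emD hS. Let SZ := emZ hS.
Let SN X : S (- X) = - S X. Proof. exact: (emN hS). Qed.

Lemma rest_lin X : rest X - K (rest X) = X - K X.
Proof.
have -> : K (rest X) = K X - th X *: V.
  rewrite /vrest SD SN SZ mulmxDr mulmxDl mulmxN mulNmx.
  by rewrite -scalemxAr -scalemxAl -fixV.
by rewrite /vrest; mxlin.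
Qed.

Lemma mnorm_rest X : mnorm (rest X) <= b * mnorm (X - K X).
Proof. by rewrite -rest_lin; apply: (ef_stab hF); exact: vcoord_rest. Qed.

(** The quadratic part of the two-point identity for the solutions [M0 + P]
    and [M0 + Q]. *)
Definition quad P D Q := P *m S D *m M0 + M0 *m S D *m Q + P *m S D *m Q.

Lemma lin_identity zeta P D Q :
  D = (M0 + P) *m (zeta%:M + S D) *m (M0 + Q) ->
  D - K D = zeta *: ((M0 + P) *m (M0 + Q)) + quad P D Q.
Proof.
move=> eD; rewrite /quad [X in X - _]eD; set Z := S D.
rewrite [(M0 + P) *m (zeta%:M + Z)]mulmxDr mul_mx_scalar.
rewrite [(_ + (M0 + P) *m Z) *m _]mulmxDl -scalemxAl.
have -> : (M0 + P) *m Z *m (M0 + Q) =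
    M0 *m Z *m M0 + (P *m Z *m M0 + M0 *m Z *m Q + P *m Z *m Q).
  by rewrite !(mulmxDl, mulmxDr); mxlin.
by mxlin.
Qed.

Lemma coord_identity zeta P D Q :
  D = (M0 + P) *m (zeta%:M + S D) *m (M0 + Q) ->
  zeta * ntr (L *m ((M0 + P) *m (M0 + Q))) + ntr (L *m quad P D Q) = 0.
Proof.
move=> /lin_identity e; rewrite -ntrZ scalemxAr -ntrD -mulmxDr -e.
by rewrite mulmxBr ntrB ntr_LK subrr.
Qed.

(** The coefficient of the quadratic term of the scalar equation satisfied by
    the coordinate along [V]. *)
Definition edge_sigma : R[i] := ntr (L *m M0 *m L *m V).

(** The normalisation of [V] makes the coefficient of the spectral parameter in
    the scalar equation equal to one. *)
Lemma ntr_LM0 : ntr (L *m (M0 *m M0)) = 1.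
Proof. by rewrite mulmxA ntr_mulC mulmxA -fixV (ef_ntr hF). Qed.

Lemma sigma_r : ntr (L *m (M0 *m L *m V)) = edge_sigma.
Proof. by rewrite /edge_sigma !mulmxA. Qed.

Lemma sigma_l : ntr (L *m (V *m L *m M0)) = edge_sigma.
Proof.
rewrite /edge_sigma; have -> : L *m (V *m L *m M0) = (L *m V) *m (L *m M0).
  by rewrite !mulmxA.
by rewrite ntr_mulC !mulmxA.
Qed.

Lemma sigma_real : edge_sigma^* = edge_sigma.
Proof.
rewrite -{2}sigma_l -sigma_r -ntr_adj !adjM (psd_herm edge_psdL).
rewrite (psd_herm pV) hM ntr_mulC; congr ntr.
by rewrite !mulmxA.
Qed.

Lemma mnormM_le X Y (x y : R) : mnorm X <= x -> mnorm Y <= y ->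
  mnorm (X *m Y) <= x * y.
Proof.
move=> hx hy; apply: le_trans (mnormM _ _) _.
by apply: ler_pM; rewrite ?mnorm_ge0.
Qed.

Let normS X x : mnorm X <= x -> mnorm (S X) <= b * x.
Proof.
by move=> h; apply: le_trans (ef_S hF X) _; rewrite ler_pM2l.
Qed.

Let normL X x : mnorm X <= x -> cabs (ntr (L *m X)) <= b * x.
Proof.
move=> h; apply: le_trans (cabs_ntr n0 _) _.
by apply: mnormM_le h; exact: ef_L hF.
Qed.

Variables (zeta : R[i]) (P D Q : 'M[R[i]]_n) (r : R).
Hypothesis r1 : r <= 1.
Hypothesis Pr : mnorm P <= r.
Hypothesis Qr : mnorm Q <= r.
Hypothesis eD : D = (M0 + P) *m (zeta%:M + S D) *m (M0 + Q).

Let r0 : 0 <= r. Proof. exact: le_trans (mnorm_ge0 P) Pr. Qed.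
Let z := cabs zeta.
Let d := mnorm D.
Let z0 : 0 <= z. Proof. exact: cabs_ge0. Qed.
Let d0 : 0 <= d. Proof. exact: mnorm_ge0. Qed.

Local Notation edge_c0 := (edge_c0 b).

Let bpow k m : (k <= m)%N -> b ^+ k <= b ^+ m.
Proof. by move=> h; apply: ler_weXn2l. Qed.

Let norm_quad : mnorm (quad P D Q) <= 3 * b ^+ 2 * (r * d).
Proof.
have sD := normS (lexx d).
have h1 := mnormM_le (mnormM_le Pr sD) (ef_M0 hF).
have h2 := mnormM_le (mnormM_le (ef_M0 hF) sD) Qr.
have h3 := mnormM_le (mnormM_le Pr sD) Qr.
apply: le_trans (mnormD _ _) _.
have h4 := le_trans (mnormD (P *m S D *m M0) (M0 *m S D *m Q)) (lerD h1 h2).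
apply: le_trans (lerD h4 h3) _.
have -> : r * (b * d) * b + b * (b * d) * r + r * (b * d) * r =
  2 * b ^+ 2 * (r * d) + (b * r) * (r * d) by ring.
have rd : 0 <= r * d by rewrite mulr_ge0.
have br : b * r <= b ^+ 2.
  by rewrite expr2 ler_pM2l //; apply: le_trans b1.
have := ler_wpM2r rd br; move: (r * d) => u; lra.
Qed.

Let rest_bound3 : mnorm (rest D) <= 4 * b ^+ 3 * (z + r * d).
Proof.
apply: le_trans (mnorm_rest D) _.
have M1 : mnorm (M0 + P) <= 2 * b.
  by have := le_trans (mnormD M0 P) (lerD (ef_M0 hF) Pr); move: b1 r1; lra.
have M2 : mnorm (M0 + Q) <= 2 * b.
  by have := le_trans (mnormD M0 Q) (lerD (ef_M0 hF) Qr); move: b1 r1; lra.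
rewrite (lin_identity eD).
have h : mnorm (zeta *: ((M0 + P) *m (M0 + Q))) <= z * (2 * b * (2 * b)).
  by rewrite mnormZ ler_wpM2l // mnormM_le.
have {}h := le_trans (mnormD _ _) (lerD h norm_quad).
apply: le_trans (ler_wpM2l (ltW b0) h) _.
have -> : b * (z * (2 * b * (2 * b)) + 3 * b ^+ 2 * (r * d)) =
  4 * b ^+ 3 * z + 3 * (b ^+ 3 * (r * d)) by ring.
have rd : 0 <= b ^+ 3 * (r * d).
  exact: mulr_ge0 (exprn_ge0 3 (ltW b0)) (mulr_ge0 r0 d0).
rewrite mulrDr lerD2l -[leRHS]mulrA.
by move: (_ * (r * d)) rd => u; lra.
Qed.

(** Transversally to [V] the linearisation is invertible, so that only the
    spectral parameter and the quadratic terms contribute. *)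
Lemma rest_bound : mnorm (rest D) <= edge_c0 * (z + r * d).
Proof.
apply: le_trans rest_bound3 _; apply: ler_wpM2r.
  by rewrite addr_ge0 ?mulr_ge0.
have := exprn_ge0 6 (ltW b0); have := @bpow 3 6 isT; rewrite edge_c0.unlock.
by move: (b ^+ 3) (b ^+ 6) => x y; lra.
Qed.

Let p := th P. Let q := th Q.
Let P' := rest P. Let Q' := rest Q.
Let e := mnorm P' + mnorm Q'.

Lemma quad_decomp : quad P D Q =
  (th D * th P) *: (V *m L *m M0) + (th D * th Q) *: (M0 *m L *m V) +
  (th D *: (rest P *m L *m M0) + th D *: (M0 *m L *m rest Q) +
   (P *m S (rest D) *m M0 + M0 *m S (rest D) *m Q + P *m S D *m Q)).
Proof.
have eS : S D = th D *: L + S (rest D) by rewrite [in LHS](vrest_decomp D) SD SZ.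
have e1 : P *m S D *m M0 = (th D * p) *: (V *m L *m M0) +
    (th D *: (P' *m L *m M0) + P *m S (rest D) *m M0).
  rewrite eS mulmxDr mulmxDl -scalemxAr -scalemxAl addrA; congr (_ + _).
  by rewrite [in LHS](vrest_decomp P) !mulmxDl -!scalemxAl scalerDr scalerA.
have e2 : M0 *m S D *m Q = (th D * q) *: (M0 *m L *m V) +
    (th D *: (M0 *m L *m Q') + M0 *m S (rest D) *m Q).
  rewrite eS mulmxDr mulmxDl -scalemxAr -scalemxAl addrA; congr (_ + _).
  by rewrite [in LHS](vrest_decomp Q) mulmxDr -scalemxAr scalerDr scalerA.
rewrite /quad e1 e2 -/p -/q -/P' -/Q'.
move: (V *m L *m M0) (P' *m L *m M0) (P *m S (rest D) *m M0).
move: (M0 *m L *m V) (M0 *m L *m Q') (M0 *m S (rest D) *m Q) (P *m S D *m Q).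
by move=> *; mxlin.
Qed.

(** Pairing the two-point identity with [L] leaves the scalar equation
    [zeta + th D (p + q) sigma = 0] up to terms of higher order. *)
Lemma coord_bound : cabs (zeta + th D * (p + q) * edge_sigma) <=
  edge_c0 * (r * z + (e + r ^+ 2) * d).
Proof.
have e0 : 0 <= e by rewrite addr_ge0 ?mnorm_ge0.
have g := rest_bound3; have g0 := mnorm_ge0 (rest D).
have thd : cabs (th D) <= b ^+ 2 * d := vcoord_le D.
set G := mnorm (rest D) in g g0.
have E1 : cabs (zeta * (ntr (L *m ((M0 + P) *m (M0 + Q))) - 1)) <=
   z * (3 * b ^+ 2 * r).
  rewrite cabsM ler_wpM2l // -ntr_LM0 -ntrB -mulmxBr.
  have -> : (M0 + P) *m (M0 + Q) - M0 *m M0 = P *m M0 + (M0 + P) *m Q.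
    by rewrite !(mulmxDl, mulmxDr); mxlin.
  have M1 : mnorm (M0 + P) <= 2 * b.
    by have := le_trans (mnormD M0 P) (lerD (ef_M0 hF) Pr); move: b1 r1; lra.
  have h1 := mnormM_le Pr (ef_M0 hF); have h2 := mnormM_le M1 Qr.
  have := normL (le_trans (mnormD _ _) (lerD h1 h2)).
  by congr (_ <= _); ring.
have [Y eY E2] : exists2 Y, quad P D Q =
    (th D * p) *: (V *m L *m M0) + (th D * q) *: (M0 *m L *m V) + Y &
    cabs (ntr (L *m Y)) <=
      b ^+ 5 * (e * d) + 2 * b ^+ 3 * (r * G) + b ^+ 2 * (r * r * d).
  eexists; first exact: quad_decomp.
  have k1 := mnormM_le (mnormM_le (lexx (mnorm P')) (ef_L hF)) (ef_M0 hF).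
  have k2 := mnormM_le (mnormM_le (ef_M0 hF) (ef_L hF)) (lexx (mnorm Q')).
  have sG := normS (lexx G); have sD := normS (lexx d).
  have k3 := mnormM_le (mnormM_le Pr sG) (ef_M0 hF).
  have k4 := mnormM_le (mnormM_le (ef_M0 hF) sG) Qr.
  have k5 := mnormM_le (mnormM_le Pr sD) Qr.
  have k1' : mnorm (th D *: (P' *m L *m M0)) <= b ^+ 2 * d * (mnorm P' * b * b).
    by rewrite mnormZ; apply: ler_pM; rewrite ?cabs_ge0 ?mnorm_ge0.
  have k2' : mnorm (th D *: (M0 *m L *m Q')) <= b ^+ 2 * d * (b * b * mnorm Q').
    by rewrite mnormZ; apply: ler_pM; rewrite ?cabs_ge0 ?mnorm_ge0.
  have t1 := le_trans (mnormD _ _) (lerD k1' k2').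
  have t2 := le_trans (mnormD _ _) (lerD (le_trans (mnormD _ _) (lerD k3 k4)) k5).
  have := normL (le_trans (mnormD _ _) (lerD t1 t2)).
  by congr (_ <= _); rewrite /e; ring.
have eL : ntr (L *m quad P D Q) =
    th D * p * edge_sigma + th D * q * edge_sigma + ntr (L *m Y).
  by rewrite eY !mulmxDr !ntrD -!scalemxAr !ntrZ sigma_l sigma_r.
have := coord_identity eD; rewrite eL.
move: (ntr (L *m ((M0 + P) *m (M0 + Q)))) (ntr (L *m Y)) E1 E2 => m y E1 E2 eq0.
have -> : zeta + th D * (p + q) * edge_sigma = - (zeta * (m - 1)) - y.
  apply/eqP; rewrite -subr_eq0 -eq0; apply/eqP; ring.
apply: le_trans (cabsD _ _) _; rewrite !cabsN.
apply: le_trans (lerD E1 E2) _.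
have rG : b ^+ 3 * (r * G) <=
    4 * (b ^+ 6 * (r * z)) + 4 * (b ^+ 6 * (r ^+ 2 * d)).
  have b3 := exprn_ge0 3 (ltW b0).
  by have := ler_wpM2l b3 (ler_wpM2l r0 g); congr (_ <= _); ring.
have rz : 0 <= r * z by rewrite mulr_ge0.
have rrd : 0 <= r ^+ 2 * d by rewrite mulr_ge0 ?exprn_ge0.
have ed : 0 <= e * d by rewrite mulr_ge0.
have h1 := ler_wpM2r rz (@bpow 2 6 isT).
have h2 := ler_wpM2r ed (@bpow 5 6 isT).
have h3 := ler_wpM2r rrd (@bpow 2 6 isT).
have -> : z * (3 * b ^+ 2 * r) = 3 * (b ^+ 2 * (r * z)) by ring.
have -> : 2 * b ^+ 3 * (r * G) = 2 * (b ^+ 3 * (r * G)) by ring.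
have -> : b ^+ 2 * (r * r * d) = b ^+ 2 * (r ^+ 2 * d) by ring.
have -> : edge_c0 * (r * z + (e + r ^+ 2) * d) =
   11 * (b ^+ 6 * (r * z)) + 11 * (b ^+ 6 * (e * d)) + 11 * (b ^+ 6 * (r ^+ 2 * d)).
  by rewrite edge_c0.unlock; ring.
have b6 := exprn_ge0 6 (ltW b0).
have k2 := mulr_ge0 b6 ed; have k3 := mulr_ge0 b6 rrd.
move: rG h1 h2 h3 k2 k3.
move: (b ^+ 2 * (r * z)) (b ^+ 6 * (r * z)) (b ^+ 5 * (e * d)) (b ^+ 6 * (e * d)).
move: (b ^+ 2 * (r ^+ 2 * d)) (b ^+ 6 * (r ^+ 2 * d)) (b ^+ 3 * (r * G)).
move=> g1 g2 g3 g4 g5 g6 g7 *; lra.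
Qed.

End LocalExpansion.

(** * The quadratic coefficient at a regular edge *)

Section CubicAlgebra.
Context {R : realType}.
Variable n : nat.
Implicit Types (L M V e T X : 'M[R[i]]_n) (t : R[i]).

(** The hypothesis on the trace is the second order of the scalar equation when
    its quadratic coefficient vanishes; it is three times the conclusion, after
    [V L V] has been expressed by [e - M T M]. *)
Lemma cubic_sum L M V e T t : V = M *m L *m M -> t != 0 ->
  e - M *m T *m M = t ^+ 2 *: (M *m L *m V) ->
  ntr (L *m ((e *m L *m M + M *m L *m e) +
    ((t *: V) *m ((2 / t) *: T) *m M + M *m ((2 / t) *: T) *m (t *: V) +
     (t *: V) *m L *m (t *: V)))) = 0 ->
  ntr (L *m M *m L *m e) + ntr (L *m M *m T *m V) = 0.
Proof.
move=> fixV t0 e_eq.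
have sym : V *m L *m M = M *m L *m V by rewrite fixV !mulmxA.
have eb X : ntr (L *m (V *m X *m M)) = ntr (L *m M *m X *m V).
  transitivity (ntr (M *m L *m V *m X)).
    by rewrite !mulmxA ntr_mulC !mulmxA.
  rewrite -sym; transitivity (ntr (V *m (L *m M *m X))).
    by rewrite !mulmxA.
  exact: ntr_mulC.
set a := ntr (L *m M *m L *m e); set bb := ntr (L *m M *m T *m V).
have n1 : ntr (L *m (e *m L *m M)) = a.
  transitivity (ntr ((L *m e) *m (L *m M))); first by rewrite !mulmxA.
  by rewrite ntr_mulC !mulmxA.
have n2 : ntr (L *m (M *m L *m e)) = a by rewrite !mulmxA.
have n3 : ntr (L *m ((t *: V) *m ((2 / t) *: T) *m M)) = 2 * bb.
  rewrite -!scalemxAl -!scalemxAr -scalemxAl -scalemxAr scalerA ntrZ eb.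
  by rewrite [_ * (2 / t)]mulrC divfK.
have n4 : ntr (L *m (M *m ((2 / t) *: T) *m (t *: V))) = 2 * bb.
  rewrite -!scalemxAr -!scalemxAl -!scalemxAr scalerA ntrZ !mulmxA.
  by rewrite [_ * (2 / t)]mulrC divfK.
have n5 : ntr (L *m ((t *: V) *m L *m (t *: V))) = a - bb.
  have -> : a - bb = ntr (L *m M *m L *m (e - M *m T *m M)).
    rewrite mulmxBr ntrB; congr (_ - _); rewrite /bb -eb [in LHS]fixV.
    by rewrite !mulmxA.
  have -> : (t *: V) *m L *m (t *: V) = (t * t) *: (V *m L *m V).
    by rewrite -scalemxAr -!scalemxAl scalerA.
  rewrite e_eq -!scalemxAr !ntrZ expr2; congr (_ * ntr _).
  by rewrite [X in _ *m (X *m _ *m _)]fixV !mulmxA.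
rewrite !(mulmxDr L) !ntrD n1 n2 n3 n4 n5 => h.
have : 3 * (a + bb) = 0 by rewrite -h; ring.
by move/eqP; rewrite mulf_eq0 pnatr_eq0 => /eqP.
Qed.

End CubicAlgebra.

(** Along a sequence approaching the edge, let [r] be the norm of
    [Dl = M - M0]. The quotient [Dl / r] tends to a multiple [t V], the rest of
    [Dl] divided by [r ^ 2] to some [e], and [omega / r ^ 2] to some [o]. The
    leading order of the scalar equation for [Dl] is [o + t ^ 2 sigma = 0]. The
    normalised imaginary part [v] of [M] solves an equation of the same type
    with the negligible spectral parameter [eta / rho], and its leading order is
    [2 Re t sigma = 0]. If [sigma] is not zero, then [t] is imaginary and the
    modulus of [sigma] is that of [o / (Im t) ^ 2]. If [sigma] vanishes, then so
    does [o], hence [t] is real; the first order of [v] is then [(2 / t) e], and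
    the second order of its scalar equation says that the cubic coefficient
    vanishes, which is impossible. *)
Section SigmaValue.
Context {R : realType} {I : Type} (F : set_system I) {FF : ProperFilter F}.
Hypothesis FU : UltraFilter F.
Variables (n : nat) (S : 'M[R[i]]_n -> 'M[R[i]]_n) (c C b : R).
Hypothesis n0 : (0 < n)%N.
Hypothesis hS : energy_map S c C.
Variables (A M0 V : 'M[R[i]]_n) (tau h : R).
Hypothesis hA : A^t* = A.
Hypothesis hF : edge_frame S M0 V b.
Hypothesis pV : posdef V.
Hypothesis e0 : mde_eq S A tau%:C M0.
Variables (z : I -> R[i]) (M : I -> 'M[R[i]]_n).
Hypothesis eM : forall k, mde_eq S A (z k) (M k).
Let rho k := rtr (ImM (M k)).
Hypothesis rho0 : forall k, 0 < rho k.
Hypothesis eta0 : forall k, 0 < complex.Im (z k).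
Hypothesis cM : mcvg F M M0.
Hypothesis cV : mcvg F (fun k => ((rho k)^-1)%:C *: ImM (M k)) V.
Hypothesis eta_small : complex.Im (z k) / rho k ^+ 3 @[k --> F] --> 0.
Hypothesis omega_rho : cabs (z k - tau%:C) / rho k ^+ 2 @[k --> F] --> h.
Hypothesis h0 : 0 < h.

Local Notation th := (vcoord S V).
Local Notation rest := (vrest S V).
Local Notation L := (S V).
Local Notation sigma := (edge_sigma S M0 V).

Let Dl k := M k - M0.
Let r k := mnorm (Dl k).
Let om k := z k - tau%:C.
Let v k := ((rho k)^-1)%:C *: ImM (M k).
Let et k : R := complex.Im (z k) / rho k.
Let ri k : R[i] := ((r k)^-1)%:C.

Let hM := ef_M0adj hF.

Let eDl k : Dl k = (M0 + 0) *m ((om k)%:M + S (Dl k)) *m (M0 + Dl k).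
Proof.
by rewrite addr0 [M0 + Dl k]addrC subrK; exact: (two_point_sym hS (eM k) e0).
Qed.

Let ev k : v k = (M0 + (Dl k)^t*) *m ((et k)%:C%:M + S (v k)) *m (M0 + Dl k).
Proof.
have -> : M0 + (Dl k)^t* = (M k)^t* by rewrite adjB hM addrC subrK.
have hSv : S (v k) = ((rho k)^-1)%:C *: S (ImM (M k)) by exact: (emZ hS).
rewrite [M0 + Dl k]addrC subrK hSv {1}/v {1}(mde_ImMl hS hA (eM k)).
rewrite scalemxAl scalemxAr scalerDr scale_scalar_mx -rmorphM.
by rewrite [_ * complex.Im _]mulrC.
Qed.

Let ImDl k : ImM (Dl k) = ImM (M k).
Proof. by rewrite !ImME adjB hM; congr (_ *: _); mxlin. Qed.

Let rho_le_r k : rho k <= r k.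
Proof.
apply: le_trans (ler_norm _) _; apply: le_trans (rtr_le_mnorm n0 _) _.
by rewrite -ImDl mnorm_ImM.
Qed.

Let r_gt0 k : 0 < r k. Proof. exact: lt_le_trans (rho_le_r k). Qed.

Let cr0 : r k @[k --> F] --> 0. Proof. exact: cM. Qed.

Let r_le1 : \forall k \near F, r k <= 1.
Proof. by have /cvgr_le := cr0; apply; exact: ltr01. Qed.

Let crc : ccvg F (fun k => (r k)%:C) 0.
Proof. exact: ccvg_real cr0. Qed.

Let rir k : ri k * (r k)%:C = 1.
Proof. by rewrite -rmorphM mulVf ?gt_eqF. Qed.

Let om_bounded : \forall k \near F, cabs (om k) / r k ^+ 2 <= h + 1.
Proof.
have /cvgr_le/(_ (h + 1)) : cabs (om k) / rho k ^+ 2 @[k --> F] --> h by [].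
rewrite ltrDl ltr01 => /(_ isT); apply: filterS => k; apply: le_trans.
rewrite ler_wpM2l ?cabs_ge0 // lef_pV2 ?posrE ?exprn_gt0 //.
by rewrite ler_pXn2r ?nnegrE ?(ltW (r_gt0 k)) ?(ltW (rho0 k)).
Qed.

Let en k := (ri k * ri k) *: rest (Dl k).

Let mnorm_ri2 k (X : 'M[R[i]]_n) : mnorm ((ri k * ri k) *: X) = mnorm X / r k ^+ 2.
Proof.
rewrite mnormZ -rmorphM cabs_real ger0_norm ?mulr_ge0 ?invr_ge0 ?(ltW (r_gt0 k)) //.
by rewrite -invfM -expr2 mulrC.
Qed.

Let c00 : 0 <= edge_c0 b.
Proof. by rewrite edge_c0.unlock mulr_ge0 // exprn_ge0 // ltW // (edge_b_gt0 hF). Qed.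

Let en_bounded : \forall k \near F, mnorm (en k) <= edge_c0 b * (h + 2).
Proof.
near=> k.
have r1 : r k <= 1 by near: k; exact: r_le1.
have ho : cabs (om k) / r k ^+ 2 <= h + 1 by near: k; exact: om_bounded.
rewrite mnorm_ri2 ler_pdivrMr ?exprn_gt0 //.
have z0 : mnorm (0 : 'M[R[i]]_n) <= r k by rewrite mnorm0 ltW.
apply: le_trans (rest_bound hS hF r1 z0 (lexx _) (eDl k)) _.
rewrite -[leRHS]mulrA ler_wpM2l // -/(r k) -expr2.
move: ho; rewrite ler_pdivrMr ?exprn_gt0 //.
move: (cabs _) (r k ^+ 2) => x y; lra.
Unshelve. all: by end_near. Qed.

Let exists_e : exists e, mcvg F en e.
Proof. exact: ultra_mcvg en_bounded. Qed.

Let th_bounded : \forall k \near F, cabs (ri k * th (Dl k)) <= b ^+ 2.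
Proof.
near=> k; rewrite cabsM cabs_real ger0_norm ?invr_ge0 ?(ltW (r_gt0 k)) //.
by rewrite mulrC ler_pdivrMr // (vcoord_le n0 hF).
Unshelve. all: by end_near. Qed.

Let exists_theta : exists t, ccvg F (fun k => ri k * th (Dl k)) t.
Proof. exact: ultra_ccvg th_bounded. Qed.

Let on_bounded : \forall k \near F, cabs (ri k * ri k * om k) <= h + 1.
Proof.
apply: filterS om_bounded => k; rewrite cabsM -rmorphM cabs_real ger0_norm.
  by rewrite -invfM -expr2 mulrC.
by rewrite mulr_ge0 ?invr_ge0 ?(ltW (r_gt0 k)).
Qed.

Let exists_o : exists o, ccvg F (fun k => ri k * ri k * om k) o.
Proof. exact: ultra_ccvg on_bounded. Qed.

Let xn k := ri k *: Dl k.

Let xnE k : xn k = (ri k * th (Dl k)) *: V + (r k)%:C *: en k.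
Proof.
rewrite /xn {1}(vrest_decomp S V (Dl k)) scalerDr scalerA; congr (_ + _).
by rewrite /en scalerA mulrA [(r k)%:C * _]mulrC rir mul1r.
Qed.

Section Limits.
Variables (e : 'M[R[i]]_n) (t o : R[i]).
Hypothesis ce : mcvg F en e.
Hypothesis ct : ccvg F (fun k => ri k * th (Dl k)) t.
Hypothesis co : ccvg F (fun k => ri k * ri k * om k) o.

Let cx : mcvg F xn (t *: V).
Proof.
have -> : t *: V = t *: V + 0 *: e by rewrite scale0r addr0.
apply: mcvg_ext (mcvgD (mcvgZ ct (mcvg_cst V)) (mcvgZ crc ce)).
by near=> k; rewrite xnE.
Unshelve. all: by end_near. Qed.

Let t_neq0 : t != 0.
Proof.
have n1 k : mnorm (xn k) = 1.
  rewrite mnormZ cabs_real ger0_norm ?invr_ge0 ?(ltW (r_gt0 k)) //.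
  by rewrite mulVf ?gt_eqF.
apply/eqP => t0; have := mcvg_norm cx; rewrite t0 scale0r mnorm0 => /(_ FF) hx.
have n1' : \forall k \near F, 1 <= mnorm (xn k).
  by apply: nearW => k; rewrite n1.
have := cvg_le0_eq ler01 n1' hx => /(_ FF) /eqP.
by rewrite oner_eq0.
Qed.

Let cEr : mnorm (rest (Dl k)) / r k @[k --> F] --> 0.
Proof.
apply: (@squeeze0 _ _ _ _ _ (fun k => r k * (edge_c0 b * (h + 2)))).
  near=> k; rewrite divr_ge0 ?mnorm_ge0 ?(ltW (r_gt0 k)) //=.
  have : mnorm (en k) <= edge_c0 b * (h + 2) by near: k; exact: en_bounded.
  rewrite mnorm_ri2; set B := edge_c0 b * _; rewrite ler_pdivrMr ?exprn_gt0 // => hk.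
  by rewrite ler_pdivrMr // mulrAC -expr2 mulrC.
rewrite -[X in _ --> X](mul0r (edge_c0 b * (h + 2))); exact: cvgMl cr0.
Unshelve. all: by end_near. Qed.

Let first_order : o + t ^+ 2 * sigma = 0.
Proof.
have c1 : ccvg F (fun k => ri k * ri k * om k +
    (ri k * th (Dl k)) * (ri k * th (Dl k)) * sigma) (o + t * t * sigma).
  by apply: ccvgD => //; apply: ccvgM (ccvg_cst _); exact: ccvgM.
rewrite expr2; apply: ccvg_unique c1 _; apply: ccvg0_abs.
apply: (@squeeze0 _ _ _ _ _ (fun k => r k * (edge_c0 b * (h + 2)) +
   mnorm (rest (Dl k)) / r k * edge_c0 b)); last first.
  apply: cvg0D; first by rewrite -[X in _ --> X](mul0r (edge_c0 b * (h + 2))); exact: cvgMl cr0.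
  by rewrite -[X in _ --> X](mul0r (edge_c0 b)); exact: cvgMl cEr.
near=> k; rewrite cabs_ge0 /=.
have r1 : r k <= 1 by near: k; exact: r_le1.
have ho : cabs (om k) / r k ^+ 2 <= h + 1 by near: k; exact: om_bounded.
have z0 : mnorm (0 : 'M[R[i]]_n) <= r k by rewrite mnorm0 ltW.
have := coord_bound n0 hS hF r1 z0 (lexx _) (eDl k).
have v0 : th 0 = 0 by rewrite -(scale0r 0) (vcoordZ S V) mul0r.
have rst0 : rest 0 = 0 by rewrite /vrest v0 scale0r subrr.
rewrite v0 rst0 mnorm0 !add0r -/(r k) => hk.
have -> : ri k * ri k * om k + ri k * th (Dl k) * (ri k * th (Dl k)) * sigma =
   ri k * ri k * (om k + th (Dl k) * th (Dl k) * sigma) by ring.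
rewrite cabsM -rmorphM cabs_real ger0_norm ?mulr_ge0 ?invr_ge0 ?(ltW (r_gt0 k)) //.
rewrite -invfM -expr2 mulrC ler_pdivrMr ?exprn_gt0 //.
apply: le_trans hk _.
have -> : (r k * (edge_c0 b * (h + 2)) + mnorm (rest (Dl k)) / r k * edge_c0 b) * r k ^+ 2
  = edge_c0 b * (r k * ((h + 2) * r k ^+ 2) + mnorm (rest (Dl k)) * r k).
  by field; rewrite gt_eqF.
rewrite ler_wpM2l // mulrDl addrCA addrC lerD2r.
rewrite -exprSr exprS -mulrDr ler_pM2l //.
move: ho; rewrite ler_pdivrMr ?exprn_gt0 //.
by move: (cabs _) (r k ^+ 2) => x y; lra.
Unshelve. all: by end_near. Qed.

Let cv : mcvg F v V. Proof. exact: cV. Qed.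

Let cth (X : I -> 'M[R[i]]_n) Y : mcvg F X Y -> ccvg F (fun k => th (X k)) (th Y).
Proof.
move=> cX; apply: ccvgM (ccvg_cst _) _.
by apply: (ccvg_ntr n0); apply: mcvgM (mcvg_cst _) cX.
Qed.

Let cS (X : I -> 'M[R[i]]_n) Y : mcvg F X Y -> mcvg F (fun k => S (X k)) (S Y).
Proof.
by move=> cX; apply: (mcvg_linear (C := b) _ (ef_S hF) cX) => X1 X2; exact: (emB hS).
Qed.

Let et_gt0 k : 0 < et k. Proof. by rewrite divr_gt0. Qed.

Let cet2 : et k / r k ^+ 2 @[k --> F] --> 0.
Proof.
apply: squeeze0 eta_small; near=> k.
rewrite divr_ge0 ?exprn_ge0 ?(ltW (et_gt0 k)) ?(ltW (r_gt0 k)) //=.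
have -> : complex.Im (z k) / rho k ^+ 3 = et k / rho k ^+ 2.
  by rewrite /et; field; rewrite gt_eqF // rho0.
rewrite ler_pM2l // lef_pV2 ?posrE ?exprn_gt0 //.
by rewrite ler_pXn2r ?nnegrE ?(ltW (r_gt0 k)) ?(ltW (rho0 k)).
Unshelve. all: by end_near. Qed.

Let cet1 : et k / r k @[k --> F] --> 0.
Proof.
apply: squeeze0 cet2; near=> k.
have r1 : r k <= 1 by near: k; exact: r_le1.
rewrite divr_ge0 ?(ltW (et_gt0 k)) ?(ltW (r_gt0 k)) //=.
rewrite ler_pM2l // lef_pV2 ?posrE ?exprn_gt0 //.
by rewrite expr2 -[leRHS]mulr1 ler_pM2l.
Unshelve. all: by end_near. Qed.

Let crie : ccvg F (fun k => ri k * (et k)%:C) 0.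
Proof.
apply: ccvg_ext (ccvg_real cet1); near=> k.
by rewrite -rmorphM mulrC.
Unshelve. all: by end_near. Qed.

Let ri_conj k : (ri k)^* = ri k. Proof. exact: conjC_rc. Qed.

Let ctJ : ccvg F (fun k => ri k * th ((Dl k)^t*)) (t^*).
Proof.
apply: ccvg_ext (ccvg_conj ct); near=> k.
by rewrite conjCM ri_conj (vcoord_adj hS hF).
Unshelve. all: by end_near. Qed.

Let first_order_v : (t^* + t) * sigma = 0.
Proof.
have c1 : ccvg F (fun k => ri k * (et k)%:C +
    th (v k) * (ri k * th ((Dl k)^t*) + ri k * th (Dl k)) * sigma)
    (0 + th V * (t^* + t) * sigma).
  apply: ccvgD crie _; apply: ccvgM (ccvg_cst _); apply: ccvgM (cth cv) _.
  exact: ccvgD.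
have -> : (t^* + t) * sigma = 0 + th V * (t^* + t) * sigma.
  by rewrite (vcoordV hS hF) mul1r add0r.
apply: ccvg_unique c1 _; apply: ccvg0_abs.
pose B := edge_c0 b * (mnorm V + 1).
apply: (@squeeze0 _ _ _ _ _ (fun k => et k / r k * edge_c0 b +
   (mnorm (rest (Dl k)) / r k * (2 * B) + r k * B))); last first.
  apply: cvg0D; first by rewrite -[X in _ --> X](mul0r (edge_c0 b)); exact: cvgMl cet1.
  apply: cvg0D; first by rewrite -[X in _ --> X](mul0r (2 * B)); exact: cvgMl cEr.
  by rewrite -[X in _ --> X](mul0r B); exact: cvgMl cr0.
near=> k; rewrite cabs_ge0 /=.
have r1 : r k <= 1 by near: k; exact: r_le1.
have hv : mnorm (v k) <= mnorm V + 1 by near: k; exact: mcvg_bounded cv.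
have Dr : mnorm ((Dl k)^t*) <= r k by rewrite mnorm_adj.
have := coord_bound n0 hS hF r1 Dr (lexx _) (ev k).
rewrite -(vrest_adj hS hF) mnorm_adj -/(r k).
rewrite cabs_real ger0_norm ?(ltW (et_gt0 k)) //.
set m := mnorm (rest _) => hk.
have -> : ri k * (et k)%:C + th (v k) * (ri k * th ((Dl k)^t*) + ri k * th (Dl k)) * sigma
  = ri k * ((et k)%:C + th (v k) * (th ((Dl k)^t*) + th (Dl k)) * sigma).
  move: (th (v k)) (th ((Dl k)^t*)) (th (Dl k)) (ri k) ((et k)%:C) sigma.
  by move=> *; ring.
rewrite cabsM cabs_real ger0_norm ?invr_ge0 ?(ltW (r_gt0 k)) //.
rewrite mulrC ler_pdivrMr //; apply: le_trans hk _.
have -> : (et k / r k * edge_c0 b + (m / r k * (2 * B) + r k * B)) * r k =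
   edge_c0 b * (et k + (m + m + r k ^+ 2) * (mnorm V + 1)).
  by rewrite /B; field; rewrite gt_eqF.
rewrite ler_wpM2l //; apply: lerD.
  by rewrite -[leRHS]mul1r ler_wpM2r // ltW.
by rewrite ler_wpM2l // !addr_ge0 ?mnorm_ge0 ?exprn_ge0 ?(ltW (r_gt0 k)).
Unshelve. all: by end_near. Qed.

Let rho_over_r : rho k / r k @[k --> F] --> complex.Im t.
Proof.
have : complex.Im (ntr (xn k)) @[k --> F] --> complex.Im (ntr (t *: V)).
  exact: ccvg_Im (ccvg_ntr n0 cx).
rewrite ntrZ (ef_ntr hF) mulr1.
have -> : (fun k => complex.Im (ntr (xn k))) = (fun k => rho k / r k); last by [].
apply/funext => k; rewrite /xn ntrZ ImMr mulrC.
by rewrite /rho -rtr_ImM ImDl.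
Qed.

Let omega_limit : cabs o = h * complex.Im t ^+ 2.
Proof.
have c1 : cabs (z k - tau%:C) / rho k ^+ 2 * (rho k / r k * (rho k / r k))
    @[k --> F] --> h * (complex.Im t * complex.Im t).
  by apply: cvgM omega_rho _; exact: cvgM.
have c2 : cabs (ri k * ri k * om k) @[k --> F] --> cabs o by exact: ccvg_abs.
rewrite expr2; apply: cvgr_unique c2 _; move: c1.
suff -> : (fun k => cabs (ri k * ri k * om k)) =
  (fun k => cabs (z k - tau%:C) / rho k ^+ 2 * (rho k / r k * (rho k / r k))) by [].
apply/funext => k /=; rewrite cabsM -rmorphM cabs_real ger0_norm.
  rewrite /om; field.
  by rewrite (gt_eqF (rho0 k)) (gt_eqF (r_gt0 k)).
by rewrite mulr_ge0 ?invr_ge0 ?(ltW (r_gt0 k)).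
Qed.

Section Degenerate.
Hypothesis sigma0 : sigma = 0.

Let o0 : o = 0.
Proof. by move: first_order; rewrite sigma0 mulr0 addr0. Qed.

Let Imt : complex.Im t = 0.
Proof.
move: omega_limit; rewrite o0 cabs0 => /esym/eqP.
by rewrite mulf_eq0 (gt_eqF h0) /= sqrf_eq0 => /eqP.
Qed.

Let tJ : t^* = t.
Proof. by apply: eqC; rewrite ?ReJ // ImJ Imt oppr0. Qed.

Let LV_sym : V *m L *m M0 = M0 *m L *m V.
Proof.
have gen G W : W = M0 *m G *m M0 -> W *m G *m M0 = M0 *m G *m W.
  by move=> ->; rewrite !mulmxA.
exact: gen (ef_fix hF).
Qed.

Local Notation K X := (M0 *m S X *m M0).

Let cK (X : I -> 'M[R[i]]_n) Y : mcvg F X Y -> mcvg F (fun k => K (X k)) (K Y).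
Proof.
move=> cX; apply: mcvgM (mcvg_cst _); apply: mcvgM (mcvg_cst _) _.
exact: cS.
Qed.

Let KZ a X : K (a *: X) = a *: K X.
Proof. by rewrite (emZ hS) -scalemxAr -scalemxAl. Qed.

Let KB X Y : K (X - Y) = K X - K Y.
Proof. by rewrite (emB hS) mulmxBr mulmxBl. Qed.

Let e_eq : e - K e = t ^+ 2 *: (M0 *m L *m V).
Proof.
have c1 : mcvg F (fun k => en k - K (en k)) (e - K e).
  by apply: mcvgB ce _; exact: cK.
have c2 : mcvg F (fun k => (ri k * ri k * om k) *: (M0 *m M k) +
    M0 *m S (xn k) *m xn k) (o *: (M0 *m M0) + M0 *m S (t *: V) *m (t *: V)).
  apply: mcvgD; first by apply: mcvgZ co _; apply: mcvgM (mcvg_cst _) cM.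
  by apply: mcvgM cx; apply: mcvgM (mcvg_cst _) _; exact: cS.
have <- : o *: (M0 *m M0) + M0 *m S (t *: V) *m (t *: V) =
    t ^+ 2 *: (M0 *m L *m V).
  by rewrite o0 scale0r add0r (emZ hS) -!scalemxAr -scalemxAl scalerA expr2.
apply: mcvg_unique c1 _; apply: mcvg_ext c2; near=> k.
have e1 := etrans (rest_lin hS hF (Dl k)) (lin_identity (eDl k)).
have -> : en k - K (en k) = (ri k * ri k) *: (rest (Dl k) - K (rest (Dl k))).
  by rewrite scalerBr KZ.
rewrite e1.
rewrite /quad addr0 [M0 + Dl k]addrC subrK !mul0mx add0r addr0.
rewrite scalerDr scalerA; congr (_ + _).
by rewrite /xn (emZ hS) -scalemxAr -scalemxAr -scalemxAl scalerA.
Unshelve. all: by end_near. Qed.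

Let th_e : th e = 0.
Proof.
apply: ccvg_unique (cth ce) _; apply: ccvg_ext (ccvg_cst 0); near=> k.
by rewrite /en vcoordZ (vcoord_rest hS hF) mulr0.
Unshelve. all: by end_near. Qed.

Let kernel_trivial X : th X = 0 -> X - K X = 0 -> X = 0.
Proof.
move=> X0 KX; apply: mnorm_eq0; apply: le_anti; rewrite mnorm_ge0 andbT.
by have := ef_stab hF X0; rewrite KX mnorm0 mulr0.
Qed.

Let e_adj : e^t* = e.
Proof.
apply/eqP; rewrite -subr_eq0; apply/eqP; apply: kernel_trivial.
  by rewrite vcoordD vcoordN (vcoord_adj hS hF) th_e rmorph0 subr0.
have h1 : e^t* - K (e^t*) = e - K e.
  have -> : K (e^t*) = (K e)^t* by rewrite (em_adj hS) !adjM hM mulmxA.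
  rewrite -adjB e_eq adjZ !adjM hM (psd_herm (edge_psdL hS hF)).
  by rewrite (psd_herm (ef_psd hF)) mulmxA LV_sym expr2 conjCM tJ.
rewrite KB; move: h1; move: (K e) (K (e^t*)) => X Y h1.
have -> : e^t* - e - (Y - X) = (e^t* - Y) - (e - X) by mxlin.
by rewrite h1 subrr.
Qed.

Let wn k := ri k *: rest (v k).

Let wn_bounded : \forall k \near F, mnorm (wn k) <= edge_c0 b * (mnorm V + 2).
Proof.
near=> k.
have r1 : r k <= 1 by near: k; exact: r_le1.
have hv : mnorm (v k) <= mnorm V + 1 by near: k; exact: mcvg_bounded cv.
have he : et k / r k <= 1 by near: k; have /cvgr_le := cet1; apply; exact: ltr01.
have Dr : mnorm ((Dl k)^t*) <= r k by rewrite mnorm_adj.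
have := rest_bound hS hF r1 Dr (lexx _) (ev k).
rewrite cabs_real ger0_norm ?(ltW (et_gt0 k)) // => hk.
rewrite mnormZ cabs_real ger0_norm ?invr_ge0 ?(ltW (r_gt0 k)) //.
rewrite mulrC ler_pdivrMr //; apply: le_trans hk _.
rewrite -[leRHS]mulrA ler_wpM2l //; move: he; rewrite ler_pdivrMr // mul1r => he.
have := ler_wpM2l (ltW (r_gt0 k)) hv.
rewrite mulrDl mulrDr mulr1 [r k * mnorm V]mulrC.
by move: (mnorm V * r k) (r k * mnorm _) => x y; lra.
Unshelve. all: by end_near. Qed.

Let cDl : mcvg F Dl 0.
Proof.
apply: squeeze0 cM; near=> k.
by rewrite mnorm_ge0 subr0 lexx.
Unshelve. all: by end_near. Qed.

Let exists_w : exists w, mcvg F wn w.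
Proof. exact: ultra_mcvg wn_bounded. Qed.

Let xnJ k : (xn k)^t* = ri k *: (Dl k)^t*.
Proof. by rewrite adjZ ri_conj. Qed.

Let w_lim w : mcvg F wn w -> w = (2 / t) *: e.
Proof.
move=> cw; apply/eqP; rewrite -subr_eq0; apply/eqP; apply: kernel_trivial.
  rewrite vcoordD vcoordN vcoordZ th_e mulr0 subr0.
  apply: ccvg_unique (cth cw) _; apply: ccvg_ext (ccvg_cst 0); near=> k.
  by rewrite /wn vcoordZ (vcoord_rest hS hF) mulr0.
have w_eq : w - K w = (2 * t) *: (M0 *m L *m V).
  have c1 : mcvg F (fun k => wn k - K (wn k)) (w - K w).
    exact: mcvgB cw (cK cw).
  have c2 : mcvg F (fun k => (ri k * (et k)%:C) *: ((M k)^t* *m M k) +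
      ((xn k)^t* *m S (v k) *m M0 + M0 *m S (v k) *m xn k +
       (Dl k)^t* *m S (v k) *m xn k))
     (0 *: (M0^t* *m M0) + ((t *: V)^t* *m L *m M0 + M0 *m L *m (t *: V) +
       0^t* *m L *m (t *: V))).
    apply: mcvgD.
      by apply: mcvgZ crie _; exact: mcvgM (mcvg_adj cM) cM.
    apply: mcvgD.
      apply: mcvgD.
        by apply: mcvgM (mcvg_cst _); apply: mcvgM (mcvg_adj cx) (cS cv).
      by apply: mcvgM cx; apply: mcvgM (mcvg_cst _) (cS cv).
    by apply: mcvgM cx; apply: mcvgM (mcvg_adj cDl) (cS cv).
  have <- : 0 *: (M0^t* *m M0) + ((t *: V)^t* *m L *m M0 + M0 *m L *m (t *: V) +
       0^t* *m L *m (t *: V)) = (2 * t) *: (M0 *m L *m V).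
    rewrite scale0r add0r adj0 !mul0mx addr0 adjZ tJ (psd_herm (ef_psd hF)).
    rewrite -!scalemxAl -scalemxAr LV_sym.
    by rewrite -scalerDl mulr_natl mulr2n.
  apply: mcvg_unique c1 _; apply: mcvg_ext c2; near=> k.
  have e1 := etrans (rest_lin hS hF (v k)) (lin_identity (ev k)).
  have -> : wn k - K (wn k) = ri k *: (rest (v k) - K (rest (v k))).
    by rewrite scalerBr KZ.
  rewrite e1.
  have -> : M0 + (Dl k)^t* = (M k)^t* by rewrite adjB hM addrC subrK.
  rewrite [M0 + Dl k]addrC subrK scalerDr scalerA; congr (_ + _).
  have gen a P Z D : a *: (P *m Z *m M0 + M0 *m Z *m D + P *m Z *m D) =
      a *: P *m Z *m M0 + M0 *m Z *m (a *: D) + P *m Z *m (a *: D).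
    by rewrite !scalerDr -!scalemxAl -!scalemxAr.
  by rewrite xnJ /xn -gen.
rewrite KB KZ.
have -> : w - (2 / t) *: e - (K w - (2 / t) *: K e) = (w - K w) - (2 / t) *: (e - K e).
  by move: (K w) (K e) => X Y; mxlin.
rewrite w_eq e_eq scalerA.
have -> : 2 / t * t ^+ 2 = 2 * t by field; exact: t_neq0.
exact: subrr.
Unshelve. all: by end_near. Qed.

Let crie2 : ccvg F (fun k => ri k * ri k * (et k)%:C) 0.
Proof.
apply: ccvg_ext (ccvg_real cet2); near=> k.
by rewrite -!rmorphM -invfM -expr2 mulrC.
Unshelve. all: by end_near. Qed.

Let second_order_v w : mcvg F wn w ->
  ntr (L *m ((e^t* *m L *m M0 + M0 *m L *m e) +
    ((t *: V)^t* *m S w *m M0 + M0 *m S w *m (t *: V) +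
     (t *: V)^t* *m L *m (t *: V)))) = 0.
Proof.
move=> cw.
pose Y k := (th (v k) *: ((en k)^t* *m L *m M0) + th (v k) *: (M0 *m L *m en k)) +
   ((xn k)^t* *m S (wn k) *m M0 + M0 *m S (wn k) *m xn k +
    (xn k)^t* *m S (v k) *m xn k).
have c1 : ccvg F (fun k => ri k * ri k * (et k)%:C *
     ntr (L *m ((M k)^t* *m M k)) + ntr (L *m Y k))
   (0 * ntr (L *m (M0^t* *m M0)) +
    ntr (L *m ((th V *: (e^t* *m L *m M0) + th V *: (M0 *m L *m e)) +
    ((t *: V)^t* *m S w *m M0 + M0 *m S w *m (t *: V) +
     (t *: V)^t* *m L *m (t *: V))))).
  apply: ccvgD.
    apply: ccvgM crie2 _; apply: (ccvg_ntr n0); apply: mcvgM (mcvg_cst _) _.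
    by exact: mcvgM (mcvg_adj cM) cM.
  apply: (ccvg_ntr n0); apply: mcvgM (mcvg_cst _) _; apply: mcvgD.
    apply: mcvgD; apply: mcvgZ (cth cv) _.
      by apply: mcvgM (mcvg_cst _); apply: mcvgM (mcvg_adj ce) (mcvg_cst _).
    by apply: mcvgM ce; exact: mcvg_cst.
  apply: mcvgD.
    apply: mcvgD.
      by apply: mcvgM (mcvg_cst _); apply: mcvgM (mcvg_adj cx) (cS cw).
    by apply: mcvgM cx; apply: mcvgM (mcvg_cst _) (cS cw).
  by apply: mcvgM cx; apply: mcvgM (mcvg_adj cx) (cS cv).
move: c1; rewrite mul0r add0r (vcoordV hS hF) !scale1r => c1.
apply: ccvg_unique c1 _; apply: ccvg_ext (ccvg_cst 0); near=> k.
have gen a x B D E P Z1 T :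
  (a * a) *: (x *: (P *m L *m M0) + x *: (M0 *m L *m E) +
    (B *m Z1 *m M0 + M0 *m Z1 *m D + B *m T *m D)) =
  x *: (((a * a) *: P) *m L *m M0) + x *: (M0 *m L *m ((a * a) *: E)) +
   ((a *: B) *m (a *: Z1) *m M0 + M0 *m (a *: Z1) *m (a *: D) +
    (a *: B) *m T *m (a *: D)).
  rewrite !scalerDr -!scalemxAl -!scalemxAr -!scalemxAl !scalerA.
  by rewrite ![x * _]mulrC.
pose Z := th (v k) *: (rest ((Dl k)^t*) *m L *m M0) +
  th (v k) *: (M0 *m L *m rest (Dl k)) +
  ((Dl k)^t* *m S (rest (v k)) *m M0 + M0 *m S (rest (v k)) *m Dl k +
   (Dl k)^t* *m S (v k) *m Dl k).
have eZ : quad S M0 ((Dl k)^t*) (v k) (Dl k) =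
    (th (v k) * th ((Dl k)^t*)) *: (V *m L *m M0) +
    (th (v k) * th (Dl k)) *: (M0 *m L *m V) + Z := quad_decomp hS M0 V _ _ _.
have eY : Y k = (ri k * ri k) *: Z.
  have e1 : (en k)^t* = (ri k * ri k) *: rest ((Dl k)^t*).
    by rewrite adjZ conjCM !ri_conj (vrest_adj hS hF).
  have e2 : S (wn k) = ri k *: S (rest (v k)) := emZ hS _ _.
  by rewrite /Y /Z gen e1 e2 xnJ.
move: Z eZ eY => Z eZ eY.
have hk : (et k)%:C * ntr (L *m ((M k)^t* *m M k)) + ntr (L *m Z) = 0.
  have := coord_identity hS hF (ev k).
  have -> : M0 + (Dl k)^t* = (M k)^t* by rewrite adjB hM addrC subrK.
  rewrite [M0 + Dl k]addrC subrK eZ !(mulmxDr L) !ntrD -!(scalemxAr _ L) !ntrZ.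
  by rewrite sigma_l sigma_r sigma0 !mulr0 !add0r.
rewrite eY.
by rewrite -scalemxAr ntrZ -mulrA -mulrDr hk mulr0.
Unshelve. all: by end_near. Qed.

(** [E = e / t ^ 2] is the solution to which the non-degeneracy of the cubic
    coefficient applies. *)
Lemma degenerate_absurd : False.
Proof.
have [w cw] := exists_w.
have := second_order_v cw; rewrite (w_lim cw) e_adj adjZ tJ (psd_herm (ef_psd hF)).
have -> : S ((2 / t) *: e) = (2 / t) *: S e by exact: (emZ hS).
move=> /(cubic_sum (ef_fix hF) t_neq0 e_eq) ab0.
have [D [U [f hpol]]] : exists D U f, balanced_polar M0 V D U f.
  apply: (balanced_polar_exists (H := M0) (y := 0) pV hM); last exact: mde_unit e0.
  have -> : 0 +i* 0 = 0 :> R[i] by [].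
  by rewrite scale0r addr0.
have t20 : t ^+ 2 != 0 by rewrite expf_eq0.
pose E := (t ^- 2) *: e.
have eE : E - M0 *m S E *m M0 = M0 *m L *m V.
  by rewrite KZ -scalerBr e_eq scalerA mulVf // scale1r.
have := cubic_coefficient_neq0 n0 hS hpol pV hM (ef_fix hF) eE.
have -> : S E = (t ^- 2) *: S e by exact: (emZ hS).
by rewrite -!scalemxAr -scalemxAl !ntrZ -mulrDr ab0 mulr0 eqxx.
Qed.

End Degenerate.

Lemma sigma_abs_of_limits : cabs sigma = h.
Proof.
have Ret : complex.Re t = 0.
  move/eqP: first_order_v; rewrite mulf_eq0 => /orP[|/eqP s0]; last first.
    by case: (degenerate_absurd s0).
  move=> /eqP /(congr1 (@complex.Re R)); rewrite ReD ReJ /=; lra.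
have eo : o = - (t ^+ 2 * sigma).
  by apply/eqP; rewrite -addr_eq0 first_order.
have t2 : cabs t ^+ 2 = complex.Im t ^+ 2.
  by rewrite sqr_cabs_ReIm Ret expr0n add0r.
have It0 : complex.Im t ^+ 2 != 0.
  rewrite -t2 expf_eq0 /=; apply: contra_neq t_neq0; exact: cabs_eq0.
have := omega_limit; rewrite eo cabsN cabsM expr2 cabsM -expr2 t2 mulrC.
exact: (mulIf It0).
Qed.

End Limits.

(** The rescaled quantities are bounded, so that their limits exist along the
    ultrafilter. *)
Lemma sigma_abs : cabs sigma = h.
Proof.
have [e ce] := exists_e; have [t ct] := exists_theta; have [q cq] := exists_o.
exact: sigma_abs_of_limits ce ct cq.
Qed.

End SigmaValue.

(** * Continuity of the solution and continuation in half discs *)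

Section UltrafilterCriterion.
Context {R : realType} {I : Type} (F : set_system I) {FF : Filter F}.

Lemma cvg_of_ultra (u : I -> R) (l : R) :
  (forall G, UltraFilter G -> F `<=` G -> u i @[i --> G] --> l) ->
  u i @[i --> F] --> l.
Proof.
move=> h B Bl; apply: contrapT => nB.
pose D : set I := ~` (u @^-1` B).
have PD : ProperFilter (within D F).
  apply: Build_ProperFilter => w0; apply: nB.
  rewrite /within /= in w0; rewrite /fmap /=.
  by apply: filterS w0 => i DA; apply: contrapT.
have [G [GU sG]] := ultraFilterLemma PD.
have FG : F `<=` G.
  by move=> A FA; apply: sG; apply: filterS FA => i Ai _.
have GD : G D by apply: sG; apply: nearW.
have GB : G (u @^-1` B) := h G GU FG B Bl.
have PG : ProperFilter G by exact: ultra_proper.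
have : G (D `&` u @^-1` B) by exact: filterI.
have -> : D `&` u @^-1` B = set0 by rewrite /D setICl.
exact: filter_not_empty.
Qed.

End UltrafilterCriterion.

Section DysonContinuity.
Context {R : realType}.
Variables (n : nat) (S : 'M[R[i]]_n -> 'M[R[i]]_n) (c C : R).
Hypothesis n0 : (0 < n)%N.
Hypothesis hS : energy_map S c C.
Variable A : 'M[R[i]]_n.
Hypothesis hA : A^t* = A.

Section MdeLimit.
Context {I : Type} (F : set_system I) {FF : ProperFilter F}.
Variables (z : I -> R[i]) (X : I -> 'M[R[i]]_n) (z0 : R[i]) (X0 : 'M[R[i]]_n).
Hypothesis eX : \forall k \near F, mde_eq S A (z k) (X k).
Hypothesis cz : ccvg F z z0.
Hypothesis cX : mcvg F X X0.

Lemma mcvg_energy (Y : I -> 'M[R[i]]_n) Y0 : mcvg F Y Y0 ->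
  mcvg F (fun k => S (Y k)) (S Y0).
Proof.
by apply: (mcvg_linear (C := 4 * C) _ (em_norm hS n0)) => Y1 Y2; exact: (emB hS).
Qed.

Lemma mde_eq_limit : mde_eq S A z0 X0.
Proof.
have c1 : mcvg F (fun k => (A - (z k)%:M - S (X k)) *m X k)
   ((A - z0%:M - S X0) *m X0).
  apply: mcvgM cX; apply: mcvgB (mcvg_energy cX); apply: mcvgB (mcvg_cst _) _.
  exact: mcvg_scalar.
apply: mcvg_unique c1 _; apply: mcvg_ext (mcvg_cst 1%:M).
by apply: filterS eX => k ->.
Qed.

Lemma mcvg_ImM : mcvg F (fun k => ImM (X k)) (ImM X0).
Proof.
have -> : (fun k => ImM (X k)) =
   (fun k => (- (0 +i* 1) * (2^-1)%:C) *: (X k - (X k)^t*)).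
  by apply/funext => k; rewrite ImME.
by rewrite ImME; apply: mcvgZ (ccvg_cst _) _; apply: mcvgB cX _; exact: mcvg_adj.
Qed.

End MdeLimit.

Variable M : R[i] -> 'M[R[i]]_n.
Hypothesis hM : is_MDE_solution A S M.
Variables (tau w0 k0 : R).
Hypothesis hgreen : forall z, upper_half z -> `|complex.Re z - tau| <= w0 ->
  complex.Im z <= 1 -> mnorm (M z) <= k0.

Lemma M_mde z : upper_half z -> mde_eq S A z (M z).
Proof. by move=> /hM [/solves_mde_eq [h _] _]. Qed.

Lemma M_posdef z : upper_half z -> posdef (ImM (M z)).
Proof. by move=> /hM [/solves_mde_eq [_ h] _]. Qed.

Lemma M_rtr_gt0 z : upper_half z -> 0 < rtr (ImM (M z)).
Proof.
move=> hz; have pM := M_posdef hz.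
have [a a0 ha] := psd_unit_lb (posdef_psd pM) (posdef_unit pM).
by apply: lt_le_trans (rtr_mono ha); rewrite rtr_scalar.
Qed.

(** Positive semidefiniteness of the imaginary part is enough to select the
    solution, since the equation for this part makes it definite. *)
Lemma M_unique z X : upper_half z -> mde_eq S A z X -> psdm (ImM X) -> M z = X.
Proof.
move=> hz eX pX; have [_ uni] := hM hz; apply: uni.
apply/solves_mde_eq; split=> //.
have [a a0 ha] := unit_gram_lb (mde_unit eX).
apply: (@posdef_of_ge _ _ _ (complex.Im z * a)); first by rewrite mulr_gt0.
rewrite [X in _ <<= X](mde_ImMl hS hA eX) mulmxDr mulmxDl.
rewrite mul_mx_scalar -scalemxAl.
apply: (loewner_trans (B := (complex.Im z)%:C *: (X^t* *m X))).
  by have := psdZ (ltW hz) ha; rewrite scalerBr scale_scalar_mx -rmorphM.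
by rewrite addrAC subrr add0r; exact: psd_congr (em_psd hS pX).
Qed.

(** A bounded family of solutions can only accumulate at solutions, hence,
    by uniqueness, at the solution. *)
Lemma M_continuous (I : Type) (F : set_system I) {FF : ProperFilter F}
    (FU : UltraFilter F) (z : I -> R[i]) z0 :
  upper_half z0 -> ccvg F z z0 ->
  (\forall k \near F, [/\ upper_half (z k), `|complex.Re (z k) - tau| <= w0 &
     complex.Im (z k) <= 1]) ->
  mcvg F (fun k => M (z k)) (M z0).
Proof.
move=> hz0 cz hz.
have [X cX] : exists X, mcvg F (fun k => M (z k)) X.
  apply: (@ultra_mcvg _ _ _ _ _ FU _ k0).
  by apply: filterS hz => k [h1 h2 h3]; exact: hgreen.
have eX : mde_eq S A z0 X.
  by apply: mde_eq_limit cz cX; apply: filterS hz => k [h1 _ _]; exact: M_mde.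
suff -> : M z0 = X by [].
apply: M_unique eX _ => //.
apply: mcvg_psd (mcvg_ImM cX) _; apply: filterS hz => k [h1 _ _].
exact/posdef_psd/M_posdef.
Qed.

Definition half_disc (d : R) (z : R[i]) : Prop :=
  upper_half z /\ cabs (z - tau%:C) < d.

Lemma half_disc_strip d z : d <= w0 -> d <= 1 -> half_disc d z ->
  [/\ upper_half z, `|complex.Re z - tau| <= w0 & complex.Im z <= 1].
Proof.
move=> dw d1 [hz hd]; split=> //.
  have := Re_le_cabs (z - tau%:C); rewrite ReD ReN /= => h.
  exact: le_trans h (le_trans (ltW hd) dw).
have := le_trans (ler_norm _) (Im_le_cabs (z - tau%:C)).
rewrite ImD ImN /= subr0 => h.
exact: le_trans h (le_trans (ltW hd) d1).
Qed.

(** On the segment from the base point to a point violating the bound, the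
    distance to [M0] would take the value [3 / 4 * eps] by continuity, which the
    self-improvement excludes. *)
Lemma half_disc_continuation d (M0 : 'M[R[i]]_n) (eps : R) :
  d <= w0 -> d <= 1 -> 0 < eps ->
  (forall z, half_disc d z -> mnorm (M z - M0) <= eps ->
     mnorm (M z - M0) <= eps / 2) ->
  (exists2 z, half_disc d z & mnorm (M z - M0) <= eps) ->
  forall z, half_disc d z -> mnorm (M z - M0) <= eps.
Proof.
move=> dw d1 eps0 improve [zb hzb Mb] z hz; apply: contrapT => /negP.
rewrite -ltNge => big.
pose p (t : R) : R[i] := (1 - t)%:C * zb + t%:C * z.
have hp t : `[0, 1]%classic t -> half_disc d (p t).
  rewrite /= in_itv /= => /andP[t0 t1].
  have [[hzb1 hzb2] [hz1 hz2]] := (hzb, hz).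
  have s0 : 0 <= 1 - t by rewrite subr_ge0.
  split.
    rewrite /upper_half ImD !ImMr.
    have [->|tn0] := eqVneq t 0; first by rewrite subr0 mul1r mul0r addr0.
    apply: ltr_wpDl; first exact: mulr_ge0 s0 (ltW hzb1).
    by apply: mulr_gt0 => //; rewrite lt0r tn0.
  have -> : p t - tau%:C = (1 - t)%:C * (zb - tau%:C) + t%:C * (z - tau%:C).
    by rewrite /p rmorphB rmorph1; ring.
  apply: le_lt_trans (cabsD _ _) _; rewrite !cabsM !cabs_real !ger0_norm //.
  have -> : d = (1 - t) * d + t * d by ring.
  have [->|tn0] := eqVneq t 0.
    by rewrite subr0 !mul1r !mul0r !addr0.
  have tp : 0 < t by rewrite lt0r tn0.
  by apply: ler_ltD; [rewrite ler_wpM2l // ltW | rewrite ltr_pM2l].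
pose g (t : R) := mnorm (M (p t) - M0).
have cg : {within `[0, 1], continuous g}.
  apply/subspace_continuousP => t ht; apply: cvg_of_ultra => G GU sG.
  have Gin : G [set s | `[0, 1]%classic s].
    by apply: sG; apply: nearW.
  have ct : s @[s --> G] --> t.
    apply: cvg_trans sG _; exact: cvg_within.
  apply: mcvg_norm; apply: mcvgB (mcvg_cst _).
  apply: M_continuous => //; first by case: (hp t ht).
    apply: ccvgD; apply: ccvgM (ccvg_cst _); apply: ccvg_real => //.
    by apply: cvgB ct; exact: cvg_cst.
  by apply: filterS Gin => s /hp; exact: half_disc_strip.
have g0 : g 0 <= eps by rewrite /g /p subr0 mul1r mul0r addr0.
have g1 : eps < g 1 by rewrite /g /p subrr mul0r mul1r add0r.
have g0' : g 0 <= eps / 2.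
  by apply: improve g0; apply: hp; rewrite /= in_itv /= lexx ler01.
have v1 : eps / 2 < 3 / 4 * eps by lra.
have v2 : 3 / 4 * eps < eps by lra.
have [|s s01 gs] := @IVT R g 0 1 (3 / 4 * eps) ler01 cg.
  rewrite ge_min le_max (le_trans g0' (ltW v1)) /=.
  by rewrite (ltW (lt_trans v2 g1)) orbT.
have hs : half_disc d (p s) by apply: hp.
have := improve _ hs; rewrite -/(g s) gs => /(_ (ltW v2)).
by rewrite leNgt v1.
Qed.

End DysonContinuity.

(** * The density near a bulk point *)

Section Density.
Context {R : realType}.

Lemma lipschitz_cvg_at_right (f : R -> R) (K d : R) : 0 < d ->
  (forall s t, 0 < s < d -> 0 < t < d -> `|f s - f t| <= K * `|s - t|) ->
  exists l : R, f t @[t --> 0^'+] --> l.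
Proof.
move=> d0 hf; exists (lim (f t @[t --> 0^'+])).
suff : cvg (f t @[t --> 0^'+]) by [].
apply: cauchy_cvg; apply: cauchy_exP => e e0.
pose s := Num.min (d / 2) (e / (2 * (`|K| + 1))).
have K1 : 0 < `|K| + 1 by rewrite ltr_wpDl.
have s0 : 0 < s by rewrite lt_min !divr_gt0 // mulr_gt0.
have sd : s < d.
  apply: (@le_lt_trans _ _ (d / 2)); first by rewrite ge_min lexx.
  lra.
exists (f s).
suff h : \forall t \near (0 : R)^'+, `|f s - f t| < e by exact: h.
near=> t.
have t0 : 0 < t by near: t; apply: nbhs_right_gt.
have ts : t < s by near: t; apply: nbhs_right_lt.
apply: le_lt_trans (hf s t _ _) _; rewrite ?s0 ?t0 ?sd ?(lt_trans ts sd) //.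
apply: (@le_lt_trans _ _ ((`|K| + 1) * s)).
  have h1 : K <= `|K| + 1 by have := ler_norm K; lra.
  apply: (le_trans (ler_wpM2r (normr_ge0 _) h1)).
  rewrite ler_pM2l // ger0_norm; lra.
apply: (@le_lt_trans _ _ ((`|K| + 1) * (e / (2 * (`|K| + 1))))).
  by rewrite ler_pM2l // ge_min lexx orbT.
have -> : (`|K| + 1) * (e / (2 * (`|K| + 1))) = e / 2 by field; rewrite gt_eqF.
lra.
Unshelve. all: by end_near. Qed.

Variable n : nat.
Implicit Types (M : R[i] -> 'M[R[i]]_n).

Lemma scdosHE M z : scdosH M z = rtr (ImM (M z)) / pi.
Proof. by rewrite rtr_ImM. Qed.

Lemma rtr_ImM_dist (n0 : (0 < n)%N) (X Y : 'M[R[i]]_n) :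
  `|rtr (ImM X) - rtr (ImM Y)| <= mnorm (X - Y).
Proof.
rewrite !rtr_ImM -ImN -ImD -ntrB.
exact: le_trans (Im_le_cabs _) (cabs_ntr n0 _).
Qed.

Lemma scdosH_dist (n0 : (0 < n)%N) M z1 z2 :
  `|scdosH M z1 - scdosH M z2| <= mnorm (M z1 - M z2) / pi.
Proof.
rewrite !scdosHE -mulrBl normrM [X in _ * X]ger0_norm ?invr_ge0 ?pi_ge0 //.
by rewrite ler_wpM2r ?invr_ge0 ?pi_ge0 // rtr_ImM_dist.
Qed.

Lemma scdos_lim M tau (l : R) :
  scdosH M (tau +i* eta) @[eta --> 0^'+] --> l -> scdos M tau = l.
Proof. by move=> h; rewrite /scdos; apply: cvg_lim. Qed.

(** [lim] is zero where there is no limit, so that a nonzero density is a true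
    limit. *)
Lemma scdos_cvg M tau : scdos M tau != 0 ->
  scdosH M (tau +i* eta) @[eta --> 0^'+] --> scdos M tau.
Proof.
move=> h.
have [l hl] : exists l : R, scdosH M (tau +i* eta) @[eta --> 0^'+] --> l.
  apply: contrapT => hn; move/eqP: h; apply.
  rewrite /scdos /lim /lim_in; apply: etrans (xgetPN _ _) _; last by [].
  by move=> l hl; apply: hn; exists l.
by rewrite (scdos_lim hl).
Qed.

End Density.

Section Bulk.
Context {R : realType}.
Variables (n : nat) (S : 'M[R[i]]_n -> 'M[R[i]]_n) (c C : R).
Hypothesis n0 : (0 < n)%N.
Hypothesis hS : energy_map S c C.

(** By compactness of the unit sphere. *)
Lemma stability_of_injective (M0 : 'M[R[i]]_n) :
  (forall X, X = M0 *m S X *m M0 -> X = 0) ->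
  exists2 B : R, 0 < B & forall X, mnorm X <= B * mnorm (X - M0 *m S X *m M0).
Proof.
move=> inj; apply: contrapT => hn.
have hk (k : nat) : exists X, mnorm X = 1 /\
    mnorm (X - M0 *m S X *m M0) <= k.+1%:R^-1.
  apply: contrapT => nk; apply: hn; exists k.+1%:R => // X.
  rewrite leNgt; apply/negP => hX; apply: nk.
  have m0 : 0 < mnorm X by apply: le_lt_trans hX; rewrite mulr_ge0 ?mnorm_ge0.
  pose Y := ((mnorm X)^-1)%:C *: X; exists Y.
  have ci : cabs ((mnorm X)^-1)%:C = (mnorm X)^-1.
    by rewrite cabs_real ger0_norm // invr_ge0 mnorm_ge0.
  split; first by rewrite mnormZ ci mulVf ?gt_eqF.
  rewrite /Y (emZ hS) -scalemxAr -scalemxAl -scalerBr mnormZ ci.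
  by rewrite mulrC ler_pdivrMr // ler_pdivlMl ?ltr0n // ltW.
have /choice[X hX] := hk.
have [G [GU sG]] := @ultraFilterLemma nat \oo _.
have PG : ProperFilter G by exact: ultra_proper.
have [X0 cX] : exists X0, mcvg G X X0.
  apply: (@ultra_mcvg _ _ _ _ _ GU _ 1).
  by apply: nearW => k; rewrite (hX k).1.
have n1 : mnorm X0 = 1.
  apply: cvgr_unique (mcvg_norm cX) _.
  have -> : (fun k => mnorm (X k)) = fun=> 1 by apply/funext => k; rewrite (hX k).1.
  exact: cvg_cst.
have c0 : mcvg G (fun k => X k - M0 *m S (X k) *m M0) 0.
  apply: (@squeeze0 _ _ _ _ _ (fun k => k.+1%:R^-1)).
    by apply: nearW => k; rewrite mnorm_ge0 subr0 (hX k).2.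
  exact: cvg_trans (cvg_app _ sG) (@cvg_harmonic R).
have c1 : mcvg G (fun k => X k - M0 *m S (X k) *m M0) (X0 - M0 *m S X0 *m M0).
  apply: (mcvgB cX); apply: mcvgM (mcvg_cst _); apply: mcvgM (mcvg_cst _) _.
  exact: (mcvg_energy n0 hS cX).
have e0 : X0 - M0 *m S X0 *m M0 = 0 by exact: (mcvg_unique c1 c0).
have X00 := inj _ (subr0_eq e0).
by move/eqP: n1; rewrite X00 mnorm0 eq_sym oner_eq0.
Qed.

Variable A : 'M[R[i]]_n.
Hypothesis hA : A^t* = A.
Variable M : R[i] -> 'M[R[i]]_n.
Hypothesis hM : is_MDE_solution A S M.
Variables (tau w0 k0 : R).
Hypothesis w00 : 0 < w0.
Hypothesis k00 : 0 < k0.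
Hypothesis hgreen : forall z, upper_half z -> `|complex.Re z - tau| <= w0 ->
  complex.Im z <= 1 -> mnorm (M z) <= k0.

Lemma strip_above : \forall eta \near 0^'+,
  [/\ upper_half (tau +i* eta), `|complex.Re (tau +i* eta) - tau| <= w0 &
     complex.Im (tau +i* eta) <= 1].
Proof.
near=> eta; split => /=.
- by rewrite /upper_half /=; near: eta; exact: nbhs_right_gt.
- by rewrite subrr normr0 ltW.
- by near: eta; apply: nbhs_right_le.
Unshelve. all: by end_near. Qed.

Lemma ccvg_above (G : set_system R) {PG : ProperFilter G} : 0^'+ `<=` G ->
  ccvg G (fun eta => tau +i* eta) tau%:C.
Proof.
move=> sG; apply: ccvg_ReIm => /=; first exact: cvg_cst.
by apply: cvg_trans sG _; apply: cvg_at_right_filter; exact: cvg_id.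
Qed.

(** At a limit [M0] of [M] above [tau] the imaginary part is positive, the
    linearisation is injective and hence stable, so that [M] stays close to [M0]
    and is Lipschitz in a half disc. The density therefore extends to the real
    axis, with values close to the nonzero one at [tau]. *)
Lemma bulk_open : scdos M tau != 0 ->
  exists2 e : R, 0 < e & forall t, `|t - tau| < e -> scdos M t != 0.
Proof.
move=> rho_neq0; have crho := scdos_cvg rho_neq0.
have [G [GU sG]] := @ultraFilterLemma R (0 : R)^'+ _.
have PG : ProperFilter G by exact: ultra_proper.
have Gstrip := sG _ strip_above.
have [M0 cM] : exists M0, mcvg G (fun eta => M (tau +i* eta)) M0.
  apply: (@ultra_mcvg _ _ _ _ _ GU _ k0).
  by apply: filterS Gstrip => eta [h1 h2 h3]; exact: hgreen.
have M0k : mnorm M0 <= k0.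
  apply: mcvg_norm_le cM _.
  by apply: filterS Gstrip => eta [h1 h2 h3]; exact: hgreen.
have eM0 : mde_eq S A tau%:C M0.
  apply: (mde_eq_limit n0 hS _ (ccvg_above sG) cM).
  by apply: filterS Gstrip => eta [h1 _ _]; exact: M_mde.
pose V := ImM M0.
have cIm : mcvg G (fun eta => ImM (M (tau +i* eta))) V by exact: mcvg_ImM cM.
have pV : psdm V.
  apply: (mcvg_psd cIm); apply: filterS Gstrip => eta [h1 _ _].
  exact/posdef_psd/(M_posdef hM).
pose r0 := rtr V.
have r0E : r0 = pi * scdos M tau.
  have c1 : rtr (ImM (M (tau +i* eta))) @[eta --> G] --> r0.
    exact: ccvg_Re (ccvg_ntr n0 cIm).
  apply: cvgr_unique c1 _.
  have c2 : pi * scdosH M (tau +i* eta) @[eta --> G] --> pi * scdos M tau.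
    by apply: cvgMr; exact: cvg_trans (cvg_app _ sG) crho.
  move: c2; suff -> : (fun eta => pi * scdosH M (tau +i* eta)) =
    (fun eta => rtr (ImM (M (tau +i* eta)))) by [].
  apply/funext => eta; rewrite scdosHE mulrC divfK // gt_eqF //; exact: pi_gt0.
have r00 : 0 < r0.
  have r0n : r0 != 0 by rewrite r0E mulf_neq0 // gt_eqF // pi_gt0.
  by rewrite lt0r r0n psd_rtr.
have fixV : V = M0 *m S V *m M0^t*.
  by have := mde_ImMr hS hA eM0; rewrite raddf0 add0r.
have uM0 := mde_unit eM0.
have pdV : posdef V.
  have uM0a : M0^t* \in unitmx by rewrite unitmx_adj.
  have [a a0 ha] := unit_gram_lb uM0a; rewrite adjK in ha.
  apply: (@posdef_of_ge _ _ _ (c * r0 * a)).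
    by rewrite !mulr_gt0 // (em_gt0 hS).
  have cr : 0 <= c * r0 by rewrite mulr_ge0 ?ltW // (em_gt0 hS).
  apply: (loewner_trans (B := (c * r0)%:C *: (M0 *m M0^t*))).
    by have := psdZ cr ha; rewrite scalerBr scale_scalar_mx -rmorphM.
  have := psd_congrV M0 (em_lb hS pV); rewrite mulmxBr mulmxBl -fixV.
  by rewrite mul_mx_scalar -scalemxAl.
have [D [U [f hpol]]] : exists D U f, balanced_polar M0 V D U f.
  apply: (balanced_polar_exists (H := ReMx M0) (y := 1) pdV) uM0.
    exact: selfadj_ReMx.
  exact: ReIm_mx.
have [B B0 stab] := @stability_of_injective M0
  (fun X => bulk_injective n0 hS hpol pdV fixV erefl).
have C0 := em_Cgt0 hS.
pose q := B * (4 * C) * k0.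
have q0 : 0 < q by rewrite !mulr_gt0.
pose eps := (4 * q)^-1.
have eps0 : 0 < eps by rewrite invr_gt0 mulr_gt0.
pose L := 2 * B * k0 ^+ 2.
have L0 : 0 < L by rewrite !mulr_gt0 // exprn_gt0.
have SB X : mnorm (S X) <= 4 * C * mnorm X by exact: (em_norm hS n0).
have local z : upper_half z -> mnorm (M z) <= k0 -> mnorm (M z - M0) <= eps ->
    mnorm (M z - M0) <= L * cabs (z - tau%:C).
  move=> hz hk he; have := two_point_sym hS (M_mde hM hz) eM0.
  set X := M z - M0 in he *; move=> eX.
  have e1 : X - M0 *m S X *m M0 = (z - tau%:C) *: (M0 *m M z) + M0 *m S X *m X.
    rewrite [X in X - _]eX mulmxDr mul_mx_scalar mulmxDl -scalemxAl.
    by rewrite -addrA -mulmxBr.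
  have := stab X; rewrite e1.
  have h1 : mnorm ((z - tau%:C) *: (M0 *m M z)) <= cabs (z - tau%:C) * (k0 * k0).
    by rewrite mnormZ ler_wpM2l ?cabs_ge0 // mnormM_le.
  have h2 : mnorm (M0 *m S X *m X) <= k0 * (4 * C * mnorm X) * eps.
    by apply: mnormM_le => //; apply: mnormM_le.
  have := le_trans (mnormD _ _) (lerD h1 h2) => /(ler_wpM2l (ltW B0)) h3.
  move=> /le_trans /(_ h3).
  have -> : B * (cabs (z - tau%:C) * (k0 * k0) + k0 * (4 * C * mnorm X) * eps) =
    L * cabs (z - tau%:C) / 2 + q * eps * mnorm X.
    by rewrite /L /q; field.
  have -> : q * eps = 4^-1 by rewrite /eps invfM mulrCA divff ?mulr1 // gt_eqF.
  have := mnorm_ge0 X; have := mulr_ge0 (ltW L0) (cabs_ge0 (z - tau%:C)).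
  by move: (mnorm X) (L * _) => x y; lra.
pose d := Num.min (Num.min w0 1) (Num.min (eps / (2 * L)) (r0 / (2 * L))).
have d0 : 0 < d by rewrite !lt_min w00 ltr01 !divr_gt0 // mulr_gt0.
have [dw d1 de dr] : [/\ d <= w0, d <= 1, d <= eps / (2 * L) & d <= r0 / (2 * L)].
  by rewrite /d !ge_min !lexx ?orbT.
have strip z : half_disc tau d z -> upper_half z /\ mnorm (M z) <= k0.
  move=> /(half_disc_strip dw d1) [h1 h2 h3]; split=> //; exact: hgreen.
have near_M0 z : half_disc tau d z -> mnorm (M z - M0) <= eps.
  apply: (half_disc_continuation n0 hS hA hM hgreen dw d1 eps0).
    move=> z1 hz1 he; have [h1 h2] := strip _ hz1.
    apply: le_trans (local _ h1 h2 he) _; rewrite mulrC -ler_pdivlMr //.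
    apply: le_trans (ltW hz1.2) (le_trans de _).
    by rewrite invfM mulrA.
  have [eta [heta1 heta2]] : exists eta, mnorm (M (tau +i* eta) - M0) <= eps /\
      half_disc tau d (tau +i* eta).
    have g1 : \forall eta \near G, mnorm (M (tau +i* eta) - M0) <= eps.
      by have /cvgr_le := cM; apply.
    have g2 : \forall eta \near G, half_disc tau d (tau +i* eta).
      apply: sG; near=> eta; split.
        by rewrite /upper_half /=; near: eta; exact: nbhs_right_gt.
      have -> : tau +i* eta - tau%:C = 0 +i* eta by apply: eqC => /=; ring.
      rewrite cabs.unlock /= expr0n add0r sqrtr_sqr ger0_norm.
        by near: eta; exact: nbhs_right_lt.
      by rewrite ltW //; near: eta; exact: nbhs_right_gt.
    have [eta [h1 h2]] := @filter_ex _ G _ _ (filterI g1 g2).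
    by exists eta.
  by exists (tau +i* eta).
pose e := d / 2; have e0 : 0 < e by rewrite divr_gt0.
have disc t eta : `|t - tau| < e -> 0 < eta < e -> half_disc tau d (t +i* eta).
  move=> ht /andP[h1 h2]; split=> //=.
  apply: le_lt_trans (cabs_le_ReIm _) _; rewrite /= subr0 (ger0_norm (ltW h1)).
  by move: ht h2; rewrite /e; move: `|_| => x; lra.
exists e => // t ht.
have two z1 z2 : half_disc tau d z1 -> half_disc tau d z2 ->
    mnorm (M z1 - M z2) <= L * cabs (z1 - z2).
  move=> hz1 hz2; have [u1 m1] := strip _ hz1; have [u2 m2] := strip _ hz2.
  have := two_point_sym hS (M_mde hM u1) (M_mde hM u2).
  set X := M z1 - M z2 => eX.
  have e1 : X - M0 *m S X *m M0 = (z1 - z2) *: (M z2 *m M z1) +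
     ((M z2 - M0) *m S X *m M z1 + M0 *m S X *m (M z1 - M0)).
    rewrite [X in X - _]eX mulmxDr mul_mx_scalar mulmxDl -scalemxAl.
    by rewrite -addrA; congr (_ + _); rewrite !mulmxBl mulmxBr; mxlin.
  have := stab X; rewrite e1.
  have h1 : mnorm ((z1 - z2) *: (M z2 *m M z1)) <= cabs (z1 - z2) * (k0 * k0).
    by rewrite mnormZ ler_wpM2l ?cabs_ge0 // mnormM_le.
  have h2 : mnorm ((M z2 - M0) *m S X *m M z1) <= eps * (4 * C * mnorm X) * k0.
    by apply: mnormM_le => //; apply: mnormM_le => //; exact: near_M0.
  have h3 : mnorm (M0 *m S X *m (M z1 - M0)) <= k0 * (4 * C * mnorm X) * eps.
    by apply: mnormM_le; [apply: mnormM_le | exact: near_M0].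
  have h23 := le_trans (mnormD _ _) (lerD h2 h3).
  have := le_trans (mnormD _ _) (lerD h1 h23) => /(ler_wpM2l (ltW B0)) h4.
  move=> /le_trans /(_ h4).
  have -> : B * (cabs (z1 - z2) * (k0 * k0) +
     (eps * (4 * C * mnorm X) * k0 + k0 * (4 * C * mnorm X) * eps)) =
    L * cabs (z1 - z2) / 2 + 2 * (q * eps) * mnorm X.
    by rewrite /L /q; field.
  have -> : q * eps = 4^-1 by rewrite /eps invfM mulrCA divff ?mulr1 // gt_eqF.
  by move: (mnorm X) (L * _) => x y; lra.
have lip s1 s2 : 0 < s1 < e -> 0 < s2 < e ->
   `|scdosH M (t +i* s1) - scdosH M (t +i* s2)| <= L / pi * `|s1 - s2|.
  move=> hs1 hs2; have := two _ _ (disc t s1 ht hs1) (disc t s2 ht hs2).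
  have -> : t +i* s1 - (t +i* s2) = 0 +i* (s1 - s2) by apply: eqC => /=; ring.
  rewrite cabs.unlock /= expr0n add0r sqrtr_sqr => h.
  apply: le_trans (scdosH_dist n0 _ _ _) _; rewrite [leRHS]mulrAC.
  by rewrite ler_pM2r ?invr_gt0 ?pi_gt0.
have [l hl] := lipschitz_cvg_at_right e0 lip.
rewrite (scdos_lim hl).
suff : 0 < l by move/gt_eqF ->.
apply: (@lt_le_trans _ _ (r0 / 2 / pi)); first by rewrite !divr_gt0 ?pi_gt0.
apply: cvg_ge hl _; near=> s.
have hz : half_disc tau d (t +i* s).
  apply: disc => //; apply/andP; split; near: s.
    exact: nbhs_right_gt.
  exact: nbhs_right_lt.
have [hu hk] := strip _ hz.
have h1 := local _ hu hk (near_M0 _ hz).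
have h2 : L * cabs (t +i* s - tau%:C) <= r0 / 2.
  apply: (@le_trans _ _ (L * (r0 / (2 * L)))).
    by rewrite ler_pM2l //; exact: le_trans (ltW hz.2) dr.
  rewrite [X in X <= _](_ : _ = r0 / 2) //.
  by move: L0 => /gt_eqF L0n; field; rewrite L0n.
rewrite scdosHE ler_pM2r; last by rewrite invr_gt0 pi_gt0.
have h3 := le_trans (rtr_ImM_dist n0 (M (t +i* s)) M0) (le_trans h1 h2).
move: h3; rewrite -/V -/r0 ler_norml => /andP[h4 _].
by move: h4; move: (rtr _) (r0) => x y; lra.
Unshelve. all: by end_near. Qed.

End Bulk.

(** * The edge as a limit of spectral parameters *)

Section EdgeBase.
Context {R : realType}.
Variables (n : nat) (S : 'M[R[i]]_n -> 'M[R[i]]_n) (c C : R).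
Hypothesis n0 : (0 < n)%N.
Hypothesis hS : energy_map S c C.
Variable A : 'M[R[i]]_n.
Hypothesis hA : A^t* = A.
Variable M : R[i] -> 'M[R[i]]_n.
Hypothesis hM : is_MDE_solution A S M.
Variables (tau w0 k0 : R).
Hypothesis w00 : 0 < w0.
Hypothesis k00 : 0 < k0.
Hypothesis hgreen : forall z, upper_half z -> `|complex.Re z - tau| <= w0 ->
  complex.Im z <= 1 -> mnorm (M z) <= k0.

(** Points of nonzero density accumulate at [tau]. If [tau] itself is one of
    them, then a whole neighbourhood is. *)
Lemma edge_not_isolated (e : R) : 0 < e -> bdry (supp (scdos M)) tau ->
  exists t, 0 < `|t - tau| < e /\ scdos M t != 0.
Proof.
move=> e0 [clo _]; have e20 : 0 < e / 2 by rewrite divr_gt0.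
have [t [ht htn]] : exists t, `|t - tau| < e /\ scdos M t != 0.
  have [s [hs1 hs2]] := clo _ (nbhsx_ballx tau (e / 2) e20).
  have [t [ht1 ht2]] := hs1 _ (nbhsx_ballx s (e / 2) e20).
  exists t; split=> //; move: hs2 ht2; rewrite /ball /= => h1 h2.
  by have := ler_normD (tau - s) (s - t); rewrite subrKA distrC; lra.
have [tt|tn] := eqVneq t tau; last by exists t; rewrite ht normr_gt0 subr_eq0 tn.
rewrite tt in htn.
have [e1 e10 h1] := bulk_open n0 hS hA hM w00 k00 hgreen htn.
pose m := Num.min e e1; have m0 : 0 < m by rewrite lt_min e0.
have [me me1] : m <= e /\ m <= e1 by rewrite /m !ge_min !lexx orbT.
exists (tau + m / 2); have -> : tau + m / 2 - tau = m / 2 by ring.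
rewrite ger0_norm; last by rewrite divr_ge0 // ltW.
split; first by apply/andP; split; lra.
apply: h1; have -> : tau + m / 2 - tau = m / 2 by ring.
by rewrite ger0_norm; lra.
Qed.

Variables (cE CE : R).
Hypothesis cE0 : 0 < cE.

(** The imaginary part is chosen after the real part, so small that it does not
    influence any limit. *)
Lemma edge_approach (gamma e : R) : bdry (supp (scdos M)) tau ->
  scdos M t / Num.sqrt `|t - tau| @[t --> within (supp (scdos M)) tau^'] -->
    gamma `^ (3 / 2) / pi -> 0 < e ->
  exists z : R[i], let x := `|complex.Re z - tau| in
    [/\ 0 < x <= e, 0 < complex.Im z <= e * x ^+ 2 &
      `|rtr (ImM (M z)) / Num.sqrt x - gamma `^ (3 / 2)| <= pi * e].
Proof.
move=> hb hlim e0; pose g := gamma `^ (3 / 2) / pi.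
have e20 : 0 < e / 2 by rewrite divr_gt0.
have /cvgrPdist_lt /(_ _ e20) := hlim.
rewrite /within /= => /nbhs_ballP[e1 e10 h1].
have [t [/andP[t0 te] tn]] : exists t, 0 < `|t - tau| < Num.min e e1 /\
    scdos M t != 0 by apply: edge_not_isolated; rewrite ?lt_min ?e0.
move: te; rewrite lt_min => /andP[te te1].
have tt : t != tau by rewrite -subr_eq0 -normr_gt0.
have h2 : `|g - scdos M t / Num.sqrt `|t - tau| | < e / 2.
  by apply: h1 => //; [rewrite /ball /= distrC | exact: subset_closure].
pose x := `|t - tau|; have sx0 : 0 < Num.sqrt x by rewrite sqrtr_gt0.
have e3 : 0 < e / 2 * Num.sqrt x by rewrite mulr_gt0.
have /cvgrPdist_lt /(_ _ e3) h3 := scdos_cvg tn.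
have ex0 : 0 < e * x ^+ 2 by rewrite mulr_gt0 // exprn_gt0.
have [eta [[eta0 eta1] eta2]] : exists eta : R, (0 < eta /\ eta <= e * x ^+ 2) /\
    `|scdos M t - scdosH M (t +i* eta)| < e / 2 * Num.sqrt x.
  apply: (@filter_ex _ (0 : R)^'+); apply: filterI h3; apply: filterI.
    exact: nbhs_right_gt.
  by apply: filterS (nbhs_right_lt ex0) => y /ltW.
exists (t +i* eta) => /=; split; rewrite -/x; first by rewrite t0 ltW.
  by rewrite eta0.
have -> : rtr (ImM (M (t +i* eta))) / Num.sqrt x - gamma `^ (3 / 2) =
    pi * (scdosH M (t +i* eta) / Num.sqrt x - g).
  rewrite scdosHE /g; move: (rtr _) (Num.sqrt x) sx0 (_ `^ _) => a s s0 y.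
  have := pi_gt0 R; move: (pi) => p p0; field.
  by rewrite !lt0r_neq0.
rewrite normrM ger0_norm ?pi_ge0 // ler_wpM2l ?pi_ge0 //.
have h4 : `|scdosH M (t +i* eta) / Num.sqrt x - scdos M t / Num.sqrt x| < e / 2.
  rewrite -mulrBl normrM [X in _ * X]ger0_norm ?invr_ge0 ?sqrtr_ge0 //.
  by rewrite ltr_pdivrMr // distrC.
have := ler_normD (scdosH M (t +i* eta) / Num.sqrt x - scdos M t / Num.sqrt x)
  (scdos M t / Num.sqrt x - g); rewrite subrKA => h5.
rewrite distrC in h2; apply: le_trans h5 _.
by rewrite [leRHS]splitr lerD // ltW.
Qed.

Lemma powR_three_halves (gamma : R) : 0 < gamma ->
  (gamma `^ (3 / 2)) ^+ 2 = gamma ^+ 3.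
Proof.
move=> g0; rewrite -powR_mulrn ?powR_ge0 // -powRrM divfK //.
by rewrite powR_mulrn // ltW.
Qed.

(** A bound for [M0] and its inverse [A - tau - S(M0)]. It contains a bound for
    [tau], which follows from the Dyson equation as [M0] cannot be small. *)
Definition base_const (Ce : R) : R := k0 + 2 * Ce + 9 * C * k0.

Variable Ce : R.
Hypothesis hCe : mnorm A <= Ce.

Section FromLimit.
Context {I : Type} (F : set_system I) {FF : ProperFilter F}.
Hypothesis FU : UltraFilter F.
Variables (z : I -> R[i]) (M0 : 'M[R[i]]_n).
Let rho k := rtr (ImM (M (z k))).
Hypothesis hz : forall k, upper_half (z k).
Hypothesis hk : forall k, mnorm (M (z k)) <= k0.
Hypothesis cz : ccvg F z tau%:C.
Hypothesis cM : mcvg F (fun k => M (z k)) M0.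
Hypothesis crho : rho k @[k --> F] --> 0.
Hypothesis ceta : complex.Im (z k) / rho k @[k --> F] --> 0.

Let v k := ((rho k)^-1)%:C *: ImM (M (z k)).

(* Limits along spectral parameters for which both [rho] and [eta / rho] tend to
   zero. *)
Lemma limit_mde : mde_eq S A tau%:C M0.
Proof.
apply: (mde_eq_limit n0 hS _ cz cM).
by apply: nearW => k; exact: M_mde.
Qed.

Let rho_gt0 k : 0 < rho k. Proof. exact: (M_rtr_gt0 n0 hM). Qed.

Let v_psd k : psdm (v k).
Proof.
by apply: psdZ; [rewrite invr_ge0 ltW | exact/posdef_psd/(M_posdef hM)].
Qed.

Let v_rtr k : rtr (v k) = 1.
Proof. by rewrite rtrZ mulVf // gt_eqF. Qed.

Let v_eq k : v k = (M (z k))^t* *m ((complex.Im (z k) / rho k)%:C%:M + S (v k)) *m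
  M (z k).
Proof.
rewrite /v {1}(mde_ImMl hS hA (M_mde hM (hz k))) (emZ hS).
rewrite mulrC rmorphM -scale_scalar_mx -scalerDr -scalemxAr -scalemxAl.
by [].
Qed.

Let v_bounded : \forall k \near F, mnorm (v k) <= k0 * (1 + C) * k0.
Proof.
have /cvgr_le/(_ 1 ltr01) := ceta; apply: filterS => k h1.
have h0 : 0 <= complex.Im (z k) / rho k by rewrite divr_ge0 // ltW // hz.
have C0 := em_Cgt0 hS.
rewrite v_eq; apply: mnormM_le => //; apply: mnormM_le; rewrite ?mnorm_adj //.
apply: le_trans (mnormD _ _) _; apply: lerD.
  apply: le_trans (mnorm_scalar_le _ _) _; first by rewrite cabs_real ger0_norm.
by have := em_psd_norm hS (v_psd k); rewrite v_rtr mulr1.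
Qed.

(** [V] is the limit of the normalised imaginary parts; its equation
    [V = M0 S(V) M0] is what remains of [Im M = M^* (eta + S(Im M)) M], and
    [M0] is self-adjoint because [rho] tends to zero. *)
Lemma edge_frame_limit : exists2 V : 'M[R[i]]_n, mcvg F v V &
  edge_frame S M0 V (edge_const c C (base_const Ce)) /\ posdef V.
Proof.
have C0 := em_Cgt0 hS.
have [V cV] := ultra_mcvg FU v_bounded; exists V => //.
have pV : psdm V by apply: (mcvg_psd cV); apply: nearW.
have V1 : ntr V = 1.
  apply: (ccvg_unique (ccvg_ntr n0 cV)).
  apply: ccvg_ext (ccvg_cst _); apply: nearW => k.
  by rewrite (ntr_herm (psd_herm (v_psd k))) v_rtr.
have hM0 : M0^t* = M0.
  have cI : mcvg F (fun k => ImM (M (z k))) (ImM M0) by exact: mcvg_ImM.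
  have cI0 : mcvg F (fun k => (rho k)%:C *: v k) (0%:C *: V).
    exact: mcvgZ (ccvg_real crho) cV.
  have I0 : ImM M0 = 0.
    apply: (mcvg_unique cI); move: cI0; rewrite scale0r; apply: mcvg_ext.
    apply: nearW => k; rewrite /v scalerA -rmorphM mulfV ?gt_eqF //.
    by rewrite scale1r.
  have eM := ReIm_mx M0; rewrite I0 scaler0 addr0 in eM.
  by rewrite eM selfadj_ReMx.
have fixV : V = M0 *m S V *m M0.
  apply: (mcvg_unique cV).
  have -> : M0 *m S V *m M0 = M0^t* *m (0%:C%:M + S V) *m M0.
    by rewrite hM0 raddf0 add0r.
  apply: (@mcvg_ext _ _ _ _ _ (fun k => (M (z k))^t* *m
     ((complex.Im (z k) / rho k)%:C%:M + S (v k)) *m M (z k))).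
    by apply: nearW => k; rewrite -v_eq.
  apply: mcvgM cM; apply: mcvgM; first exact: mcvg_adj.
  apply: mcvgD; last exact: (mcvg_energy n0 hS cV).
  by apply: mcvg_scalar; exact: ccvg_real.
have M0k : mnorm M0 <= k0 by apply: (mcvg_norm_le cM); apply: nearW.
have eM0 := limit_mde.
have m1 : 1 <= C * mnorm M0 ^+ 2.
  have <- : rtr V = 1 by rewrite /rtr V1.
  apply: le_trans (ler_norm _) _; apply: le_trans (rtr_le_mnorm n0 V) _.
  rewrite [X in mnorm X]fixV expr2 mulrA.
  apply: mnormM_le => //; rewrite mulrC; apply: mnormM_le => //.
  by have := em_psd_norm hS pV; rewrite /rtr V1 mulr1.
have m0 : 0 < mnorm M0.
  rewrite lt0r mnorm_ge0 andbT; apply: contraTneq m1 => ->.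
  by rewrite expr0n mulr0 -ltNge ltr01.
have SM : mnorm (S M0) <= 4 * C * k0.
  apply: le_trans (em_norm hS n0 _) _; rewrite ler_pM2l // mulr_gt0 //.
have Ce0 : 0 <= Ce by exact: le_trans (mnorm_ge0 _) hCe.
have tau_le : `|tau| <= Ce + 5 * C * k0.
  have e1 : tau%:C *: M0 = (A - S M0) *m M0 - 1%:M.
    rewrite -[X in _ - X]eM0 -mulmxBl.
    have -> : A - S M0 - (A - tau%:C%:M - S M0) = tau%:C%:M by mxlin.
    by rewrite mul_scalar_mx.
  have h1 : `|tau| * mnorm M0 <= (Ce + 4 * C * k0) * mnorm M0 + 1.
    rewrite -cabs_real -mnormZ e1; apply: le_trans (mnormB _ _) _.
    apply: lerD; last exact: mnorm1_le.
    apply: mnormM_le => //; apply: le_trans (mnormB _ _) _; exact: lerD.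
  rewrite -(ler_pM2r m0); apply: le_trans h1 _.
  have h2 : 1 <= C * k0 * mnorm M0.
    apply: le_trans m1 _; rewrite expr2 mulrA.
    by rewrite ler_pM2r // ler_pM2l.
  by move: h2; move: (mnorm M0) => m; lra.
have kb0 : 0 < base_const Ce.
  rewrite /base_const; have := mulr_gt0 C0 k00; lra.
have kb : k0 <= base_const Ce.
  rewrite /base_const; have := mulr_gt0 C0 k00; lra.
apply: (edge_frame_of n0 hS kb0 hM0 fixV pV V1 _ eM0).
  exact: le_trans M0k kb.
apply: le_trans (mnormB _ _) _.
have h1 := mnormB A tau%:C%:M.
have h2 : mnorm (tau%:C%:M : 'M[R[i]]_n) <= `|tau|.
  by apply: le_trans (mnorm_scalar_le _ _) _; rewrite cabs_real.
rewrite /base_const.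
move: SM h1 h2 tau_le hCe; move: (mnorm _) (mnorm _) (mnorm _) (mnorm _) => a b d e.
by have := mulr_gt0 C0 k00; lra.
Qed.

End FromLimit.

(** The square root law enters here only through [rho / sqrt x], whose limit is
    [gamma ^ (3 / 2)]: it fixes the modulus of [sigma]. *)
Lemma edge_base : regular_edge (scdos M) cE CE tau ->
  exists M0 V, exists2 gamma : R, cE <= gamma <= CE &
  [/\ mde_eq S A tau%:C M0,
      edge_frame S M0 V (edge_const c C (base_const Ce)),
      cabs (edge_sigma S M0 V) = gamma ^- 3 &
      forall eps d : R, 0 < eps -> 0 < d ->
        exists2 z, half_disc tau d z & mnorm (M z - M0) <= eps].
Proof.
move=> [hb [gamma [g1 g2 hlim]]].
have g0 : 0 < gamma by apply: lt_le_trans g1.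
pose e (k : nat) : R := Num.min w0 k.+1%:R^-1.
have e0 k : 0 < e k by rewrite lt_min w00 invr_gt0 ltr0n.
have ek k : e k <= w0 /\ e k <= k.+1%:R^-1 by rewrite /e !ge_min !lexx orbT.
have e1 k : e k <= 1.
  by apply: le_trans (ek k).2 _; rewrite invf_le1 ?ltr0n // ler1n.
have /choice[z hz] := fun k => edge_approach hb hlim (e0 k).
have [G [GU sG]] := @ultraFilterLemma nat \oo _.
have PG : ProperFilter G by exact: ultra_proper.
have ce : e k @[k --> G] --> 0.
  apply: (@squeeze0 _ _ _ _ _ (fun k => k.+1%:R^-1)).
    by apply: nearW => k; rewrite (ek k).2 andbT ltW.
  exact: cvg_trans (cvg_app _ sG) (@cvg_harmonic R).
pose x k := `|complex.Re (z k) - tau|.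
pose rho k := rtr (ImM (M (z k))).
pose q k := rho k / Num.sqrt (x k).
pose Ga : R := gamma `^ (3 / 2).
have Ga0 : 0 < Ga by rewrite powR_gt0.
have x0 k : 0 < x k by have [/andP[]] := hz k.
have xe k : x k <= e k by have [/andP[]] := hz k.
have x1 k : x k <= 1 by exact: le_trans (xe k) (e1 k).
have eta0 k : upper_half (z k) by have [_ /andP[]] := hz k.
have etax k : complex.Im (z k) <= e k * x k ^+ 2 by have [_ /andP[]] := hz k.
have strip k : upper_half (z k) /\ mnorm (M (z k)) <= k0.
  split=> //; apply: hgreen => //; first exact: le_trans (xe k) (ek k).1.
  apply: le_trans (etax k) _.
  by apply: mulr_ile1; rewrite ?exprn_ge0 ?exprn_ile1 ?e1 // ltW.
have sx0 k : 0 < Num.sqrt (x k) by rewrite sqrtr_gt0.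
have sx1 k : Num.sqrt (x k) <= 1 by rewrite -sqrtr1 ler_sqrt ?ltr01.
have sxx k : x k = Num.sqrt (x k) ^+ 2 by rewrite sqr_sqrtr // ltW.
have cq : q k @[k --> G] --> Ga.
  apply/cvg_distP; apply: (@squeeze0 _ _ _ _ _ (fun k => pi * e k)).
    by apply: nearW => k; rewrite normr_ge0; have [_ _] := hz k.
  by rewrite -(mulr0 (pi : R)); exact: cvgMr.
have cx : x k @[k --> G] --> 0.
  by apply: squeeze0 ce; apply: nearW => k; rewrite xe ltW.
have csx : Num.sqrt (x k) @[k --> G] --> 0.
  rewrite -(sqrtr0 R); exact: (continuous_cvg _ (@sqrt_continuous R 0) cx).
have rhoE k : rho k = q k * Num.sqrt (x k) by rewrite /q divfK // gt_eqF.
have crho : rho k @[k --> G] --> 0.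
  have -> : rho = (fun k => q k * Num.sqrt (x k)) by apply/funext => k.
  by rewrite -(mulr0 Ga); exact: cvgM.
have rho0 k : 0 < rho k by exact: (M_rtr_gt0 n0 hM).
have q0 k : 0 < q k by rewrite divr_gt0.
have cqi : (q k)^-1 @[k --> G] --> Ga^-1 by apply: cvgV; rewrite ?gt_eqF.
have eta_sx m k : (m <= 4)%N ->
    0 <= complex.Im (z k) / Num.sqrt (x k) ^+ m <= e k.
  move=> m4; have p0 : 0 < Num.sqrt (x k) ^+ m by rewrite exprn_gt0.
  rewrite divr_ge0 ?(ltW p0) ?(ltW (eta0 k)) //= ler_pdivrMr //.
  apply: le_trans (etax k) _; rewrite ler_pM2l // [leLHS](_ : _ = Num.sqrt (x k) ^+ 4).
    by apply: ler_wiXn2l => //; rewrite ltW.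
  by rewrite (sxx k) -exprM; congr (_ ^+ _); rewrite -sxx.
have ceta m : (m <= 4)%N -> complex.Im (z k) / Num.sqrt (x k) ^+ m @[k --> G] --> 0.
  by move=> m4; apply: squeeze0 ce; apply: nearW => k; exact: eta_sx.
have ceta1 : complex.Im (z k) / rho k @[k --> G] --> 0.
  have -> : (fun k => complex.Im (z k) / rho k) =
     (fun k => complex.Im (z k) / Num.sqrt (x k) ^+ 1 * (q k)^-1).
    by apply/funext => k; rewrite rhoE expr1 invfM mulrCA mulrC.
  by rewrite -(mul0r (Ga^-1)); apply: cvgM cqi; exact: ceta.
have ceta3 : complex.Im (z k) / rho k ^+ 3 @[k --> G] --> 0.
  have -> : (fun k => complex.Im (z k) / rho k ^+ 3) =
     (fun k => complex.Im (z k) / Num.sqrt (x k) ^+ 3 * (q k)^-1 ^+ 3).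
    by apply/funext => k; rewrite rhoE exprMn invfM exprVn mulrCA mulrC.
  rewrite -(mul0r (Ga^-1 ^+ 3)); apply: cvgM; first exact: ceta.
  exact: (cvg_comp _ _ cqi (@exprn_continuous R 3 (Ga^-1))).
have com : cabs (z k - tau%:C) / x k @[k --> G] --> (1 : R).
  apply/cvg_distP.
  apply: (@squeeze0 _ _ _ _ _ (fun k => complex.Im (z k) / Num.sqrt (x k) ^+ 2)).
    apply: nearW => k; rewrite normr_ge0 -(sxx k) /=.
    have -> : cabs (z k - tau%:C) / x k - 1 = (cabs (z k - tau%:C) - x k) / x k.
      by field; rewrite gt_eqF.
    rewrite normrM [X in _ * X]ger0_norm; last by rewrite invr_ge0 ltW.
    rewrite ler_pM2r ?invr_gt0 //.
    have := cabs_le_ReIm (z k - tau%:C); have := Re_le_cabs (z k - tau%:C).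
    rewrite ReD ReN ImD ImN /= subr0 (ger0_norm (ltW (eta0 k))) -/(x k) => h1 h2.
    by rewrite ger0_norm; lra.
  exact: ceta.
have com2 : cabs (z k - tau%:C) / rho k ^+ 2 @[k --> G] --> gamma ^- 3.
  have -> : (fun k => cabs (z k - tau%:C) / rho k ^+ 2) =
     (fun k => cabs (z k - tau%:C) / x k * (q k)^-1 ^+ 2).
    by apply/funext => k; rewrite rhoE exprMn -sxx invfM exprVn mulrCA mulrC.
  rewrite -(powR_three_halves g0) -/Ga -exprVn -[X in _ --> X]mul1r.
  apply: cvgM com _; exact: (cvg_comp _ _ cqi (@exprn_continuous R 2 (Ga^-1))).
have [M0 cM] : exists M0, mcvg G (fun k => M (z k)) M0.
  by apply: (@ultra_mcvg _ _ _ _ _ GU _ k0); apply: nearW => k; exact: (strip k).2.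
have cz : ccvg G z tau%:C.
  apply: (@squeeze0 _ _ _ _ _ (fun k => x k + complex.Im (z k) / Num.sqrt (x k) ^+ 0)).
    apply: nearW => k; rewrite cabs_ge0 /= expr0 divr1.
    have := cabs_le_ReIm (z k - tau%:C).
    by rewrite ReD ReN ImD ImN /= subr0 (ger0_norm (ltW (eta0 k))) -/(x k).
  by apply: cvg0D cx _; exact: ceta.
have [V cV [hF pV]] := edge_frame_limit GU eta0 (fun k => (strip k).2) cz cM crho ceta1.
have e0M : mde_eq S A tau%:C M0 by exact: limit_mde eta0 cz cM.
exists M0, V, gamma; first by rewrite g1.
split=> //.
  apply: (sigma_abs GU n0 hS hA hF pV e0M _ _ _ cM cV ceta3 com2) => //.
    by move=> k; exact: M_mde.
  by rewrite invr_gt0 exprn_gt0.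
move=> eps d eps0 d0.
have g3 : \forall k \near G, mnorm (M (z k) - M0) <= eps.
  by have /cvgr_le := cM; apply.
have g4 : \forall k \near G, cabs (z k - tau%:C) < d.
  by have /cvgr_lt := cz; apply.
have [k [h1 h2]] := @filter_ex _ G _ _ (filterI g3 g4).
by exists (z k).
Qed.

End EdgeBase.

(** * A priori bounds near a regular edge *)

Section Scalar.
Context {R : realFieldType}.

(** Here [d] is the distance to the base point, [t] and [r] the sizes of its
    components, [w] that of the spectral parameter and [q] the error in the
    scalar equation; smallness of [d] makes the cubic error negligible. *)
Lemma quadratic_apriori (b B c d w t r q : R) : 1 <= b -> 1 <= B -> 1 <= c ->
  0 <= d -> 0 <= w <= 1 -> 0 <= t -> d * (32 * b ^+ 2 * B * c ^+ 2) <= 1 ->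
  r <= c * (w + d * d) -> d <= t * b + r -> t ^+ 2 <= B * (w + q) ->
  q <= c * (d * w + (r + d ^+ 2) * d) ->
  d ^+ 2 <= (32 * b ^+ 2 * B + 16 * c ^+ 2) * w /\
  q <= 2 * c ^+ 2 * (w * d + d ^+ 3).
Proof.
move=> b1 B1 c1 d0 /andP[w0 w1] t0 dE hr hd ht hq.
have cc : c <= c ^+ 2 by rewrite expr2 ler_peMr //; lra.
have c20 : 1 <= c ^+ 2 by lra.
have bb : 1 <= b ^+ 2 by rewrite exprn_ege1.
have bB : 1 <= b ^+ 2 * B by rewrite mulr_ege1.
set a := b ^+ 2 * B * c ^+ 2.
have ca : c ^+ 2 <= a by rewrite /a ler_peMl //; lra.
have da : d * a <= 32^-1.
  by move: dE; rewrite (_ : d * _ = 32 * (d * a)); [lra | rewrite /a; ring].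
have dc : d * c <= 32^-1.
  by apply: le_trans da; rewrite ler_wpM2l //; apply: le_trans cc ca.
have hq2 : q <= 2 * c ^+ 2 * (w * d + d ^+ 3).
  apply: le_trans hq _.
  have h1 : (r + d ^+ 2) * d <= (c * (w + d * d) + d ^+ 2) * d.
    by rewrite ler_wpM2r //; lra.
  have h2 : c * (d * w + (r + d ^+ 2) * d) <=
     c * (d * w + (c * (w + d * d) + d ^+ 2) * d).
    by rewrite ler_wpM2l //; lra.
  apply: le_trans h2 _.
  have h3 : 0 <= (c ^+ 2 - c) * (d * w) by rewrite mulr_ge0 ?mulr_ge0 // subr_ge0.
  have h4 : 0 <= (c ^+ 2 - c) * d ^+ 3 by rewrite mulr_ge0 ?exprn_ge0 // subr_ge0.
  lra.
split=> //.
have hd2 : d <= 2 * (t * b + c * w).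
  have : d * c * d <= 32^-1 * d by rewrite ler_wpM2r.
  by move: hd hr; rewrite -/(d * c * d); lra.
have tb0 : 0 <= t * b by rewrite mulr_ge0 //; lra.
have cw0 : 0 <= c * w by rewrite mulr_ge0 //; lra.
have h5 : d ^+ 2 <= 8 * ((t * b) ^+ 2 + (c * w) ^+ 2).
  have h : d ^+ 2 <= (2 * (t * b + c * w)) ^+ 2.
    by rewrite ler_pXn2r // nnegrE //; lra.
  apply: le_trans h _; have := sqr_ge0 (t * b - c * w); lra.
have h6 : (t * b) ^+ 2 <= b ^+ 2 * B * w + w / 16 + d ^+ 2 / 16.
  have h1 : (t * b) ^+ 2 <= b ^+ 2 * (B * (w + 2 * c ^+ 2 * (w * d + d ^+ 3))).
    rewrite exprMn mulrC ler_wpM2l ?sqr_ge0 //; apply: le_trans ht _.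
    by rewrite ler_wpM2l //; lra.
  apply: le_trans h1 _.
  have -> : b ^+ 2 * (B * (w + 2 * c ^+ 2 * (w * d + d ^+ 3))) =
    b ^+ 2 * B * w + 2 * (d * a * w) + 2 * (d * a * d ^+ 2) by rewrite /a; ring.
  have := ler_wpM2r w0 da; have := ler_wpM2r (sqr_ge0 d) da; lra.
have h7 : (c * w) ^+ 2 <= c ^+ 2 * w.
  rewrite exprMn ler_wpM2l ?sqr_ge0 // expr2 ler_piMr //.
have := ler_wpM2r w0 bB; lra.
Qed.

End Scalar.

(** [near_eps] is the distance below which the scalar equation gives
    [distance ^ 2 <= near_C3 * |omega|]; then [near_C4 * |omega|] bounds the
    transversal part, and [near_C5 * |omega| * distance] the error in the scalar
    equation, inside the half disc of radius [near_radius]. *)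
Definition near_eps {R : realType} (b B : R) : R :=
  (32 * b ^+ 2 * B * edge_c0 b ^+ 2)^-1.
HB.lock Definition near_C3 (R : realType) (b B : R) : R :=
  32 * b ^+ 2 * B + 16 * edge_c0 b ^+ 2.
HB.lock Definition near_C4 (R : realType) (b B : R) : R :=
  edge_c0 b * (1 + near_C3 b B).
HB.lock Definition near_C5 (R : realType) (b B : R) : R :=
  2 * edge_c0 b ^+ 2 * (1 + near_C3 b B).
Definition near_radius {R : realType} (b B w0 : R) : R :=
  Num.min (Num.min w0 1) (near_eps b B ^+ 2 / (4 * near_C3 b B)).

Section NearEdge.
Context {R : realType}.
Variables (n : nat) (S : 'M[R[i]]_n -> 'M[R[i]]_n) (c C : R).
Hypothesis n0 : (0 < n)%N.
Hypothesis hS : energy_map S c C.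
Variable A : 'M[R[i]]_n.
Hypothesis hA : A^t* = A.
Variable M : R[i] -> 'M[R[i]]_n.
Hypothesis hM : is_MDE_solution A S M.
Variables (tau w0 k0 : R).
Hypothesis w00 : 0 < w0.
Hypothesis hgreen : forall z, upper_half z -> `|complex.Re z - tau| <= w0 ->
  complex.Im z <= 1 -> mnorm (M z) <= k0.
Variables (M0 V : 'M[R[i]]_n) (b B s : R).
Hypothesis e0 : mde_eq S A tau%:C M0.
Hypothesis hF : edge_frame S M0 V b.
Hypothesis B1 : 1 <= B.
Hypothesis sE : edge_sigma S M0 V = s%:C.
Hypothesis sB : B^-1 <= `|s| <= B.
Hypothesis hbase : forall eps d : R, 0 < eps -> 0 < d ->
  exists2 z, half_disc tau d z & mnorm (M z - M0) <= eps.

Local Notation th := (vcoord S V).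
Local Notation rest := (vrest S V).
Local Notation c0 := (edge_c0 b).
Local Notation eps := (near_eps b B).
Local Notation C3 := (near_C3 b B).
Local Notation C4 := (near_C4 b B).
Local Notation C5 := (near_C5 b B).
Local Notation rad := (near_radius b B w0).
Local Notation Dl z := (M z - M0).

Lemma edge_c0_ge1 : 1 <= c0.
Proof.
have b1 := ef_b1 hF; rewrite edge_c0.unlock.
have : 1 <= b ^+ 6 by rewrite exprn_ege1.
lra.
Qed.
Let c1 : 1 <= c0. Proof. exact: edge_c0_ge1. Qed.
Let b1 : 1 <= b. Proof. exact: ef_b1 hF. Qed.
Let b0 : 0 < b. Proof. exact: lt_le_trans b1. Qed.
Let B0 : 0 < B. Proof. exact: lt_le_trans B1. Qed.
Let c00 : 0 < c0. Proof. exact: lt_le_trans c1. Qed.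

Lemma near_C3_ge1 : 1 <= C3.
Proof.
have h1 : 1 <= b ^+ 2 * B by rewrite mulr_ege1 // exprn_ege1.
have h2 := exprn_ege1 2 c1; rewrite near_C3.unlock -mulrA; lra.
Qed.
Let C31 : 1 <= C3. Proof. exact: near_C3_ge1. Qed.
Let C30 : 0 < C3. Proof. exact: lt_le_trans C31. Qed.

Lemma near_eps_gt0 : 0 < eps.
Proof.
by rewrite invr_gt0 !mulr_gt0 ?exprn_gt0.
Qed.
Let eps0 : 0 < eps. Proof. exact: near_eps_gt0. Qed.

Lemma near_eps_le1 : eps <= 1.
Proof.
rewrite invf_le1; last by rewrite -invr_gt0.
have h1 : 1 <= b ^+ 2 * B by rewrite mulr_ege1 // exprn_ege1.
have h2 : 1 <= b ^+ 2 * B * c0 ^+ 2 by rewrite mulr_ege1 // exprn_ege1.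
have -> : 32 * b ^+ 2 * B * c0 ^+ 2 = 32 * (b ^+ 2 * B * c0 ^+ 2) by ring.
by move: h2; move: (_ * c0 ^+ 2) => x; lra.
Qed.

Lemma near_radius_gt0 : 0 < rad.
Proof.
by rewrite !lt_min w00 ltr01 divr_gt0 ?exprn_gt0 ?mulr_gt0.
Qed.

Lemma near_radius_le : [/\ rad <= w0, rad <= 1 & C3 * rad <= (eps / 2) ^+ 2].
Proof.
rewrite {1 2}/near_radius !ge_min !lexx ?orbT; split=> //.
apply: (@le_trans _ _ (C3 * (eps ^+ 2 / (4 * C3)))).
  by rewrite ler_pM2l // ge_min lexx orbT.
rewrite le_eqVlt; apply/orP; left; apply/eqP; field.
exact: lt0r_neq0.
Qed.

Lemma vcoord0 : th 0 = 0.
Proof. by rewrite /vcoord mulmx0 /ntr mxtrace0 mul0r mulr0. Qed.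

Lemma vrest0 : rest 0 = 0.
Proof. by rewrite /vrest vcoord0 scale0r subr0. Qed.

Lemma sigma_scale (t : R) : 0 <= t -> t <= B * (t * `|s|).
Proof.
move=> t0; have /andP[h _] := sB; rewrite mulrCA ler_peMr //.
by rewrite -(ler_pM2l B0) mulfV ?gt_eqF // in h.
Qed.

(** As [sigma] is bounded below, the scalar equation bounds the square of the
    coordinate, and so the square of the whole distance, by a multiple of
    [|omega|]. *)
Lemma near_improve z : upper_half z -> cabs (z - tau%:C) <= 1 ->
  mnorm (Dl z) <= eps ->
  mnorm (Dl z) ^+ 2 <= C3 * cabs (z - tau%:C) /\
  [/\ mnorm (rest (Dl z)) <= C4 * cabs (z - tau%:C) &
      cabs (z - tau%:C + th (Dl z) ^+ 2 * s%:C) <=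
      C5 * (cabs (z - tau%:C) * mnorm (Dl z))].
Proof.
move=> hz w1 he; set w := cabs _ in w1 *; set d := mnorm (Dl z) in he *.
have d1 : d <= 1 by exact: le_trans he near_eps_le1.
have eD : Dl z = (M0 + 0) *m ((z - tau%:C)%:M + S (Dl z)) *m (M0 + Dl z).
  rewrite addr0 [M0 + _]addrC subrK; exact: (two_point_sym hS (M_mde hM hz) e0).
have d0 : 0 <= d by exact: mnorm_ge0.
have w0' : 0 <= w by exact: cabs_ge0.
have P0 : mnorm (0 : 'M[R[i]]_n) <= d by rewrite mnorm0.
have hr := rest_bound hS hF d1 P0 (lexx d) eD.
have hq := coord_bound n0 hS hF d1 P0 (lexx d) eD.
rewrite vcoord0 vrest0 mnorm0 !add0r -/w -/d -expr2 sE in hr hq.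
have hd : d <= cabs (th (Dl z)) * b + mnorm (rest (Dl z)).
  rewrite {1}/d {1}(vrest_decomp S V (Dl z)).
  apply: le_trans (mnormD _ _) _; rewrite lerD2r mnormZ.
  by rewrite ler_wpM2l ?cabs_ge0 // (ef_V hF).
set q := cabs (_ + _) in hq *; set t := cabs (th _) in hd *.
have ht : t ^+ 2 <= B * (w + q).
  apply: le_trans (sigma_scale _) _; first by rewrite sqr_ge0.
  rewrite ler_pM2l //.
  have -> : t ^+ 2 * `|s| = cabs (th (Dl z) ^+ 2 * s%:C).
    by rewrite cabsM cabs_real expr2 cabsM.
  have := cabsD (- (z - tau%:C)) (z - tau%:C + th (Dl z) ^+ 2 * s%:C).
  by rewrite addKr cabsN.
have dE : d * (32 * b ^+ 2 * B * c0 ^+ 2) <= 1.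
  have := he; rewrite /near_eps -[X in _ <= X]mul1r ler_pdivlMr //.
  by rewrite -invr_gt0.
have w01 : 0 <= w <= 1 by rewrite w0'.
have t0 : 0 <= t by exact: cabs_ge0.
have [h1 h2] := quadratic_apriori b1 B1 c1 d0 w01 t0 dE hr hd ht hq.
have h3 : d ^+ 2 <= C3 * w by rewrite near_C3.unlock.
split=> //; split.
  apply: le_trans hr _; rewrite near_C4.unlock -mulrA ler_pM2l // mulrDl mul1r.
  by rewrite lerD2l.
apply: le_trans h2 _.
have h4 : d ^+ 3 <= C3 * (w * d) by rewrite exprSr mulrA ler_wpM2r.
have -> : C5 * (w * d) = 2 * c0 ^+ 2 * (w * d + C3 * (w * d)).
  by rewrite near_C5.unlock; ring.
by rewrite ler_wpM2l ?lerD2l // mulr_ge0 ?sqr_ge0.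
Qed.

(** Within the chosen radius the a priori bound improves itself. *)
Lemma near_edge z : half_disc tau rad z ->
  [/\ mnorm (Dl z) <= eps, mnorm (Dl z) ^+ 2 <= C3 * cabs (z - tau%:C),
    mnorm (rest (Dl z)) <= C4 * cabs (z - tau%:C) &
    cabs (z - tau%:C + th (Dl z) ^+ 2 * s%:C) <=
      C5 * (cabs (z - tau%:C) * mnorm (Dl z))].
Proof.
have [rw r1 rC] := near_radius_le.
have w1 y : half_disc tau rad y -> cabs (y - tau%:C) <= 1.
  by move=> hy; exact: le_trans (ltW hy.2) r1.
move=> hz; suff he : mnorm (Dl z) <= eps.
  by have [h1 [h2 h3]] := near_improve hz.1 (w1 _ hz) he.
apply: (half_disc_continuation n0 hS hA hM hgreen rw r1 eps0 _ _ hz).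
  move=> y hy he; have [h1 _] := near_improve hy.1 (w1 _ hy) he.
  have e20 : 0 <= eps / 2 by rewrite divr_ge0 // ltW.
  rewrite -(@ler_pXn2r _ 2) ?nnegrE ?mnorm_ge0 //.
  apply: le_trans h1 _; apply: le_trans rC; rewrite ler_pM2l //.
  exact: ltW hy.2.
exact: hbase near_radius_gt0.
Qed.

End NearEdge.

(** * The density on the two sides of a regular edge *)

Section ScalarSides.
Context {R : realFieldType}.

(** Of the real and imaginary parts of a square root of [- u / s], the one
    allowed by the sign of [u s] is large. *)
Lemma sign_split (u p q s B x : R) : 0 <= p -> 0 <= q -> `|s| <= B ->
  `|u| = x ^+ 2 -> `|u + (p - q) * s| <= x ^+ 2 / 2 -> u * s < 0 ->
  x ^+ 2 <= 2 * B * p.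
Proof.
move=> p0 q0 sB ux; rewrite ler_norml => /andP[h1 h2] us.
have hp := ler_wpM2l p0 sB.
have [s0|s0|s0] := ltgtP s 0; last by rewrite s0 mulr0 ltxx in us.
  have u0 : 0 < u by rewrite -(ltr_nM2r s0) mul0r.
  have qs : 0 <= q * - s by rewrite mulr_ge0 // oppr_ge0 ltW.
  by rewrite (ltr0_norm s0) in hp; rewrite (gtr0_norm u0) in ux; lra.
have u0 : u < 0 by rewrite -(ltr_pM2r s0) mul0r.
have qs : 0 <= q * s by rewrite mulr_ge0 // ltW.
by rewrite (gtr0_norm s0) in hp; rewrite (ltr0_norm u0) in ux; lra.
Qed.

(** Here [t] is a coordinate multiplied by a coefficient [g s] of order [x],
    which dominates the errors, of order [x ^ 2]. *)
Lemma coordinate_dominates (b B c k r e t y g s x : R) :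
  1 <= B -> 0 <= c -> 0 <= k -> 0 <= e -> 0 <= t -> 0 <= x <= 1 ->
  c * r <= 2^-1 -> 8 * b * k * B ^+ 2 * x <= 1 -> 4 * c * k * x <= 1 ->
  y <= t * b + c * (e + r * y) -> 0 <= y ->
  x / B <= g -> B^-1 <= s -> t * g * s <= e + c * r * e + 2 * k * x ^+ 2 * y ->
  t * x <= 5 * B ^+ 2 * e /\ y <= 2 * (t * b + c * e).
Proof.
move=> B1 c0 k0 e0 t0 /andP[x0 x1] cr hb hc hy y0 hg hs h.
have hy2 : y <= 2 * (t * b + c * e).
  have : c * r * y <= 2^-1 * y by rewrite ler_wpM2r.
  by move: hy; rewrite mulrDr !mulrA; lra.
split=> //.
have B0 : 0 < B by lra.
have B20 : 0 < B ^+ 2 by rewrite exprn_gt0.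
have h1 : t * (x / B) * B^-1 <= t * g * s.
  apply: ler_pM => //; rewrite ?invr_ge0 ?mulr_ge0 ?invr_ge0 ?(ltW B0) //.
  by rewrite ler_wpM2l.
have kx0 : 0 <= 2 * k * x ^+ 2 by rewrite !mulr_ge0 ?exprn_ge0.
have h2 := ler_wpM2l kx0 hy2.
have h3 : c * r * e <= 2^-1 * e by rewrite ler_wpM2r.
have h4 : 4 * c * k * x * (x * e) <= x * e.
  by rewrite -[leRHS]mul1r ler_wpM2r // mulr_ge0.
have h5 : x * e <= e by rewrite ler_piMl.
have h6 : 8 * b * k * B ^+ 2 * x * (t * x) <= t * x.
  by rewrite -[leRHS]mul1r ler_wpM2r // mulr_ge0.
have h7 := le_trans h1 h.
have e1 : t * (x / B) * B^-1 * B ^+ 2 = t * x by field; rewrite gt_eqF.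
have := ler_wpM2r (ltW B20) h7; rewrite e1 => h8.
have h9 := ler_wpM2r (ltW B20) h2.
have h10 := ler_wpM2r (ltW B20) h3.
have h11 := ler_wpM2r (ltW B20) (le_trans h4 h5).
clear -h6 h8 h9 h10 h11; lra.
Qed.

End ScalarSides.

(** At the distance [x ^ 2] from the edge, the error of the scalar equation for
    [D] contains the norm of [D] with the coefficient [2 * near_K1 * x ^ 2];
    [near_slope] is the inverse of the largest admissible [x], and
    [near_error * x ^ 2] bounds [pi] times the error in the density. *)
HB.lock Definition near_K1 (R : realType) (b B : R) : R :=
  edge_c0 b * (2 * near_C4 b B + near_C3 b B).
Definition near_slope {R : realType} (b B : R) : R :=
  1 + 8 * near_C5 b B * near_C3 b B + 8 * b * near_K1 b B * B ^+ 2 +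
  4 * edge_c0 b * near_K1 b B.
Definition near_error {R : realType} (b B : R) : R :=
  B ^+ 2 * (1 + 4 * near_C5 b B * near_C3 b B) + 2 * near_C4 b B.

Section EdgeSides.
Context {R : realType}.
Variables (n : nat) (S : 'M[R[i]]_n -> 'M[R[i]]_n) (c C : R).
Hypothesis n0 : (0 < n)%N.
Hypothesis hS : energy_map S c C.
Variable A : 'M[R[i]]_n.
Hypothesis hA : A^t* = A.
Variable M : R[i] -> 'M[R[i]]_n.
Hypothesis hM : is_MDE_solution A S M.
Variables (tau w0 k0 : R).
Hypothesis w00 : 0 < w0.
Hypothesis hgreen : forall z, upper_half z -> `|complex.Re z - tau| <= w0 ->
  complex.Im z <= 1 -> mnorm (M z) <= k0.
Variables (M0 V : 'M[R[i]]_n) (b B s : R).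
Hypothesis e0 : mde_eq S A tau%:C M0.
Hypothesis hF : edge_frame S M0 V b.
Hypothesis B1 : 1 <= B.
Hypothesis sE : edge_sigma S M0 V = s%:C.
Hypothesis sB : B^-1 <= `|s| <= B.
Hypothesis hbase : forall eps d : R, 0 < eps -> 0 < d ->
  exists2 z, half_disc tau d z & mnorm (M z - M0) <= eps.

Local Notation th := (vcoord S V).
Local Notation rest := (vrest S V).
Local Notation c0 := (edge_c0 b).
Local Notation eps := (near_eps b B).
Local Notation C3 := (near_C3 b B).
Local Notation C4 := (near_C4 b B).
Local Notation C5 := (near_C5 b B).
Local Notation K1 := (near_K1 b B).
Local Notation rad := (near_radius b B w0).
Local Notation Dl z := (M z - M0).

Let b1 : 1 <= b. Proof. exact: ef_b1 hF. Qed.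
Let b0 : 0 < b. Proof. exact: lt_le_trans b1. Qed.
Let B0 : 0 < B. Proof. exact: lt_le_trans B1. Qed.
Let c1 : 1 <= c0. Proof. exact: edge_c0_ge1 hF. Qed.
Let c00 : 0 < c0. Proof. exact: lt_le_trans c1. Qed.
Let C31 : 1 <= C3. Proof. exact: near_C3_ge1 hF B1. Qed.
Let C30 : 0 < C3. Proof. exact: lt_le_trans C31. Qed.
Let C40 : 0 < C4.
Proof. by rewrite near_C4.unlock mulr_gt0 // ltr_wpDr // ltW. Qed.
Let C50 : 0 < C5.
Proof. by rewrite near_C5.unlock !mulr_gt0 // ?exprn_gt0 // ltr_wpDr // ltW. Qed.
Let K10 : 0 < K1.
Proof. by rewrite near_K1.unlock mulr_gt0 // addr_gt0 // mulr_gt0. Qed.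

Lemma near_slope_gt0 : 0 < near_slope b B.
Proof.
have h1 : 0 < 8 * C5 * C3 by rewrite !mulr_gt0.
have h2 : 0 < 8 * b * K1 * B ^+ 2 by rewrite !mulr_gt0 ?exprn_gt0.
have h3 : 0 < 4 * c0 * K1 by rewrite !mulr_gt0.
by rewrite /near_slope; do 3![apply: addr_gt0 => //].
Qed.

Lemma near_slope_le x : 0 <= x -> near_slope b B * x <= 1 ->
  [/\ x <= 1, 8 * C5 * C3 * x <= 1, 8 * b * K1 * B ^+ 2 * x <= 1 &
      4 * c0 * K1 * x <= 1].
Proof.
move=> x0; have -> : near_slope b B * x = x + 8 * C5 * C3 * x +
    8 * b * K1 * B ^+ 2 * x + 4 * c0 * K1 * x by rewrite /near_slope; ring.
have h1 : 0 <= 8 * C5 * C3 * x by rewrite !mulr_ge0 // ltW.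
have h2 : 0 <= 8 * b * K1 * B ^+ 2 * x by rewrite !mulr_ge0 ?exprn_ge0 // ltW.
have h3 : 0 <= 4 * c0 * K1 * x by rewrite !mulr_ge0 // ltW.
by move: (8 * C5 * C3 * x) (8 * b * K1 * B ^+ 2 * x) (4 * c0 * K1 * x) h1 h2 h3
  => p q r *; split; lra.
Qed.

Lemma near_eps_c0 r : r <= eps -> c0 * r <= 2^-1.
Proof.
move=> he; apply: (@le_trans _ _ (c0 * eps)); first by rewrite ler_pM2l.
rewrite ler_pdivrMr; last by rewrite !mulr_gt0 ?exprn_gt0.
have h : 1 <= b ^+ 2 * B * c0 by rewrite !mulr_ege1 ?exprn_ege1.
have := ler_wpM2r (ltW c00) h; rewrite mul1r.
have -> : 32 * b ^+ 2 * B * c0 ^+ 2 = 32 * (b ^+ 2 * B * c0 * c0) by ring.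
by move: c00; move: (c0) (_ * c0 * c0) => x y; lra.
Qed.

Lemma vcoord_real X : X^t* = X -> complex.Im (th X) = 0.
Proof.
move=> hX; have := congr1 (@complex.Im R) (vcoord_adj hS hF X).
by rewrite hX ImJ; lra.
Qed.

Lemma ImM_M0 : ImM M0 = 0.
Proof. by rewrite ImME (ef_M0adj hF) subrr scaler0. Qed.

Lemma rtr_ImM_Dl z : rtr (ImM (M z)) = complex.Im (ntr (Dl z)).
Proof.
have r0 : complex.Im (ntr M0) = 0.
  by rewrite -rtr_ImM ImM_M0 /rtr /ntr mxtrace0 mul0r.
by rewrite rtr_ImM ntrB ImD ImN r0 subr0.
Qed.

Lemma Im_vcoord_Dl z : complex.Im (th (Dl z)) = complex.Re (th (ImM (M z))).
Proof.
rewrite (vcoordD S V) vcoordN ImD ImN (vcoord_real (ef_M0adj hF)) subr0.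
rewrite {1}(ReIm_mx (M z)) vcoordD vcoordZ ImD.
rewrite (vcoord_real (selfadj_ReMx _)) add0r.
have := vcoord_real (selfadj_ImM (M z)).
by case: (th _) => p q /= ->; ring.
Qed.

(** The coordinate is positive on positive semidefinite matrices. *)
Lemma vcoord_Im_ge0 z : upper_half z -> 0 <= complex.Im (th (Dl z)).
Proof.
move=> hz; rewrite Im_vcoord_Dl; set rho := rtr (ImM (M z)).
have r0 : 0 < rho by exact: (M_rtr_gt0 n0 hM).
have eI : ImM (M z) = rho%:C *: ((rho^-1)%:C *: ImM (M z)).
  by rewrite scalerA -rmorphM mulfV ?gt_eqF // scale1r.
rewrite eI vcoordZ ReMr mulr_ge0 ?ltW //.
apply: lt_le_trans (ef_coord_psd hF _ _); first by rewrite invr_gt0.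
  by apply: psdZ; [rewrite invr_ge0 ltW | exact/posdef_psd/(M_posdef hM)].
by rewrite rtrZ mulVf ?gt_eqF.
Qed.

Section AtPoint.
Variables (u x : R).
Hypothesis x0 : 0 < x.
Hypothesis ux : `|u| = x ^+ 2.
Hypothesis xs : near_slope b B * x <= 1.
Hypothesis xr : 2 * x ^+ 2 < rad.

Let x1 : x <= 1. Proof. by have [] := near_slope_le (ltW x0) xs. Qed.
Let xC : 8 * C5 * C3 * x <= 1. Proof. by have [] := near_slope_le (ltW x0) xs. Qed.
Let x20 : 0 < x ^+ 2. Proof. by rewrite exprn_gt0. Qed.
Let x01 : 0 <= x <= 1. Proof. by rewrite (ltW x0) x1. Qed.

Local Notation pt eta := ((tau + u) +i* eta).

Lemma om_pt eta : pt eta - tau%:C = u +i* eta.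
Proof. by apply: eqC => /=; ring. Qed.

(* From here on, [x] is the square root of the distance [|u|] to the edge, and
   all bounds are in powers of [x]. *)
Lemma pt_bounds eta : 0 < eta <= x ^+ 2 ->
  [/\ half_disc tau rad (pt eta), mnorm (Dl (pt eta)) <= eps,
    mnorm (Dl (pt eta)) ^+ 2 <= 2 * C3 * x ^+ 2,
    mnorm (rest (Dl (pt eta))) <= 2 * C4 * x ^+ 2 &
    cabs (u +i* eta + th (Dl (pt eta)) ^+ 2 * s%:C) <= 4 * C5 * C3 * x ^+ 3].
Proof.
move=> /andP[eta0 etax].
have w2 : cabs (pt eta - tau%:C) <= 2 * x ^+ 2.
  rewrite om_pt; apply: le_trans (cabs_le_ReIm _) _.
  by rewrite /= ux (gtr0_norm eta0); move: etax; move: (x ^+ 2) => y; lra.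
have hz : half_disc tau rad (pt eta).
  by split=> //; exact: le_lt_trans w2 xr.
have [h1 h2 h3 h4] := near_edge n0 hS hA hM w00 hgreen e0 hF B1 sE sB hbase hz.
have d2 : mnorm (Dl (pt eta)) ^+ 2 <= 2 * C3 * x ^+ 2.
  apply: le_trans h2 _; rewrite [2 * _]mulrC -mulrA; by rewrite ler_pM2l.
have dx : mnorm (Dl (pt eta)) <= 2 * C3 * x.
  have p0 : 0 <= 2 * C3 * x by rewrite !mulr_ge0 // ltW.
  rewrite -(@ler_pXn2r _ 2) ?nnegrE ?mnorm_ge0 //; apply: le_trans d2 _.
  rewrite [leRHS]exprMn ler_pM2r // expr2 ler_peMr ?mulr_ge0 ?(ltW C30) //.
  by move: C31; move: (C3) => y; lra.
split=> //.
  by apply: le_trans h3 _; rewrite [2 * _]mulrC -mulrA ler_pM2l.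
rewrite om_pt in h4; apply: le_trans h4 _.
have -> : 4 * C5 * C3 * x ^+ 3 = C5 * (2 * x ^+ 2 * (2 * C3 * x)) by ring.
rewrite ler_pM2l //; apply: ler_pM; rewrite ?cabs_ge0 ?mnorm_ge0 //.
by rewrite -om_pt.
Qed.

Lemma pt_Re eta : 0 < eta <= x ^+ 2 -> let Th := th (Dl (pt eta)) in
  `|u + (complex.Re Th ^+ 2 - complex.Im Th ^+ 2) * s| <= x ^+ 2 / 2.
Proof.
move=> he /=; have [_ _ _ _ h] := pt_bounds he.
have := le_trans (Re_le_cabs _) h; rewrite ReD.
have -> : complex.Re (th (Dl (pt eta)) ^+ 2 * s%:C) =
  (complex.Re (th (Dl (pt eta))) ^+ 2 - complex.Im (th (Dl (pt eta))) ^+ 2) * s.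
  by case: (th _) => p q /=; ring.
move=> /le_trans; apply.
have := ler_wpM2r (ltW x20) xC.
by rewrite mul1r exprS; move: (x ^+ 2) => y; lra.
Qed.

Let half_x (p : R) : x ^+ 2 <= 2 * B * p ^+ 2 -> x / (2 * B) <= `|p|.
Proof.
move=> h; have B20 : 0 < 2 * B by rewrite mulr_gt0.
have B21 : 1 <= 2 * B by move: B1; lra.
rewrite -(@ler_pXn2r _ 2) ?nnegrE ?normr_ge0 ?divr_ge0 ?(ltW x0) ?(ltW B20) //.
rewrite real_normK ?num_real // exprMn exprVn ler_pdivrMr ?exprn_gt0 //.
apply: le_trans h _; rewrite mulrC ler_wpM2l ?sqr_ge0 // expr2 ler_peMr //.
exact: ltW.
Qed.

Let s_abs_le : `|s| <= B. Proof. by have /andP[] := sB. Qed.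

(** On this side of the edge the real part of the coordinate is at least of
    order [x]. In the scalar equation for the normalised imaginary part, it has
    to be balanced by [eta / rho]. *)
Lemma outside_bound eta : u * s < 0 -> 0 < eta <= x ^+ 2 ->
  rtr (ImM (M (pt eta))) * x <= 5 * B ^+ 2 * b * eta.
Proof.
move=> us he; have [hz deps d2 hr _] := pt_bounds he.
have hsplit := pt_Re he; move: hsplit => /= hsplit.
have /andP[eta0 _] := he.
set z := pt eta in hz deps d2 hr hsplit *.
set rho := rtr (ImM (M z)); have r0 : 0 < rho by exact: (M_rtr_gt0 n0 hM hz.1).
pose v := (rho^-1)%:C *: ImM (M z).
have pv : psdm v.
  apply: psdZ; [rewrite invr_ge0 ltW // | exact/posdef_psd/(M_posdef hM hz.1)].
have rv : rtr v = 1 by rewrite rtrZ mulVf // gt_eqF.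
pose e := eta / rho; have e_ge0 : 0 <= e by rewrite divr_ge0 // ltW.
set d := mnorm (Dl z) in deps d2.
have d1 : d <= 1 by exact: le_trans deps (near_eps_le1 hF B1).
have Pd : mnorm ((Dl z)^t*) <= d by rewrite mnorm_adj.
have eD : v = (M0 + (Dl z)^t*) *m ((e%:C)%:M + S v) *m (M0 + Dl z).
  have -> : M0 + (Dl z)^t* = (M z)^t* by rewrite adjB (ef_M0adj hF) addrC subrK.
  rewrite [M0 + Dl z]addrC subrK /v {1}(mde_ImMl hS hA (M_mde hM hz.1)) (emZ hS).
  by rewrite /e mulrC rmorphM -scale_scalar_mx -scalerDr -scalemxAr -scalemxAl.
have hrv := rest_bound hS hF d1 Pd (lexx d) eD.
have hq := coord_bound n0 hS hF d1 Pd (lexx d) eD.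
have ev : th v = (complex.Re (th v))%:C.
  by apply: eqC; rewrite //= (vcoord_real (psd_herm pv)).
have tb := ef_coord_psd hF pv rv.
set t := complex.Re (th v) in ev tb.
have t0 : 0 < t by apply: lt_le_trans tb; rewrite invr_gt0.
have ce : cabs e%:C = e by rewrite cabs_real ger0_norm.
rewrite (vcoord_adj hS hF) -(vrest_adj hS hF) mnorm_adj sE ev ce in hq.
set p := complex.Re (th (Dl z)) in hsplit.
have hp : x / (2 * B) <= `|p|.
  apply: half_x.
  exact: (sign_split (sqr_ge0 _) (sqr_ge0 _) s_abs_le ux hsplit us).
have hy : mnorm v <= t * b + c0 * (e + d * mnorm v).
  rewrite {1}(vrest_decomp S V v); apply: le_trans (mnormD _ _) _.
  apply: lerD; last by rewrite -ce.
  rewrite mnormZ ev cabs_real gtr0_norm // ler_pM2l //; exact: ef_V hF.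
have hlow : t * (2 * `|p|) * `|s| <= e + c0 * d * e + 2 * K1 * x ^+ 2 * mnorm v.
  have E1 : cabs (t%:C * ((th (Dl z))^* + th (Dl z)) * s%:C) = t * (2 * `|p|) * `|s|.
    have -> : (th (Dl z))^* + th (Dl z) = (2 * p)%:C.
      by rewrite /p; apply: eqC; rewrite ?ReD ?ImD ?ReJ ?ImJ /=; ring.
    rewrite !cabsM !cabs_real [`|2 * p|]normrM (gtr0_norm t0); congr (_ * (_ * _) * _).
    by rewrite ger0_norm.
  rewrite -E1; set Y := _ * s%:C in hq *.
  have := cabsD (- e%:C) (e%:C + Y); rewrite addKr cabsN ce => h.
  apply: le_trans h _; rewrite -[leRHS]addrA lerD2l; apply: le_trans hq _.
  rewrite mulrDr mulrA lerD2l mulrA ler_wpM2r ?mnorm_ge0 //.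
  have -> : 2 * K1 * x ^+ 2 = c0 * (2 * C4 * x ^+ 2 + 2 * C4 * x ^+ 2 + 2 * C3 * x ^+ 2).
    by rewrite near_K1.unlock; ring.
  by rewrite (ler_pM2l c00); exact: lerD (lerD hr hr) d2.
have hg : x / B <= 2 * `|p|.
  have -> : x / B = 2 * (x / (2 * B)) by field; rewrite gt_eqF.
  by rewrite ler_pM2l.
have [_ _ h8 h4] := near_slope_le (ltW x0) xs.
have /andP[sB1 _] := sB.
have [h _] := coordinate_dominates B1 (ltW c00) (ltW K10) e_ge0 (ltW t0) x01
  (near_eps_c0 deps) h8 h4 hy (mnorm_ge0 _) hg sB1 hlow.
have h9 : x / b <= t * x by rewrite mulrC ler_pM2r.
have h10 : x <= 5 * B ^+ 2 * e * b by rewrite -ler_pdivrMr //; exact: le_trans h.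
have := ler_wpM2l (ltW r0) h10.
have -> : rho * (5 * B ^+ 2 * e * b) = 5 * B ^+ 2 * b * eta.
  by rewrite /e; field; rewrite gt_eqF.
by [].
Qed.

Lemma inside_Im eta : 0 < u * s -> 0 < eta <= x ^+ 2 ->
  x / (2 * B) <= complex.Im (th (Dl (pt eta))).
Proof.
move=> us he; have hsplit := pt_Re he; move: hsplit => /= hsplit.
have [hz _ _ _ _] := pt_bounds he.
rewrite -(ger0_norm (vcoord_Im_ge0 hz.1)); apply: half_x.
have us' : - u * s < 0 by rewrite mulNr oppr_lt0.
have ux' : `|- u| = x ^+ 2 by rewrite normrN.
apply: (sign_split (sqr_ge0 _) (sqr_ge0 (complex.Re (th (Dl (pt eta)))))
  s_abs_le ux' _ us').
by rewrite -normrN opprD opprK -mulNr opprB.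
Qed.

(** The sum of the two coordinates is at least of order [x], because their
    imaginary parts are nonnegative and cannot cancel. *)
Lemma inside_lipschitz eta1 eta2 : 0 < u * s ->
  0 < eta1 <= x ^+ 2 -> 0 < eta2 <= x ^+ 2 ->
  mnorm (M (pt eta1) - M (pt eta2)) * x <=
    2 * (5 * B ^+ 2 * b + c0) * `|eta1 - eta2|.
Proof.
move=> us he1 he2.
have [hz1 de1 d21 hr1 _] := pt_bounds he1.
have [hz2 de2 d22 hr2 _] := pt_bounds he2.
have i1 := inside_Im us he1; have i2 := inside_Im us he2.
set z1 := pt eta1 in hz1 de1 d21 hr1 i1 *.
set z2 := pt eta2 in hz2 de2 d22 hr2 i2 *.
set D := M z1 - M z2.
have eD : D = (M0 + Dl z2) *m ((z1 - z2)%:M + S D) *m (M0 + Dl z1).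
  rewrite ![M0 + _]addrC !subrK.
  exact: (two_point_sym hS (M_mde hM hz1.1) (M_mde hM hz2.1)).
pose r := Num.max (mnorm (Dl z1)) (mnorm (Dl z2)).
have r1l : mnorm (Dl z1) <= r by rewrite /r le_max lexx.
have r2l : mnorm (Dl z2) <= r by rewrite /r le_max lexx orbT.
have reps : r <= eps by rewrite /r ge_max de1.
have r2 : r ^+ 2 <= 2 * C3 * x ^+ 2.
  by rewrite /r /Num.max; case: ifP.
have r1 : r <= 1 by exact: le_trans reps (near_eps_le1 hF B1).
have hrD := rest_bound hS hF r1 r2l r1l eD.
have hq := coord_bound n0 hS hF r1 r2l r1l eD.
pose e := `|eta1 - eta2|.
have ce : cabs (z1 - z2) = e.
  have -> : z1 - z2 = 0 +i* (eta1 - eta2) by apply: eqC => /=; ring.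
  by rewrite cabs.unlock /= expr0n add0r sqrtr_sqr.
rewrite ce sE in hq; rewrite ce in hrD.
set t := cabs (th D).
have hy : mnorm D <= t * b + c0 * (e + r * mnorm D).
  rewrite {1}(vrest_decomp S V D); apply: le_trans (mnormD _ _) _.
  apply: lerD => //.
  by rewrite mnormZ ler_wpM2l ?cabs_ge0 //; exact: ef_V hF.
set g := cabs (th (Dl z2) + th (Dl z1)).
have hg : x / B <= g.
  have -> : x / B = x / (2 * B) + x / (2 * B) by field; rewrite gt_eqF.
  apply: le_trans (lerD i2 i1) _; rewrite -ImD.
  exact: le_trans (ler_norm _) (Im_le_cabs _).
have hlow : t * g * `|s| <= e + c0 * r * e + 2 * K1 * x ^+ 2 * mnorm D.
  rewrite -cabs_real -!cabsM; set Y := _ * s%:C in hq *.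
  have := cabsD (- (z1 - z2)) (z1 - z2 + Y); rewrite addKr cabsN ce => h.
  apply: le_trans h _; rewrite -[leRHS]addrA lerD2l; apply: le_trans hq _.
  rewrite mulrDr mulrA lerD2l mulrA ler_wpM2r ?mnorm_ge0 //.
  have -> : 2 * K1 * x ^+ 2 = c0 * (2 * C4 * x ^+ 2 + 2 * C4 * x ^+ 2 + 2 * C3 * x ^+ 2).
    by rewrite near_K1.unlock; ring.
  by rewrite (ler_pM2l c00); exact: lerD (lerD hr2 hr1) r2.
have [_ _ h8 h4] := near_slope_le (ltW x0) xs.
have /andP[sB1 _] := sB.
have [h hy2] := coordinate_dominates B1 (ltW c00) (ltW K10) (normr_ge0 _ : 0 <= e)
  (cabs_ge0 _ : 0 <= t) x01
  (near_eps_c0 reps) h8 h4 hy (mnorm_ge0 _) hg sB1 hlow.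
have := ler_wpM2r (ltW x0) hy2 => /le_trans; apply.
have -> : 2 * (t * b + c0 * e) * x = 2 * (b * (t * x) + c0 * e * x) by ring.
rewrite -/e -[leRHS]mulrA ler_pM2l // [leRHS]mulrDl; apply: lerD.
  by rewrite [5 * _ * b]mulrC -mulrA ler_pM2l.
by rewrite ler_piMr // mulr_ge0 ?normr_ge0 // ltW.
Qed.

(** The scalar equation says that the coordinate [Th] is close to a square root
    of [- u / s]; the factor [Th + i g] is at least [g] since the imaginary part
    of [Th] is nonnegative. The restriction to [eta <= x ^ 3] makes the
    contribution of [eta] an error term. *)
Lemma inside_value eta : 0 < u * s -> 0 < eta <= x ^+ 3 ->
  `|rtr (ImM (M (pt eta))) - x / Num.sqrt `|s| | <= near_error b B * x ^+ 2.
Proof.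
move=> us /andP[eta0 eta3].
have he : 0 < eta <= x ^+ 2.
  rewrite eta0; apply: le_trans eta3 _; rewrite exprS ler_piMl //; exact: ltW.
have [hz _ _ hr hq] := pt_bounds he.
have sn0 : 0 < `|s|.
  by have /andP[h _] := sB; apply: lt_le_trans h; rewrite invr_gt0.
pose g := x / Num.sqrt `|s|; rewrite -/g.
have g0 : 0 < g by rewrite divr_gt0 // sqrtr_gt0.
have g2 : g ^+ 2 * s = u.
  rewrite exprMn exprVn sqr_sqrtr ?ltW // -ux.
  have [s0|s0] := ltP 0 s.
    have u0 : 0 < u by rewrite -(pmulr_lgt0 _ s0).
    by rewrite !gtr0_norm // divfK // gt_eqF.
  have s0' : s < 0 by rewrite lt_neqAle s0 andbT -normr_gt0.
  have u0 : u < 0 by rewrite -(nmulr_lgt0 _ s0').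
  by rewrite !ltr0_norm // invrN mulrNN divfK // lt_eqF.
have gB : x / B <= g.
  rewrite ler_pM2l // lef_pV2 ?posrE ?sqrtr_gt0 //.
  have BB : `|s| <= B ^+ 2 by apply: le_trans s_abs_le _; rewrite expr2 ler_peMl // ltW.
  have eB : B = Num.sqrt (B ^+ 2) by rewrite sqrtr_sqr ger0_norm // ltW.
  by rewrite [leRHS]eB ler_sqrt // exprn_ge0 // ltW.
set Th := th (Dl (pt eta)) in hq *.
have Im0 : 0 <= complex.Im Th by exact: vcoord_Im_ge0 hz.1.
have h1 : `|rtr (ImM (M (pt eta))) - complex.Im Th| <= 2 * C4 * x ^+ 2.
  rewrite rtr_ImM_Dl {1}(vrest_decomp S V (Dl (pt eta))) ntrD ntrZ (ef_ntr hF).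
  rewrite mulr1 -/Th ImD addrAC subrr add0r.
  exact: le_trans (Im_le_cabs _) (le_trans (cabs_ntr n0 _) hr).
have h2 : `|complex.Im Th - g| * g <= B * ((1 + 4 * C5 * C3) * x ^+ 3).
  have f1 : cabs ((Th - (0 +i* g)) * (Th + (0 +i* g)) * s%:C) <=
      (1 + 4 * C5 * C3) * x ^+ 3.
    have -> : (Th - (0 +i* g)) * (Th + (0 +i* g)) * s%:C =
       (u +i* eta + Th ^+ 2 * s%:C) - (0 +i* eta).
      by rewrite -g2; move: (Th) => [p q]; apply: eqC => /=; ring.
    apply: le_trans (cabsD _ _) _; rewrite cabsN mulrDl mul1r addrC.
    apply: lerD => //; rewrite cabs.unlock /= expr0n add0r sqrtr_sqr.
    by rewrite gtr0_norm.
  apply: (@le_trans _ _ (cabs (Th - (0 +i* g)) * cabs (Th + (0 +i* g)))).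
    apply: ler_pM; rewrite ?normr_ge0 ?(ltW g0) //.
      by have := Im_le_cabs (Th - (0 +i* g)); rewrite ImD ImN.
    have := le_trans (ler_norm _) (Im_le_cabs (Th + (0 +i* g))).
    by rewrite ImD /=; lra.
  rewrite -cabsM; apply: le_trans (sigma_scale B1 sB (cabs_ge0 _)) _.
  by rewrite ler_pM2l // -cabs_real -cabsM.
have h3 : `|complex.Im Th - g| <= B ^+ 2 * (1 + 4 * C5 * C3) * x ^+ 2.
  rewrite -(ler_pM2r g0); apply: le_trans h2 _.
  have k0' : 0 <= B ^+ 2 * (1 + 4 * C5 * C3) * x ^+ 2.
    by rewrite !mulr_ge0 ?exprn_ge0 ?addr_ge0 ?mulr_ge0 ?ltW.
  apply: le_trans (ler_wpM2l k0' gB).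
  rewrite le_eqVlt; apply/orP; left; apply/eqP; field; exact: lt0r_neq0.
have := ler_normD (rtr (ImM (M (pt eta))) - complex.Im Th) (complex.Im Th - g).
rewrite subrKA => /le_trans; apply.
by rewrite /near_error mulrDl addrC lerD.
Qed.

End AtPoint.
End EdgeSides.

Section DensitySides.
Context {R : realType}.
Variables (n : nat) (S : 'M[R[i]]_n -> 'M[R[i]]_n) (c C : R).
Hypothesis n0 : (0 < n)%N.
Hypothesis hS : energy_map S c C.
Variable A : 'M[R[i]]_n.
Hypothesis hA : A^t* = A.
Variable M : R[i] -> 'M[R[i]]_n.
Hypothesis hM : is_MDE_solution A S M.
Variables (tau w0 k0 : R).
Hypothesis w00 : 0 < w0.
Hypothesis hgreen : forall z, upper_half z -> `|complex.Re z - tau| <= w0 ->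
  complex.Im z <= 1 -> mnorm (M z) <= k0.
Variables (M0 V : 'M[R[i]]_n) (b B s : R).
Hypothesis e0 : mde_eq S A tau%:C M0.
Hypothesis hF : edge_frame S M0 V b.
Hypothesis B1 : 1 <= B.
Hypothesis sE : edge_sigma S M0 V = s%:C.
Hypothesis sB : B^-1 <= `|s| <= B.
Hypothesis hbase : forall eps d : R, 0 < eps -> 0 < d ->
  exists2 z, half_disc tau d z & mnorm (M z - M0) <= eps.

Local Notation rad := (near_radius b B w0).

Let scdosH_ge0 z : upper_half z -> 0 <= scdosH M z.
Proof.
move=> hz; rewrite scdosHE divr_ge0 ?pi_ge0 // ltW //.
exact: (M_rtr_gt0 n0 hM).
Qed.

Section AtPoint.
Variables (u x : R).
Hypothesis x0 : 0 < x.
Hypothesis ux : `|u| = x ^+ 2.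
Hypothesis xs : near_slope b B * x <= 1.
Hypothesis xr : 2 * x ^+ 2 < rad.

Let x20 : 0 < x ^+ 2. Proof. by rewrite exprn_gt0. Qed.

Lemma density_outside : u * s < 0 -> scdos M (tau + u) = 0.
Proof.
move=> us; apply: scdos_lim.
pose K := 5 * B ^+ 2 * b / (pi * x).
apply: (@squeeze0 _ _ _ _ _ (fun eta => K * eta)).
  near=> eta.
  have eta0 : 0 < eta by near: eta; apply: nbhs_right_gt.
  have etax : eta < x ^+ 2 by near: eta; apply: nbhs_right_lt.
  have he : 0 < eta <= x ^+ 2 by rewrite eta0 ltW.
  rewrite scdosH_ge0 //= scdosHE.
  have := outside_bound n0 hS hA hM w00 hgreen e0 hF B1 sE sB hbase x0 ux xs xr us he.
  move: (rtr _) => r h; rewrite ler_pdivrMr ?pi_gt0 //.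
  rewrite -(ler_pM2r x0); apply: le_trans h _.
  rewrite le_eqVlt; apply/orP; left; apply/eqP; rewrite /K.
  have := pi_gt0 R; move: (pi) => p p0; field.
  by rewrite !lt0r_neq0.
rewrite -[X in _ --> X](mulr0 K); apply: cvgMr.
apply: cvg_at_right_filter; exact: cvg_id.
Unshelve. all: by end_near. Qed.

(** The Lipschitz bound provides the existence of the limit. *)
Lemma density_inside : 0 < u * s ->
  `|scdos M (tau + u) - (pi * Num.sqrt `|s|)^-1 * x| <=
    near_error b B / pi * x ^+ 2.
Proof.
move=> us.
pose K := 2 * (5 * B ^+ 2 * b + edge_c0 b) / (x * pi).
have lip t1 t2 : 0 < t1 < x ^+ 2 -> 0 < t2 < x ^+ 2 ->
    `|scdosH M ((tau + u) +i* t1) - scdosH M ((tau + u) +i* t2)| <=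
    K * `|t1 - t2|.
  move=> /andP[h1 h2] /andP[h3 h4].
  have ht1 : 0 < t1 <= x ^+ 2 by rewrite h1 ltW.
  have ht2 : 0 < t2 <= x ^+ 2 by rewrite h3 ltW.
  have := inside_lipschitz n0 hS hA hM w00 hgreen e0 hF B1 sE sB hbase x0 ux xs
    xr us ht1 ht2.
  move=> h; apply: le_trans (scdosH_dist n0 M _ _) _.
  move: h; move: (mnorm _) `|_ - _| => m t h.
  rewrite ler_pdivrMr ?pi_gt0 // -(ler_pM2r x0); apply: le_trans h _.
  rewrite le_eqVlt; apply/orP; left; apply/eqP; rewrite /K.
  have := pi_gt0 R; move: (pi) => p p0; field.
  by rewrite !lt0r_neq0.
have [l hl] := lipschitz_cvg_at_right x20 lip.
rewrite (scdos_lim hl).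
pose g := (pi * Num.sqrt `|s|)^-1 * x.
have hc : `|scdosH M ((tau + u) +i* eta) - g| @[eta --> 0^'+] --> `|l - g|.
  by apply: cvg_norm; apply: cvgB hl _; exact: cvg_cst.
apply: cvg_le hc _; near=> eta.
have eta0 : 0 < eta by near: eta; apply: nbhs_right_gt.
have etax : eta < x ^+ 3.
  by near: eta; apply: nbhs_right_lt; rewrite exprn_gt0.
have he : 0 < eta <= x ^+ 3 by rewrite eta0 ltW.
have := inside_value n0 hS hA hM w00 hgreen e0 hF B1 sE sB hbase x0 ux xs xr us he.
rewrite scdosHE /g; move: (rtr _) (Num.sqrt _) => r q h.
have -> : r / pi - (pi * q)^-1 * x = (r - x / q) / pi by rewrite invfM; ring.
rewrite normrM (ger0_norm (x := pi^-1)); last by rewrite invr_ge0 pi_ge0.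
by rewrite [leRHS]mulrAC ler_pM2r ?invr_gt0 ?pi_gt0.
Unshelve. all: by end_near. Qed.

End AtPoint.

Lemma density_at_edge : scdos M tau = 0.
Proof.
apply: scdos_lim; pose C3 := near_C3 b B.
have rad0 : 0 < rad by exact: (near_radius_gt0 w00 hF B1).
apply: (@squeeze0 _ _ _ _ _ (fun eta => pi^-1 * Num.sqrt (C3 * eta))).
  near=> eta.
  have eta0 : 0 < eta by near: eta; apply: nbhs_right_gt.
  have etar : eta < rad by near: eta; apply: nbhs_right_lt.
  have ce : cabs (tau +i* eta - tau%:C) = eta.
    have -> : tau +i* eta - tau%:C = 0 +i* eta by apply: eqC => /=; ring.
    by rewrite cabs.unlock /= expr0n add0r sqrtr_sqr gtr0_norm.
  have hz : half_disc tau rad (tau +i* eta) by split; rewrite // ce.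
  have [_ h _ _] := near_edge n0 hS hA hM w00 hgreen e0 hF B1 sE sB hbase hz.
  rewrite ce in h; rewrite scdosH_ge0 //= scdosHE mulrC.
  rewrite ler_pM2l ?invr_gt0 ?pi_gt0 //.
  have := rtr_ImM_dist n0 (M (tau +i* eta)) M0.
  have -> : rtr (ImM M0) = 0 by rewrite (ImM_M0 hF) /rtr /ntr mxtrace0 mul0r.
  rewrite subr0 => /(le_trans (ler_norm _)) /le_trans; apply.
  rewrite -(ger0_norm (mnorm_ge0 (M (tau +i* eta) - M0))) -sqrtr_sqr.
  by rewrite ler_sqrt // (le_trans _ h) // sqr_ge0.
rewrite -[X in _ --> X](mulr0 (pi^-1 : R)); apply: cvgMr.
rewrite -[X in _ --> X](sqrtr0 R) -[X in Num.sqrt X](mulr0 C3).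
apply: (continuous_cvg _ (@sqrt_continuous R (C3 * 0))).
by apply: cvgMr; apply: cvg_at_right_filter; exact: cvg_id.
Unshelve. all: by end_near. Qed.

Lemma density_sides d u : d * near_slope b B ^+ 2 <= 1 -> 2 * d < rad ->
  `|u| <= d ->
  (u * s <= 0 -> scdos M (tau + u) = 0) /\
  (0 <= u * s ->
   `|scdos M (tau + u) - (pi * Num.sqrt `|s|)^-1 * Num.sqrt `|u| | <=
     near_error b B / pi * `|u|).
Proof.
move=> hd1 hd2 ud; have [->|u0] := eqVneq u 0.
  rewrite addr0 density_at_edge normr0 sqrtr0 !mulr0 subrr normr0.
  by split.
pose x := Num.sqrt `|u|.
have x0 : 0 < x by rewrite sqrtr_gt0 normr_gt0.
have ux : `|u| = x ^+ 2 by rewrite sqr_sqrtr.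
have xr : 2 * x ^+ 2 < rad.
  by apply: le_lt_trans hd2; rewrite -ux ler_pM2l.
have xs : near_slope b B * x <= 1.
  have [h|h] := leP (near_slope b B * x) 0; first exact: le_trans h ler01.
  rewrite -(@expr_le1 _ 2) ?(ltW h) // exprMn mulrC -ux.
  by apply: le_trans hd1; rewrite ler_wpM2r ?sqr_ge0.
have s0 : s != 0.
  rewrite -normr_gt0; have /andP[h _] := sB; apply: lt_le_trans h.
  by rewrite invr_gt0; exact: lt_le_trans B1.
have us0 : u * s != 0 by rewrite mulf_neq0.
split=> us.
  by apply: (density_outside x0 ux xs xr); rewrite lt_neqAle us0.
rewrite -/x [X in _ / pi * X]ux; apply: (density_inside x0 ux xs xr).
by rewrite lt_neqAle eq_sym us0.
Qed.

End DensitySides.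

(** * Edges of a support *)

Section SupportEdge.
Context {R : realType}.
Variables (rho : R -> R) (tau c K d sg : R).
Hypothesis c0 : 0 < c.
Hypothesis K0 : 0 < K.
Hypothesis d0 : 0 < d.
Hypothesis sg1 : `|sg| = 1.
Hypothesis inside : forall w, - d <= w <= 0 ->
  `|rho (tau + sg * w) - c * Num.sqrt `|w| | <= K * `|w|.
Hypothesis outside : forall w, 0 <= w <= d -> rho (tau + sg * w) = 0.

Let e := Num.min d (c ^+ 2 / K ^+ 2).

Let e0 : 0 < e.
Proof. by rewrite lt_min d0 divr_gt0 ?exprn_gt0. Qed.

Let ed : e <= d.
Proof. by rewrite ge_min lexx. Qed.

Let rho_neq0 w : - e < w < 0 -> rho (tau + sg * w) != 0.
Proof.
move=> /andP[ew w0].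
have wd : - d <= w <= 0 by rewrite (ltW w0) andbT; have := ed; lra.
have h := inside wd; apply: contraTneq h => ->; rewrite -ltNge.
set x := Num.sqrt `|w|.
have x0 : 0 < x by rewrite sqrtr_gt0 normr_gt0 lt_eqF.
have wx : `|w| = x ^+ 2 by rewrite sqr_sqrtr.
rewrite sub0r normrN [`|c * x|]gtr0_norm ?mulr_gt0 // wx expr2 mulrA ltr_pM2r //.
rewrite -(@ltr_pXn2r _ 2) ?nnegrE ?mulr_ge0 ?ltW // exprMn -wx.
rewrite (ltr0_norm w0) mulrC -ltr_pdivlMr ?exprn_gt0 //.
apply: (@lt_le_trans _ _ e); first by lra.
by rewrite ge_min lexx orbT.
Qed.

(** Close to the edge the square root dominates the linear error. *)
Lemma supp_side w : `|w| < e -> supp rho (tau + sg * w) <-> w <= 0.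
Proof.
move=> we; split=> [hs|w0].
  rewrite leNgt; apply/negP => w0; rewrite (gtr0_norm w0) in we.
  pose m := Num.min w (e - w).
  have m0 : 0 < m by rewrite lt_min w0 subr_gt0.
  have [mw me] : m <= w /\ m <= e - w by rewrite /m !ge_min !lexx orbT.
  have [t [ht1 ht2]] := hs _ (nbhsx_ballx (tau + sg * w) m m0).
  move: ht1 => /eqP; apply.
  have ss : sg * sg = 1.
    by rewrite -expr2 -(real_normK (num_real sg)) sg1 expr1n.
  have -> : t = tau + sg * (sg * (t - tau)).
    by rewrite mulrA ss mul1r addrC subrK.
  apply: outside.
  have : `|w - sg * (t - tau)| < m.
    move: ht2; rewrite /ball /=.
    have -> : tau + sg * w - t = sg * (w - sg * (t - tau)).
      by rewrite mulrBr mulrA ss mul1r; ring.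
    by rewrite normrM sg1 mul1r.
  rewrite ltr_norml => /andP[h1 h2]; have := ed.
  by move: (sg * _) h1 h2 => y h1 h2; lra.
have [w00|w00] := ltP w 0.
  apply: subset_closure; apply: rho_neq0; rewrite w00 andbT.
  by move: we; rewrite ltr0_norm //; lra.
have -> : w = 0 by apply/eqP; rewrite eq_le w0.
move=> U /nbhs_ballP[r r0 hr].
pose m := Num.min r e; have m0 : 0 < m by rewrite lt_min e0 andbT.
have mr : m <= r by rewrite ge_min lexx.
have me : m <= e by rewrite ge_min lexx orbT.
exists (tau + sg * - (m / 2)); split; first by apply: rho_neq0; lra.
apply: hr; rewrite /ball /= mulr0 addr0.
have -> : tau - (tau + sg * - (m / 2)) = sg * (m / 2) by ring.
by rewrite normrM sg1 mul1r gtr0_norm; lra.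
Qed.

End SupportEdge.

Section EdgeKinds.
Context {R : realType}.
Variables (rho : R -> R) (tau c K d : R).
Hypothesis c0 : 0 < c.
Hypothesis K0 : 0 < K.
Hypothesis d0 : 0 < d.

Let e := Num.min d (c ^+ 2 / K ^+ 2).

Let e0 : 0 < e.
Proof. by rewrite lt_min d0 divr_gt0 ?exprn_gt0. Qed.

Lemma right_edge_expansion :
  (forall w, - d <= w <= 0 ->
     `|rho (tau + 1 * w) - c * Num.sqrt `|w| | <= K * `|w|) ->
  (forall w, 0 <= w <= d -> rho (tau + 1 * w) = 0) ->
  right_edge (supp rho) tau.
Proof.
move=> hin hout; exists e => //.
have side t : `|t - tau| < e -> supp rho t <-> t <= tau.
  have := supp_side c0 K0 d0 (normr1 R) hin hout (w := t - tau).
  by rewrite mul1r [tau + _]addrC subrK subr_le0.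
apply/seteqP; split=> t /=; rewrite !in_itv /=.
  move=> [ht /andP[h1 h2]]; rewrite h1 /=; apply/side => //.
  by rewrite ltr_distl h1.
move=> /andP[h1 h2]; have h3 : t < tau + e by apply: le_lt_trans h2 _; rewrite ltrDl.
by rewrite h1 h3; split=> //; apply/side; rewrite // ltr_distl h1.
Qed.

Lemma left_edge_expansion :
  (forall w, - d <= w <= 0 ->
     `|rho (tau + -1 * w) - c * Num.sqrt `|w| | <= K * `|w|) ->
  (forall w, 0 <= w <= d -> rho (tau + -1 * w) = 0) ->
  left_edge (supp rho) tau.
Proof.
have n1 : `|-1 : R| = 1 by rewrite normrN normr1.
move=> hin hout; exists e => //.
have side t : `|tau - t| < e -> supp rho t <-> tau <= t.
  have := supp_side c0 K0 d0 n1 hin hout (w := tau - t).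
  by rewrite (_ : tau + -1 * (tau - t) = t) ?subr_le0 //; ring.
apply/seteqP; split=> t /=; rewrite !in_itv /=.
  move=> [ht /andP[h1 h2]]; rewrite h2 andbT; apply/side => //.
  by rewrite ltr_distlC h1.
move=> /andP[h1 h2]; have h3 : tau - e < t.
  by apply: lt_le_trans h1; rewrite ltrBlDr ltrDl.
by rewrite h2 h3; split=> //; apply/side; rewrite // ltr_distlC h3.
Qed.

End EdgeKinds.

(** * The regular edge *)

Theorem theorem4p1 (R : realType)
  (C_exp c_flat C_flat omega_star M_star c_edge C_edge : R)
  (hc_flat : 0 < c_flat) (hC_flat : c_flat < C_flat)
  (homega : 0 < omega_star) (hM_star : 0 < M_star)
  (hc_edge : 0 < c_edge) :
  (* K bounds every implicit constant: it depends on the model parameters only *)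
  exists2 K : R, 0 < K &
    forall (N : nat) (hN : (0 < N)%N) (A : 'M[R[i]]_N)
      (d : measure_display) (T : measurableType d) (P : probability T R)
      (W : T -> 'M[R[i]]_N) (M : R[i] -> 'M[R[i]]_N) (tau0 : R),
    selfadjoint A ->
    centered_hermitian_random_matrix P W ->
    is_MDE_solution A (self_energy P W) M ->
    opnorm A <= C_exp ->
    flat (self_energy P W) c_flat C_flat ->
    green_bounded_near M tau0 omega_star M_star ->
    regular_edge (scdos M) c_edge C_edge tau0 ->
    exists c delta s : R,
      [/\ K^-1 <= c <= K,
          K^-1 <= delta <= K,
          (s = 1 /\ right_edge (supp (scdos M)) tau0) \/
          (s = -1 /\ left_edge (supp (scdos M)) tau0),
          (forall omega : R, - delta <= omega <= 0 ->
             `|scdos M (tau0 + s * omega) - c * Num.sqrt `|omega| |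
               <= K * `|omega|) &
          (forall omega : R, 0 <= omega <= delta ->
             scdos M (tau0 + s * omega) = 0)].
Proof.
(* [M_star] bounds the limit of [M] at the edge, and [B] bounds [gamma ^ - 3],
   the modulus of [sigma], from both sides. *)
pose b : R := edge_const c_flat C_flat (base_const C_flat M_star `|C_exp|).
pose B : R := 1 + c_edge ^- 3 + `|C_edge| ^+ 3.
pose m : R := near_slope b B.
pose d : R := Num.min (m ^- 2) (near_radius b B omega_star / 4).
pose E : R := near_error b B / pi.
pose K : R := 1 + `|E| + `|d| + `|d^-1| + pi * B.
have ce3 : 0 < c_edge ^- 3 by rewrite invr_gt0 exprn_gt0.
have Ce3 : 0 <= `|C_edge| ^+ 3 by rewrite exprn_ge0.
have B1 : 1 <= B by move: ce3 Ce3; rewrite /B; move: (c_edge ^- 3) (`|C_edge| ^+ 3) => x y; lra.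
have B0 : 0 < B by exact: lt_le_trans B1.
have pB : 0 < pi * B by rewrite mulr_gt0 ?pi_gt0.
have [K1 [KE [Kd [Kdi KB]]]] :
    1 <= K /\ `|E| <= K /\ `|d| <= K /\ `|d^-1| <= K /\ pi * B <= K.
  have := normr_ge0 E; have := normr_ge0 d; have := normr_ge0 (d^-1); move: pB.
  rewrite /K; move: `|E| `|d| `|d^-1| (pi * B) => x y z w *.
  by do !split; lra.
have K0 : 0 < K by exact: lt_le_trans K1.
exists K => // N hN A dd T P W M tau0 sA hW hM hCe hflat hgreen hedge.
set S := self_energy P W in hM hflat.
have hS : energy_map S c_flat C_flat.
  exact: (self_energy_energy_map hW hc_flat (ltW hC_flat) hflat).
have hA : mnorm A <= `|C_exp|.
  by rewrite mnorm.unlock; exact: le_trans hCe (ler_norm _).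
have hg z : upper_half z -> `|complex.Re z - tau0| <= omega_star ->
    complex.Im z <= 1 -> mnorm (M z) <= M_star.
  by rewrite mnorm.unlock; exact: hgreen.
have [M0 [V [g /andP[g1 g2] [e0 hF sg hbase]]]] :=
  edge_base hN hS sA hM homega hM_star hg hc_edge hA hedge.
rewrite -/b in hF.
have sE := real_of_conj (sigma_real hS hF).
set s := complex.Re _ in sE.
have g0 : 0 < g by exact: lt_le_trans g1.
have sB : B^-1 <= `|s| <= B.
  rewrite -cabs_real -sE sg lef_pV2 ?posrE ?exprn_gt0 //; apply/andP; split.
    apply: (@le_trans _ _ (`|C_edge| ^+ 3)).
      rewrite ler_pXn2r ?nnegrE ?normr_ge0 ?(ltW g0) //.
      exact: le_trans g2 (ler_norm _).
    by rewrite /B; move: ce3; move: (c_edge ^- 3) (`|C_edge| ^+ 3) => x y; lra.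
  apply: (@le_trans _ _ (c_edge ^- 3)).
    by rewrite lef_pV2 ?posrE ?exprn_gt0 // ler_pXn2r ?nnegrE ?(ltW hc_edge) ?(ltW g0).
  by rewrite /B; move: Ce3; move: (c_edge ^- 3) (`|C_edge| ^+ 3) => x y; lra.
have sn0 : 0 < `|s|.
  by have /andP[h _] := sB; apply: lt_le_trans h; rewrite invr_gt0.
have rad0 : 0 < near_radius b B omega_star by exact: (near_radius_gt0 homega hF B1).
have m0 : 0 < m by exact: (near_slope_gt0 hF B1).
have m20 : 0 < m ^- 2 by rewrite invr_gt0 exprn_gt0.
have d0 : 0 < d by rewrite lt_min m20 divr_gt0.
have dm : d * m ^+ 2 <= 1.
  by rewrite -ler_pdivlMr ?exprn_gt0 // mul1r ge_min lexx.
have dr : 2 * d < near_radius b B omega_star.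
  have : d <= near_radius b B omega_star / 4 by rewrite ge_min lexx orbT.
  by move: rad0; move: (near_radius _ _ _) (d) => x y; lra.
have sides := density_sides hN hS sA hM homega hg e0 hF B1 sE sB hbase dm dr.
(* The support lies where [omega] and [sigma] have the same sign. *)
pose c : R := (pi * Num.sqrt `|s|)^-1.
have c0 : 0 < c by rewrite invr_gt0 mulr_gt0 ?pi_gt0 ?sqrtr_gt0.
pose sgn : R := if 0 < s then -1 else 1.
have sgn_s : sgn * s = - `|s|.
  rewrite /sgn; case: ltP => s0; first by rewrite (gtr0_norm s0) mulN1r.
  by rewrite (ler0_norm s0) opprK mul1r.
have sgn1 : `|sgn| = 1 by rewrite /sgn; case: ifP; rewrite ?normrN normr1.
have inside w : - d <= w <= 0 ->
    `|scdos M (tau0 + sgn * w) - c * Num.sqrt `|w| | <= K * `|w|.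
  move=> /andP[w1 w2].
  have [|_ h] := sides (sgn * w).
    by rewrite normrM sgn1 mul1r ler0_norm // lerNl.
  have ws : 0 <= sgn * w * s.
    by rewrite mulrAC sgn_s mulNr -mulrN mulr_ge0 ?oppr_ge0 // ltW.
  have := h ws; rewrite normrM sgn1 mul1r => /le_trans; apply.
  by rewrite ler_wpM2r //; exact: le_trans (ler_norm _) KE.
have outside w : 0 <= w <= d -> scdos M (tau0 + sgn * w) = 0.
  move=> /andP[w1 w2]; have [|h _] := sides (sgn * w).
    by rewrite normrM sgn1 mul1r ger0_norm.
  by apply: h; rewrite mulrAC sgn_s mulNr oppr_le0 mulr_ge0.
exists c, d, sgn; split=> //.
- have sq1 : Num.sqrt `|s| <= B.
    have eB : B = Num.sqrt (B ^+ 2) by rewrite sqrtr_sqr ger0_norm // ltW.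
    rewrite eB ler_sqrt ?exprn_ge0 ?(ltW B0) //.
    have /andP[_ h] := sB; apply: le_trans h _; by rewrite expr2 ler_peMl ?(ltW B0).
  have sq2 : B^-1 <= Num.sqrt `|s|.
    have Bi0 : 0 <= B^-1 by rewrite invr_ge0 ltW.
    have eB : B^-1 = Num.sqrt (B^-1 ^+ 2) by rewrite sqrtr_sqr ger0_norm.
    rewrite eB ler_sqrt ?normr_ge0 //.
    have /andP[h _] := sB; apply: le_trans h; by rewrite expr2 ler_piMl ?invf_le1.
  apply/andP; split.
    rewrite lef_pV2 ?posrE ?mulr_gt0 ?pi_gt0 ?sqrtr_gt0 //.
    by apply: le_trans KB; rewrite ler_pM2l ?pi_gt0.
  apply: (@le_trans _ _ B); last first.
    apply: le_trans KB; rewrite ler_peMl ?(ltW B0) //.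
    by apply: le_trans (@pi_ge2 R); rewrite ler1n.
  rewrite -[leRHS]invrK lef_pV2 ?posrE ?invr_gt0 ?mulr_gt0 ?pi_gt0 ?sqrtr_gt0 //.
  apply: le_trans sq2 _; rewrite ler_peMl ?sqrtr_ge0 //.
  by apply: le_trans (@pi_ge2 R); rewrite ler1n.
- apply/andP; split; last exact: le_trans (ler_norm _) Kd.
  rewrite -[leRHS]invrK lef_pV2 ?posrE ?invr_gt0 //.
  exact: le_trans (ler_norm _) Kdi.
- rewrite /sgn in inside outside *; case: ltP inside outside => s0 hin hout.
    by right; split=> //; exact: (left_edge_expansion c0 K0 d0 hin hout).
  by left; split=> //; exact: (right_edge_expansion c0 K0 d0 hin hout).
Qed.
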